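(* Let $W$ be an ordinary holomorphic $d$-web of codimension one on a complex manifold $M$ of dimension $n\ge2$, with $d>n$. Assume that $\pi_{h+1}:R_{h+1}\to R_h$ has constant rank on $M$ for every $h\ge h_0-2$, and let $\rho_h$ be the rank of $R_h$. Then the sequence $(\rho_h)_{h\ge h_0-2}$ is (weakly) decreasing from $\rho_{h_0-2}=\pi'(n,d)$ to the rank $\rho(W)$ of the web (i.e. $\rho_h=\rho(W)$ for all sufficiently large $h$), and for every $h\ge h_0-2$ it satisfies the inequalities $$(h+2)d-\beta_{h+2}\ \le\ \rho_{h+1}\ \le\ \rho_h\ \le\ \pi'(n,d).$$
   Context: **Webs.** A (totally decomposable) holomorphic $d$-web $W$ of codimension one, without singularity, on a complex $n$-dimensional manifold $M$ is the data of $d$ holomorphic regular foliations $\mathcal F_1,\dots,\mathcal F_d$ of codimension one on $M$, any two of them being transverse to each other at every point. It is assumed to be at least in weak general position: at every point there are at least $n$ of the $d$ foliations whose tangent spaces there are in general position. Locally $\mathcal F_i$ is defined by a first integral $u_i$ with $du_i$ nowhere zero. **Abelian relations and rank.** An abelian relation on a connected, simply connected open set $U$ is a family $(\omega_i)_{1\le i\le d}$ of holomorphic closed 1-forms on $U$ (possibly vanishing at some points) such that $T\mathcal F_i\subset\ker\omega_i$ for each $i$ and $\sum_i\omega_i=0$. The rank of $W$ at a point is the dimension of the vector space of germs of abelian relations there; the rank $\rho(W)$ is the highest of the ranks at the points of $M$. **Formal abelian relations.** $A_i\subset T^*M$ is the line bundle of 1-forms vanishing on $T\mathcal F_i$. $A$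 is the kernel of $Tr:\bigoplus_{i=1}^d A_i\to T^*M$, $(\omega_i)_i\mapsto\sum_i\omega_i$, a holomorphic vector bundle of rank $d-n$. Let $B=(\wedge^2T^*M)^{\oplus d}$ and let $D$ be the first order differential operator $(\omega_i)_i\mapsto(d\omega_i)_i$ from sections of $A$ to sections of $B$. For $h\ge1$, $D_h:J^hA\to J^{h-1}B$ is the prolongation $j^hs\mapsto j^{h-1}(Ds)$, and $R_h=\ker D_h\subset J^hA$; $R_0=A$. The map $\pi_{h+1}:R_{h+1}\to R_h$ is truncation of jets, linear on each fibre. The rank $\rho_h$ of $R_h$ is the dimension of its fibres (when it does not depend on the point). **Numbers.** $c(n,h)=\frac{(n-1+h)!}{(n-1)!\,h!}$; $\beta_k=\sum_{h=1}^kc(n,h)=c(n+1,k)-1$; $h_0$ is the integer with $c(n,h_0-1)<d\le c(n,h_0)$; $\pi'(n,d)=\sum_{h=1}^{h_0-1}\big(d-c(n,h)\big)=(h_0-1)d-\beta_{h_0-1}$. **Ordinary webs.** In local coordinates $(x_1,\dots,x_n)$, for $j\ge1$ let $P_j$ be the $c(n,j)\times d$ matrix with rows indexed by the multi-indices $L=(\ell_1,\dots,\ell_n)$ of degree $|L|=\sum_\lambda \ell_\lambda=j$, columns by $i\in\{1,\dots,d\}$, and entries $\prod_{\lambda=1}^n(\partial u_i/\partial x_\lambda)^{\ell_\lambda}$. $W$ is ordinary if for every $j\ge1$ the matrix $P_j$ has maximal rank $\inf(d,c(n,j))$ at every point. *)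

(* Defs.v *)
From HB Require Import structures.
From mathcomp Require Import all_boot all_order all_algebra.
From mathcomp Require Import complex.
From mathcomp Require Import all_classical all_reals all_analysis.

Set Implicit Arguments.
Unset Strict Implicit.
Unset Printing Implicit Defensive.

Import Order.TTheory GRing.Theory Num.Theory.
Import numFieldNormedType.Exports.

Local Open Scope classical_set_scope.
Local Open Scope ring_scope.

(* The complex field, as a type whose norm is the modulus. *)
Definition Cplx (R : realType) : numClosedFieldType := R[i].

(* C-differentiability at every point, i.e. holomorphy when O is open. *)
Definition holomorphic_on (R : realType) (V W : normedModType (Cplx R))
    (O : set V) (f : V -> W) : Prop :=
  forall x, O x -> differentiable f x.

(* [chart_inv] is only meaningful on the image of [chart_dom]. *)
Record chart (R : realType) (T : topologicalType) (n : nat) := Chart {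
  chart_dom : set T;
  chart_map : T -> 'rV[Cplx R]_n;
  chart_inv : 'rV[Cplx R]_n -> T;
  chart_dom_open : open chart_dom;
  chart_img_open : open (chart_map @` chart_dom);
  chart_mapK : forall p, chart_dom p -> chart_inv (chart_map p) = p;
  chart_map_cont : {within chart_dom, continuous chart_map};
  chart_inv_cont : {within chart_map @` chart_dom, continuous chart_inv} }.

Record complexManifold (R : realType) (n : nat) := ComplexManifold {
  carrier :> topologicalType;
  atlas : set (chart R carrier n);
  manifold_inhabited : [set: carrier] !=set0;
  manifold_hausdorff : hausdorff_space carrier;
  manifold_second_countable : @second_countable carrier;
  atlas_cover : forall p : carrier, exists2 k, atlas k & chart_dom k p;
  atlas_holomorphic : forall k l, atlas k -> atlas l ->
    holomorphic_on (chart_map k @` (chart_dom k `&` chart_dom l))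
      (chart_map l \o chart_inv k) }.
Arguments atlas {R n} c _.

Definition chart_at (R : realType) (n : nat) (M : complexManifold R n) (p : M)
    : set (chart R M n) :=
  [set k : chart R M n | atlas M k /\ chart_dom k p].

(* The differential at p of u : M -> C, read in the chart k, where a tangent
   vector is a row of n complex coordinates. *)
Definition dfun (R : realType) (n : nat) (M : complexManifold R n)
    (k : chart R M n) (u : M -> Cplx R) (p : M) (v : 'rV[Cplx R]_n) : Cplx R :=
  derive (u \o chart_inv k : 'rV[Cplx R]_n -> (Cplx R)^o) (chart_map k p) v.

(* A regular holomorphic foliation of codimension one, presented by local first
   integrals u on open sets U; two of them have the same tangent hyperplanes on
   the overlap of their domains. *)
Record foliation (R : realType) (n : nat) (M : complexManifold R n) :=
  Foliation {
  first_int : set (set M * (M -> Cplx R));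
  first_int_open : forall U u, first_int (U, u) -> open U;
  first_int_cover : forall p, exists U u, first_int (U, u) /\ U p;
  first_int_holomorphic : forall U u k, first_int (U, u) -> atlas M k ->
    holomorphic_on (chart_map k @` (chart_dom k `&` U))
      (u \o chart_inv k : 'rV[Cplx R]_n -> (Cplx R)^o);
  first_int_regular : forall U u p k, first_int (U, u) -> U p ->
    chart_at p k -> exists v, dfun k u p v <> 0;
  first_int_compat : forall U u U' u' p k,
    first_int (U, u) -> first_int (U', u') -> U p -> U' p -> chart_at p k ->
    [set v | dfun k u p v = 0] = [set v | dfun k u' p v = 0] }.
Arguments first_int {R n M} f _.

Definition local_first_int (R : realType) (n : nat) (M : complexManifold R n)
    (F : foliation M) (p : M) (u : M -> Cplx R) : Prop :=
  exists2 U, first_int F (U, u) & U p.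

(* The tangent hyperplane T_p F, read in the chart k. *)
Definition tangent (R : realType) (n : nat) (M : complexManifold R n)
    (F : foliation M) (k : chart R M n) (p : M) : set 'rV[Cplx R]_n :=
  [set v | exists2 u, local_first_int F p u & dfun k u p v = 0].

(* In [web_weak_general], n hyperplanes of an n-dimensional space are in general
   position iff their intersection has codimension n, i.e. is 0. *)
Record web (R : realType) (n : nat) (M : complexManifold R n) (d : nat) := Web {
  foliations :> 'I_d -> foliation M;
  web_transverse : forall i j p k, i != j -> chart_at p k ->
    forall v, exists a b, tangent (foliations i) k p a /\
      tangent (foliations j) k p b /\ v = a + b;
  web_weak_general : forall p k, chart_at p k ->
    exists s : 'I_n -> 'I_d, injective s /\
      \bigcap_(j in [set: 'I_n]) tangent (foliations (s j)) k p = [set 0] }.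

(* S / N has dimension r, for linear subspaces S and N of V with N inside S. *)
Definition has_dim_mod (K : fieldType) (V : lmodType K) (S N : set V) (r : nat)
    : Prop :=
  exists b : 'I_r -> V, (forall i, S (b i)) /\
    forall v, S v -> exists! c : 'rV[K]_r, N (v - \sum_i c 0 i *: b i).

Definition has_dim (K : fieldType) (V : lmodType K) (S : set V) (r : nat)
    : Prop :=
  has_dim_mod S [set 0] r.

Definition partial (R : realType) (n : nat) (V : normedModType (Cplx R))
    (l : 'I_n) (f : 'rV[Cplx R]_n -> V) (x : 'rV[Cplx R]_n) : V :=
  derive f x (delta_mx 0 l).

(* The derivative of f of multi-index a. *)
Definition dpartial (R : realType) (n : nat) (V : normedModType (Cplx R))
    (a : {ffun 'I_n -> nat}) (f : 'rV[Cplx R]_n -> V) : 'rV[Cplx R]_n -> V :=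
  foldr (fun l g => iter (a l) (partial l) g) f (enum 'I_n).

Definition degree (n : nat) (a : {ffun 'I_n -> nat}) : nat := (\sum_l a l)%N.

(* An h-jet is the family of derivatives of order at most h, extended by 0 to
   all the multi-indices so that jets of all orders have the same type. *)
Definition jets (R : realType) (n d : nat) (V : normedModType (Cplx R)) :=
  {ffun 'I_n -> nat} -> 'I_d -> V.

Definition trunc (R : realType) (n d : nat) (V : normedModType (Cplx R))
    (h : nat) (J : jets n d V) : jets n d V :=
  fun a i => if (degree a <= h)%N then J a i else 0.

Definition jet (R : realType) (n d : nat) (V : normedModType (Cplx R)) (h : nat)
    (s : 'I_d -> 'rV[Cplx R]_n -> V) (x : 'rV[Cplx R]_n) : jets n d V :=
  trunc h (fun a i => dpartial a (s i) x).

(* A family of d one-forms on an open subset of C^n; the covector at x is given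
   by its row of coordinates. *)
Definition forms (R : realType) (n d : nat) :=
  'I_d -> 'rV[Cplx R]_n -> 'rV[Cplx R]_n.

(* (omega_i)_i |-> (d omega_i)_i, where a two-form is given by its
   antisymmetric matrix of coordinates. *)
Definition dform (R : realType) (n d : nat) (s : forms R n d)
    : 'I_d -> 'rV[Cplx R]_n -> 'M[Cplx R]_n :=
  fun i x => \matrix_(l, m) (partial l (s i) x 0 m - partial m (s i) x 0 l).

(* s is a holomorphic section over O of the kernel A of the trace, where O is an
   open subset of the image of the chart k. *)
Definition sectionA (R : realType) (n : nat) (M : complexManifold R n) (d : nat)
    (W : web M d) (k : chart R M n) (O : set 'rV[Cplx R]_n) (s : forms R n d)
    : Prop :=
  [/\ open O, O `<=` chart_map k @` chart_dom k,
      forall i, holomorphic_on O (s i),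
      forall x i v, O x -> tangent (W i) k (chart_inv k x) v ->
        \sum_l s i x 0 l * v 0 l = 0
    & forall x, O x -> \sum_i s i x = 0].

Definition abelian_relation (R : realType) (n : nat) (M : complexManifold R n)
    (d : nat) (W : web M d) (k : chart R M n) (O : set 'rV[Cplx R]_n)
    (s : forms R n d) : Prop :=
  sectionA W k O s /\ forall x i, O x -> dform s i x = 0.

(* Germs of abelian relations: abelian relations on some neighbourhood of p,
   modulo the families of forms that vanish near p. *)
Definition rank_at (R : realType) (n : nat) (M : complexManifold R n) (d : nat)
    (W : web M d) (p : M) (r : nat) : Prop :=
  forall k, chart_at p k ->
    @has_dim_mod (Cplx R) (forms R n d)
      [set s | exists2 O, O (chart_map k p) & abelian_relation W k O s]
      [set s | \forall x \near chart_map k p, forall i, s i x = 0] r.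

Definition web_rank (R : realType) (n : nat) (M : complexManifold R n) (d : nat)
    (W : web M d) (r : nat) : Prop :=
  (exists p, rank_at W p r) /\
  (forall p, exists2 r', (r' <= r)%N & rank_at W p r').

(* The fibre at p of R_h = ker D_h, read in the chart k; R_0 is A. *)
Definition Rfib (R : realType) (n : nat) (M : complexManifold R n) (d : nat)
    (W : web M d) (h : nat) (k : chart R M n) (p : M)
    : set (jets n d 'rV[Cplx R]_n) :=
  [set J | exists O s, [/\ O (chart_map k p), sectionA W k O s,
      J = jet h s (chart_map k p)
    & (0 < h)%N -> jet h.-1 (dform s) (chart_map k p) = 0]].

Definition R_has_rank (R : realType) (n : nat) (M : complexManifold R n)
    (d : nat) (W : web M d) (h r : nat) : Prop :=
  forall p k, chart_at p k -> has_dim (Rfib W h k p) r.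

(* The rank of pi_{h+1} : R_{h+1} -> R_h at p is the dimension of its image. *)
Definition pi_constant_rank (R : realType) (n : nat) (M : complexManifold R n)
    (d : nat) (W : web M d) (h : nat) : Prop :=
  exists r, forall p k, chart_at p k ->
    has_dim (@trunc R n d 'rV[Cplx R]_n h @` Rfib W h.+1 k p) r.

Definition cnum (n h : nat) : nat := 'C(n.-1 + h, h).

Definition betanum (n k : nat) : nat := (\sum_(1 <= h < k.+1) cnum n h)%N.

Definition pi'num (n d h0 : nat) : int :=
  \sum_(1 <= h < h0) (d%:Z - (cnum n h)%:Z).

(* The multi-indices L of degree j; their entries are at most j. *)
Definition multi_indices (n j : nat) : {set {ffun 'I_n -> 'I_j.+1}} :=
  [set L : {ffun 'I_n -> 'I_j.+1} | (\sum_l L l)%N == j]%SET.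

Definition Pmatrix (R : realType) (n : nat) (M : complexManifold R n) (d : nat)
    (k : chart R M n) (u : 'I_d -> M -> Cplx R) (p : M) (j : nat)
    : 'M[Cplx R]_(#|multi_indices n j|, d) :=
  \matrix_(L, i) \prod_l
    dfun k (u i) p (delta_mx 0 l)
      ^+ ((enum_val L : {ffun 'I_n -> 'I_j.+1}) l).

Definition ordinary (R : realType) (n : nat) (M : complexManifold R n) (d : nat)
    (W : web M d) : Prop :=
  forall j, (1 <= j)%N -> forall p k, chart_at p k ->
    forall u, (forall i, local_first_int (W i) p (u i)) ->
      \rank (Pmatrix k u p j) = minn d (cnum n j).

(* Main.v *)
Require Import Defs.
From HB Require Import structures.
From mathcomp Require Import all_boot all_order all_algebra.
From mathcomp Require Import complex.
From mathcomp Require Import all_classical all_reals all_analysis.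
From mathcomp Require Import ring lra.
Set Implicit Arguments.
Unset Strict Implicit.
Unset Printing Implicit Defensive.
Import Order.TTheory GRing.Theory Num.Theory.
Import numFieldNormedType.Exports.
Local Open Scope classical_set_scope.
Local Open Scope ring_scope.

(** Fix a point and a chart there, and let U_1, ..., U_d be first integrals of
    the foliations around its image x0.

    A section of A is a family (g_i dU_i) with vanishing trace, and its
    differentials vanish to order h exactly when each g_i is, up to terms
    vanishing to order h + 1, a polynomial of degree h in U_i: this is an
    integration with respect to U_i (lemma [integrate]).  Conversely every
    family of such polynomials whose trace vanishes to order h + 1 is the
    h-jet of an actual section, because the dU_i span the cotangent space and
    the error can be absorbed (lemma [correct]).  So the fibre of R_h is the
    space of coefficients (c_m)_{m <= h} subject to that condition on the trace
    (lemma [RlocP]).  The trace is the differential of the sum of the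
    primitives; the derivatives of that sum, computed by the chain rule, turn
    the condition into the linear equations

       sum_{m <= j} S_{j,m} c_m = 0   for j = 0, ..., h,

    a block triangular system whose diagonal block S_{j,j} is the matrix
    P_{j+1} (lemmas [trace_okP] and [sysM_diag]).

    For an ordinary web P_{j+1} is onto when j + 1 < h0 and injective when
    j + 1 >= h0.  The system has (h + 1) d unknowns and beta_{h+1} equations,
    which are independent for h = h0 - 2: hence the lower bounds and the rank
    of R_{h0-2} (lemmas [sysB_full] and [Rloc_dim]).  Injectivity of the blocks
    with j > h0 - 2 says that the first h0 - 1 coefficients determine the
    others, so all the maps R_{h+1} -> R_h with h >= h0 - 2 are injective
    (lemma [K_uniq]); their constant rank is therefore the rank of R_{h+1},
    and the ranks decrease.

    A decreasing sequence of natural numbers is stationary.  From some order H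
    on the maps R_{h+1} -> R_h are thus bijective, and each element of R_H
    extends to a unique formal solution (lemma [formal_exists]).  Formal
    solutions converge: injectivity of P_{h0}, which persists near x0, expresses
    the derivatives of order h0 - 1 of the one-variable series through the lower
    ones (lemma [sysG_solve]), so that these series satisfy a linear differential
    system with holomorphic coefficients; iterating it, Cauchy's inequality on
    nested balls bounds c_m by Y K^m m! (lemma [coef_bound]).  The sums of the
    series are abelian relations, and so the germs of abelian relations form, at
    every point, a space isomorphic to R_H (lemma [relations_dim]).

    Holomorphy is complex differentiability on an open set, so the complex
    analysis rests on Goursat's theorem [goursat], from which come the maximum
    principle, removable singularities, Taylor expansions, Cauchy's inequality
    and Weierstrass's theorem. *)

(** * A real-valued norm for modules over the complex field *)

Section RealNorm.
Context {R : realType}.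
Local Notation C := (Cplx R).

(** The real numbers inside the complex field. *)
Definition rc (a : R) : C := a%:C%C.

(** The norm of a module over the complex field takes values in that field,
    where the order is only partial; this is its real value. *)
Definition nm {V : normedZmodType C} (v : V) : R := complex.Re (`|v| : C).

Lemma nmE (V : normedZmodType C) (v : V) : `|v| = rc (nm v).
Proof. by rewrite /rc /nm RRe_real // ger0_real. Qed.

Lemma rc_le (a b : R) : (rc a <= rc b) = (a <= b). Proof. exact: lecR. Qed.
Lemma rc_lt (a b : R) : (rc a < rc b) = (a < b). Proof. exact: ltcR. Qed.
Lemma rcD (a b : R) : rc (a + b) = rc a + rc b. Proof. exact: raddfD. Qed.
Lemma rcM (a b : R) : rc (a * b) = rc a * rc b.
Proof. exact: (rmorphM (real_complex R)). Qed.
Lemma rc1 : rc 1 = 1. Proof. by []. Qed.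
Lemma rcN (a : R) : rc (- a) = - rc a. Proof. exact: raddfN. Qed.
Lemma rcI : injective rc. Proof. exact: complexI. Qed.

Lemma rc_gt0P (e : C) : 0 < e -> exists2 a : R, 0 < a & e = rc a.
Proof.
move=> e0; exists (complex.Re e); last by rewrite /rc RRe_real // gtr0_real.
by rewrite -rc_lt /rc RRe_real // gtr0_real.
Qed.

Section Basic.
Context {V : normedZmodType C}.
Implicit Types u v : V.

Lemma nm_ge0 v : 0 <= nm v.
Proof. by rewrite -rc_le -nmE normr_ge0. Qed.
Lemma nm0 : nm (0 : V) = 0.
Proof. by apply: rcI; rewrite -nmE normr0. Qed.
Lemma nm_eq0 v : (nm v == 0) = (v == 0).
Proof. by rewrite -(inj_eq rcI) -nmE normr_eq0. Qed.
Lemma nm_gt0 v : (0 < nm v) = (v != 0).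
Proof. by rewrite -rc_lt -nmE normr_gt0. Qed.
Lemma nmD u v : nm (u + v) <= nm u + nm v.
Proof. by rewrite -rc_le rcD -!nmE ler_normD. Qed.
Lemma nmN v : nm (- v) = nm v.
Proof. by rewrite /nm normrN. Qed.
Lemma nmB u v : nm (u - v) <= nm u + nm v.
Proof. by rewrite -(nmN v) nmD. Qed.
Lemma nm_distC u v : nm (u - v) = nm (v - u).
Proof. by rewrite /nm distrC. Qed.
Lemma nm_tri u v w : nm (u - w) <= nm (u - v) + nm (v - w).
Proof. by rewrite -{1}(subrK v u) -addrA nmD. Qed.
Lemma nmD4 a b c d (A B E D : R) : nm (a : V) <= A -> nm (b : V) <= B ->
  nm (c : V) <= E -> nm (d : V) <= D -> nm (a + b + c + d) <= A + B + E + D.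
Proof.
move=> *; have := nmD a b; have := nmD (a + b) c; have := nmD (a + b + c) d; lra.
Qed.
Lemma nm_sum (I : Type) (r : seq I) (P : pred I) (F : I -> V) :
  nm (\sum_(i <- r | P i) F i) <= \sum_(i <- r | P i) nm (F i).
Proof.
elim/big_ind2: _ => [|x1 x2 y1 y2 h1 h2|//]; first by rewrite nm0.
exact: le_trans (nmD _ _) (lerD h1 h2).
Qed.
End Basic.

Lemma nmM (x y : C) : nm (x * y) = nm x * nm y.
Proof. by apply: rcI; rewrite rcM -!nmE normrM. Qed.
Lemma nm1 : nm (1 : C) = 1.
Proof. by apply: rcI; rewrite -nmE normr1. Qed.
Lemma nmX (x : C) n : nm (x ^+ n) = nm x ^+ n.
Proof. by elim: n => [|n IH]; rewrite ?expr0 ?nm1 // !exprS nmM IH. Qed.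
Lemma nmV (x : C) : nm (x^-1) = (nm x)^-1.
Proof.
have [->|x0] := eqVneq x 0; first by rewrite invr0 nm0 invr0.
apply: (mulfI (x := nm x)); first by rewrite nm_eq0.
by rewrite -nmM !mulfV ?nm1 // nm_eq0.
Qed.
Lemma nmf (x y : C) : nm (x / y) = nm x / nm y.
Proof. by rewrite nmM nmV. Qed.
Lemma nm_rc (a : R) : nm (rc a) = `|a|.
Proof.
by rewrite /nm /rc normc_def /= expr0n /= addr0 sqrtr_sqr.
Qed.
Lemma nmZ (V : normedModType C) (c : C) (v : V) : nm (c *: v) = nm c * nm v.
Proof. by apply: rcI; rewrite rcM -!nmE normrZ. Qed.
Lemma nm_nat n : nm (n%:R : C) = n%:R.
Proof. by apply: rcI; rewrite -nmE normr_nat /rc (rmorph_nat (real_complex R)). Qed.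
Lemma nm_Re (x : C) : complex.Re x <= nm x.
Proof.
by rewrite -rc_le -nmE; apply: le_trans (normc_ge_Re x); rewrite lecR ler_norm.
Qed.
Lemma nm_Im (x : C) : complex.Im x <= nm x.
Proof.
have := nm_Re (x * (- 'i)%C).
rewrite nmM nmN mulrN raddfN /= ReiNIm opprK => /le_trans; apply.
by rewrite {2}/nm normc_def /= expr0n expr1n add0r sqrtr1 mulr1.
Qed.
Lemma nm_ReIm (x : C) : nm x <= `|complex.Re x| + `|complex.Im x|.
Proof.
case: x => a b; rewrite /nm normc_def /=.
rewrite -[leRHS]ger0_norm ?addr_ge0 // -sqrtr_sqr ler_wsqrtr //.
rewrite -[a ^+ 2]real_normK ?num_real // -[b ^+ 2]real_normK ?num_real //.
have := mulr_ge0 (normr_ge0 a) (normr_ge0 b); rewrite sqrrD; lra.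
Qed.

Lemma nearE_nm (V : normedModType C) (x : V) (P : set V) :
  (\forall y \near x, P y) <->
  exists2 r : R, 0 < r & forall y, nm (y - x) < r -> P y.
Proof.
split.
  move=> /nbhs_normP [e /= e0 H]; have [a a0 ea] := rc_gt0P e0.
  exists a => // y yx; apply: H => /=.
  by rewrite distrC ea nmE rc_lt.
move=> [r r0 H]; apply/nbhs_normP; exists (rc r); first by rewrite /= rc_lt.
by move=> y /=; rewrite distrC nmE rc_lt => /H.
Qed.

Lemma open_nm (V : normedModType C) (O : set V) (x : V) : open O -> O x ->
  exists2 r : R, 0 < r & forall y, nm (y - x) < r -> O y.
Proof. by move=> oO Ox; apply/nearE_nm; exact: open_nbhs_nbhs. Qed.

Lemma open_ball_nm (V : normedModType C) (x : V) (r : R) :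
  open [set y | nm (y - x) < r].
Proof.
rewrite openE => y /= yr; apply/nearE_nm; exists (r - nm (y - x)).
  by rewrite subr_gt0.
by move=> z zy; rewrite /= (le_lt_trans (nm_tri _ y _)) // -ltrBrDr.
Qed.

Lemma continuous_nmP (V W : normedModType C) (f : V -> W) (x : V) :
  {for x, continuous f} <->
  forall e : R, 0 < e -> exists2 r : R, 0 < r &
    forall y, nm (y - x) < r -> nm (f y - f x) < e.
Proof.
split.
  move=> /cvgrPdist_lt H e e0; apply/(nearE_nm x (fun y => nm (f y - f x) < e)).
  by apply: filterS (H (rc e) _) => [y|]; rewrite ?rc_lt // distrC nmE rc_lt.
move=> H; apply/cvgrPdist_lt => e /rc_gt0P [a a0 ->].
apply/(nearE_nm x); have [r r0 Hr] := H _ a0; exists r => // y /Hr.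
by rewrite distrC nmE rc_lt.
Qed.

Lemma is_derive_nmP (V W : normedModType C) (f : V -> W) (x v : V) (a : W) :
  is_derive x v f a <->
  forall e : R, 0 < e -> exists2 r : R, 0 < r &
    forall h : C, nm h < r -> nm (f (x + h *: v) - f x - h *: a) <= e * nm h.
Proof.
split.
  move=> [df dfv] e e0.
  move: df; rewrite /derivable -/(derive _ _ _) => /cvgP => H.
  have {}H : (fun h => h^-1 *: ((f \o shift x) (h *: v) - f x)) @ 0^' --> a.
    by rewrite -dfv; exact: H.
  move/cvgrPdist_le : H => /(_ (rc e)); rewrite rc_lt => /(_ e0).
  rewrite /dnbhs near_withinE => /nearE_nm [r r0 H].
  exists r => // h hr; have [->|h0] := eqVneq h 0.
    by rewrite !scale0r addr0 !subrr !nm0 mulr0.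
  have := H h; rewrite subr0 => /(_ hr h0).
  rewrite nmE rc_le /= => H1.
  rewrite -[f _ - f x](scalerKV h0) -scalerBr nmZ mulrC ler_wpM2r ?nm_ge0 //.
  by rewrite nm_distC [x + _]addrC.
move=> H.
have Hc : (fun h => h^-1 *: ((f \o shift x) (h *: v) - f x)) @ 0^' --> a.
  apply/cvgrPdist_le => e /rc_gt0P [b b0 ->].
  suff : \forall h \near (0 : C^o), h != 0 ->
      `|a - h^-1 *: ((f \o shift x) (h *: v) - f x)| <= rc b.
    by rewrite /dnbhs near_withinE.
  apply/nearE_nm.
  have [r r0 Hr] := H _ b0; exists r => // h; rewrite subr0 => hr h0.
  rewrite nmE rc_le nm_distC /= -[X in _ - X](scalerK h0) -scalerBr nmZ nmV.
  rewrite ler_pdivrMl ?nm_gt0 // mulrC [_ + x]addrC; exact: Hr.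
split; first by apply/cvg_ex; exists a.
exact: cvg_lim Hc.
Qed.

Lemma differentiable_nmP (V W : normedModType C) (f : V -> W) (x : V)
    (L : {linear V -> W}) (K : R) :
  (forall v, nm (L v) <= K * nm v) ->
  (forall e : R, 0 < e -> exists2 r : R, 0 < r &
    forall v, nm v < r -> nm (f (x + v) - f x - L v) <= e * nm v) ->
  differentiable f x.
Proof.
move=> LK H.
have Lc : continuous L.
  move=> y; apply/continuous_nmP => e e0.
  have K1 : 0 < `|K| + 1 by rewrite ltr_wpDl.
  exists (e / (`|K| + 1)); first by rewrite divr_gt0.
  move=> z; rewrite ltr_pdivlMr // => zy; rewrite -linearB.
  apply: le_lt_trans (LK _) (le_lt_trans _ zy).
  rewrite mulrC ler_wpM2l ?nm_ge0 //.
  by rewrite (le_trans (ler_norm _)) // lerDl.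
have E : f \o shift x = cst (f x) + L +o_ 0 id.
  apply/eqaddoP => e /rc_gt0P [b b0 ->]; apply/nearE_nm.
  have [r r0 Hr] := H _ b0; exists r => // v; rewrite subr0 => vr.
  rewrite !nmE -rcM rc_le.
  have -> : (f \o shift x - (cst (f x) + L)) v = f (x + v) - f x - L v.
    by rewrite !fctE /= [x + v]addrC opprD addrA.
  exact: Hr.
apply/diff_locallyP; rewrite (diff_unique Lc E); split => //.
Qed.

Lemma diff_nm (V W : normedModType C) (f : V -> W) (x : V) :
  differentiable f x ->
  forall e : R, 0 < e -> exists2 r : R, 0 < r &
    forall v, nm v < r -> nm (f (x + v) - f x - 'd f x v) <= e * nm v.
Proof.
move=> /diff_locally /eqaddoP H e e0.
have := H (rc e); rewrite rc_lt => /(_ e0) /nearE_nm [r r0 Hr].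
exists r => // v vr; have := Hr v; rewrite subr0 => /(_ vr).
rewrite !nmE -rcM rc_le.
suff -> : (f \o shift x - (cst (f x) + 'd f x)) v = f (x + v) - f x - 'd f x v.
  by [].
by rewrite !fctE /= [x + v]addrC opprD addrA.
Qed.

Lemma nm_complete (u : nat -> C) :
  (forall e : R, 0 < e -> exists N, forall m n, (N <= m)%N -> (N <= n)%N ->
    nm (u m - u n) <= e) ->
  exists l, forall e : R, 0 < e -> exists N, forall n, (N <= n)%N ->
    nm (u n - l) <= e.
Proof.
move=> H.
have real_case (g : C -> R) : (forall x y, `|g x - g y| <= nm (x - y)) ->
    exists l : R, forall e : R, 0 < e -> exists N, forall n, (N <= n)%N ->
      `|g (u n) - l| <= e.
  move=> gL.
  have /cvg_ex [l /cvgrPdist_le Hl] : cvg ((g \o u) @ \oo).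
    apply/cauchy_cvgP/cauchy_exP => e e0.
    have [N HN] := H _ (divr_gt0 e0 (ltr0n _ 2)); exists (g (u N)).
    exists N => // n /= Nn; rewrite -ball_normE /=.
    apply: le_lt_trans (gL _ _) _; apply: le_lt_trans (HN _ _ (leqnn _) Nn) _.
    by rewrite ltr_pdivrMr // ltr_pMr // ltr1n.
  exists l => e e0; have [N _ HN] := Hl _ e0.
  by exists N => n /HN /=; rewrite distrC.
have [|a Ha] := real_case (@complex.Re R).
  move=> x y; rewrite -raddfB ler_norml nm_Re andbT lerNl -raddfN.
  by rewrite (le_trans (nm_Re _)) // nmN.
have [|b Hb] := real_case (@complex.Im R).
  move=> x y; rewrite -raddfB ler_norml nm_Im andbT lerNl -raddfN.
  by rewrite (le_trans (nm_Im _)) // nmN.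
exists (Complex a b) => e e0.
have [N HN] := Ha _ (divr_gt0 e0 (ltr0n _ 2)).
have [M HM] := Hb _ (divr_gt0 e0 (ltr0n _ 2)).
exists (maxn N M) => n; rewrite geq_max => /andP [/HN h1 /HM h2].
apply: le_trans (nm_ReIm _) _.
by rewrite !raddfB /= (splitr e) lerD.
Qed.

(** A sequence with geometrically decreasing steps converges, with the usual
    estimate of the distance to its limit. *)
Lemma nm_geometric (u : nat -> C) (A q : R) : 0 <= A -> 0 <= q < 1 ->
  (forall k, nm (u k.+1 - u k) <= A * q ^+ k) ->
  exists l, forall n, nm (u n - l) <= A / (1 - q) * q ^+ n.
Proof.
move=> A0 /andP [q0 q1] H.
have q1' : 0 < 1 - q by rewrite subr_gt0.
have B n k : nm (u (n + k)%N - u n) <= A / (1 - q) * q ^+ n * (1 - q ^+ k).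
  elim: k => [|k IH]; first by rewrite addn0 subrr nm0 expr0 subrr mulr0.
  rewrite addnS; apply: le_trans (nm_tri _ (u (n + k)%N) _) _.
  apply: le_trans (lerD (H _) IH) _.
  rewrite le_eqVlt; apply/orP; left; apply/eqP.
  by rewrite exprD exprS; field; rewrite lt0r_neq0.
have B' n k : nm (u (n + k)%N - u n) <= A / (1 - q) * q ^+ n.
  apply: le_trans (B n k) _; rewrite ler_piMr //.
    by rewrite mulr_ge0 ?exprn_ge0 // divr_ge0 // ltW.
  by rewrite lerBlDr lerDl exprn_ge0.
have T0 : forall e : R, 0 < e -> exists N, A / (1 - q) * q ^+ N <= e.
  move=> e e0.
  have c : (fun n => A / (1 - q) * q ^+ n) @ \oo --> (0 : R).
    rewrite -(mulr0 (A / (1 - q))); apply: cvgM; first exact: cvg_cst.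
    by apply: cvg_expr; rewrite ger0_norm.
  move/cvgrPdist_le : c => /(_ _ e0) [N _ HN]; exists N.
  have := HN N (leqnn _); rewrite /= sub0r normrN; apply: le_trans.
  exact: ler_norm.
have [|l Hl] := nm_complete (u := u).
  move=> e e0; have [N HN] := T0 _ (divr_gt0 e0 (ltr0n _ 2)).
  exists N => m n Nm Nn; apply: le_trans (nm_tri _ (u N) _) _.
  rewrite (splitr e) lerD //; last rewrite nm_distC.
    by rewrite -(subnKC Nm) (le_trans (B' _ _)).
  by rewrite -(subnKC Nn) (le_trans (B' _ _)).
exists l => n; apply/ler_addgt0Pl => e e0.
have [N HN] := Hl _ e0.
apply: le_trans (nm_tri _ (u (n + N)%N) _) _; rewrite addrC lerD //.
  by apply: HN; rewrite leq_addl.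
by rewrite nm_distC.
Qed.

(** The tensor power trick: an inequality between powers up to a constant
    factor, valid for all exponents, holds without the factor. *)
Lemma le_of_expr (F m A c : R) : 0 <= F -> 0 <= m -> 0 < c -> 0 <= A ->
  (forall k, c * F ^+ k <= A * m ^+ k) -> F <= m.
Proof.
move=> F0 m0 c0 A0 H; rewrite leNgt; apply/negP => mF.
have Fp : 0 < F by exact: le_lt_trans mF.
have q0 : 0 <= m / F by rewrite divr_ge0.
have q1 : `|m / F| < 1 by rewrite ger0_norm // ltr_pdivrMr // mul1r.
have cv : (fun n => A * (m / F) ^+ n) @ \oo --> (0 : R).
  rewrite -(mulr0 A); apply: cvgM; first exact: cvg_cst.
  exact: cvg_expr.
move/cvgrPdist_lt : cv => /(_ _ c0) [N _ /(_ N (leqnn _))] /=.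
rewrite sub0r normrN ger0_norm ?mulr_ge0 ?exprn_ge0 // expr_div_n mulrA.
by rewrite ltr_pdivrMr ?exprn_gt0 // ltNge H.
Qed.

Section Deriv.
Context {V : normedModType C}.
Implicit Types (f g : V -> C) (x v : V) (a b : C).

(** The directional derivative of a scalar function, the complex field being
    seen as a normed module over itself. *)
Definition deriv_at f x v a : Prop := is_derive x v (f : V -> C^o) (a : C^o).
Definition der f x v : C := derive (f : V -> C^o) x v.
Definition dvable f x v : Prop := exists a, deriv_at f x v a.

Lemma deriv_atP f x v a : deriv_at f x v a <->
  forall e : R, 0 < e -> exists2 r : R, 0 < r &
    forall h : C, nm h < r -> nm (f (x + h *: v) - f x - h * a) <= e * nm h.
Proof. exact: is_derive_nmP. Qed.

Lemma deriv_at_der f x v a : deriv_at f x v a -> der f x v = a.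
Proof. by case. Qed.
Lemma dvable_at f x v a : deriv_at f x v a -> dvable f x v.
Proof. by exists a. Qed.
Lemma der_at f x v : dvable f x v -> deriv_at f x v (der f x v).
Proof. by case=> a fa; rewrite (deriv_at_der fa). Qed.

Lemma deriv_at_cst (c : C) x v : deriv_at (fun=> c) x v 0.
Proof. exact: is_derive_cst. Qed.
Lemma deriv_atD f g x v a b : deriv_at f x v a -> deriv_at g x v b ->
  deriv_at (fun y => f y + g y) x v (a + b).
Proof. move=> fa gb; exact: (is_deriveD (df := a : C^o) (dg := b : C^o)). Qed.
Lemma deriv_atB f g x v a b : deriv_at f x v a -> deriv_at g x v b ->
  deriv_at (fun y => f y - g y) x v (a - b).
Proof. move=> fa gb; exact: (is_deriveB (df := a : C^o) (dg := b : C^o)). Qed.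
Lemma deriv_atM f g x v a b : deriv_at f x v a -> deriv_at g x v b ->
  deriv_at (fun y => f y * g y) x v (f x * b + g x * a).
Proof. move=> fa gb; exact: (is_deriveM (df := a) (dg := b)). Qed.
Lemma dvV f x v : f x != 0 -> dvable f x v -> dvable (fun y => (f y)^-1) x v.
Proof.
move=> fx [a [fa _]]; exists (der (fun y => (f y)^-1) x v).
split; last by [].
exact: derivableV.
Qed.
Lemma dvB f g x v : dvable f x v -> dvable g x v -> dvable (fun y => f y - g y) x v.
Proof. by move=> [a fa] [b gb]; exists (a - b); exact: deriv_atB. Qed.
Lemma dvM f g x v : dvable f x v -> dvable g x v -> dvable (fun y => f y * g y) x v.
Proof. by move=> [a fa] [b gb]; eexists; exact: (deriv_atM fa gb). Qed.
Lemma dv_cst (c : C) x v : dvable (fun=> c) x v.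
Proof. by exists 0; exact: deriv_at_cst. Qed.
Lemma dvX f n x v : dvable f x v -> dvable (fun y => f y ^+ n) x v.
Proof.
move=> df; elim: n => [|n IH]; first exact: dv_cst.
rewrite (_ : (fun y => _) = (fun y => f y * f y ^+ n)); first exact: dvM.
by apply/funext => y; rewrite exprS.
Qed.

Lemma deriv_at_local f g x v a (r : R) : 0 < r ->
  (forall y, nm (y - x) < r -> f y = g y) -> deriv_at f x v a -> deriv_at g x v a.
Proof.
move=> r0 E /deriv_atP H; apply/deriv_atP => e /H [d d0 Hd].
have v1 : 0 < nm v + 1 by rewrite ltr_wpDl ?nm_ge0.
exists (Num.min (r / (nm v + 1)) d); first by rewrite lt_min divr_gt0.
move=> h; rewrite lt_min ltr_pdivlMr // => /andP [h1 h2].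
rewrite -(E (x + h *: v)); last first.
  rewrite addrAC subrr add0r nmZ; apply: le_lt_trans h1.
  by rewrite ler_wpM2l ?nm_ge0 // lerDl.
by rewrite -(E x) ?subrr ?nm0 //; exact: Hd.
Qed.

Lemma deriv_at_shift f x v u a : deriv_at f (x + u) v a ->
  deriv_at (fun y => f (y + u)) x v a.
Proof.
move=> /deriv_atP H; apply/deriv_atP => e /H [r r0 Hr]; exists r => // h /Hr.
by rewrite [x + _ + u]addrAC.
Qed.
Lemma deriv_atZ c f x v a : deriv_at f x v a -> deriv_at (fun y => f y * c) x v (a * c).
Proof.
by move=> fa; have := deriv_atM fa (deriv_at_cst c x v); rewrite mulr0 add0r mulrC.
Qed.
End Deriv.

Local Notation dv f z := (dvable f z (1 : C)).
Local Notation dva f z a := (deriv_at f z (1 : C) a).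

Lemma dv_nmP (f : C -> C) (z a : C) : dva f z a <->
  forall e : R, 0 < e -> exists2 r : R, 0 < r &
    forall h : C, nm h < r -> nm (f (z + h) - f z - h * a) <= e * nm h.
Proof.
split=> [/deriv_atP H|H].
  move=> e /H [r r0 Hr]; exists r => // h /Hr.
  by rewrite /GRing.scale /= mulr1.
apply/deriv_atP => e /H [r r0 Hr]; exists r => // h /Hr.
by rewrite /GRing.scale /= mulr1.
Qed.

Lemma dva_id (z : C) : dva (fun y => y) z 1.
Proof. exact: (is_derive_id (V := C^o)). Qed.
Lemma dv_id (z : C) : dv (fun y => y) z.
Proof. by exists 1; exact: dva_id. Qed.
Lemma dv_inv (z : C) : z != 0 -> dv (fun y : C => y^-1) z.
Proof. by move=> z0; exact: (dvV (f := fun y : C => y) z0 (dv_id z)). Qed.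

(* Unification would otherwise unfold derivatives down to limits of filters. *)
#[global] Opaque der deriv_at.

(** * Goursat's theorem and the maximum principle *)

Definition ci : C := Complex 0 1.

(** The midpoint Riemann sum of f over the segment from p to p + e cut into 2 ^
    N equal parts. Such sums replace integrals: they are exact on affine
    functions and additive under bisection, which is all that Goursat's argument
    uses. *)
Fixpoint segsum (f : C -> C) (N : nat) (p e : C) : C :=
  if N is N'.+1 then segsum f N' p (e / 2) + segsum f N' (p + e / 2) (e / 2)
  else e * f (p + e / 2).

Lemma two_neq0 : (2 : C) != 0. Proof. by rewrite pnatr_eq0. Qed.

Lemma segsum_rev f N p e : segsum f N (p + e) (- e) = - segsum f N p e.
Proof.
elim: N p e => [|N IH] p e /=.
  by rewrite mulNr; congr (- (_ * f _)); field.
rewrite mulNr.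
have -> : p + e - e / 2 = p + e / 2 by field.
rewrite opprD -!IH addrC; congr (_ + _).
  by congr (segsum f N _ _); field.
Qed.

Lemma segsum_linear f g a b N p e :
  segsum (fun x => a * f x + b * g x) N p e =
  a * segsum f N p e + b * segsum g N p e.
Proof.
elim: N p e => [|N IH] p e /=; first by ring.
rewrite !IH; ring.
Qed.

Lemma segsum_affine a b N p e :
  segsum (fun x => a * x + b) N p e = e * (a * (p + e / 2) + b).
Proof.
elim: N p e => [|N IH] p e //=.
by rewrite !IH; field.
Qed.

Lemma nm_half (e : C) : nm (e / 2) = nm e / 2.
Proof. by rewrite nmf nm_nat. Qed.

Lemma rc_nat n : rc n%:R = n%:R.
Proof. by rewrite /rc (rmorph_nat (real_complex R)). Qed.

Lemma rc_half : rc 2^-1 = 2^-1.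
Proof.
by apply: (mulIf two_neq0); rewrite mulVf ?two_neq0 // -[in LHS]rc_nat -rcM mulVf.
Qed.

Lemma half01 : 0 <= (2^-1 : R) <= 1.
Proof. by apply/andP; split; lra. Qed.

Lemma half_point (P : C -> Prop) (p e : C) :
  (forall t : R, 0 <= t <= 1 -> P (p + rc t * e)) ->
  (forall t : R, 0 <= t <= 1 -> P (p + rc t * (e / 2))) /\
  (forall t : R, 0 <= t <= 1 -> P (p + e / 2 + rc t * (e / 2))).
Proof.
have rcd (t : R) : rc (t / 2) = rc t / 2 by rewrite rcM rc_half.
move=> H; split=> t /andP [t0 t1].
  have -> : rc t * (e / 2) = rc (t / 2) * e by rewrite rcd; field.
  by apply: H; apply/andP; split; lra.
have -> : p + e / 2 + rc t * (e / 2) = p + rc ((1 + t) / 2) * e.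
  by rewrite rcd rcD rc1; field.
by apply: H; apply/andP; split; lra.
Qed.

Lemma segsum_bound f N p e (m : R) :
  (forall t : R, 0 <= t <= 1 -> nm (f (p + rc t * e)) <= m) ->
  nm (segsum f N p e) <= m * nm e.
Proof.
elim: N p e => [|N IH] p e H /=.
  rewrite nmM mulrC ler_wpM2r ?nm_ge0 //.
  have := H _ half01; rewrite rc_half.
  by rewrite mulrC.
have [h1 h2] := half_point (P := fun x => nm (f x) <= m) H.
apply: le_trans (nmD _ _) (le_trans (lerD (IH _ _ h1) (IH _ _ h2)) _).
by rewrite nm_half; lra.
Qed.

Lemma segsum_Im f N p e (m : R) :
  (forall t : R, 0 <= t <= 1 -> m <= complex.Im (e * f (p + rc t * e))) ->
  m <= complex.Im (segsum f N p e).
Proof.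
elim: N p e m => [|N IH] p e m H /=.
  have := H _ half01; rewrite rc_half.
  by rewrite [_ * e]mulrC.
have Ih (x : C) : complex.Im (e / 2 * x) = complex.Im (e * x) / 2.
  have -> : e / 2 * x = rc 2^-1 * (e * x).
    by rewrite rc_half; field.
  by case: (e * x) => u v; rewrite /rc /=; ring.
have [h1 h2] := half_point (P := fun x => m <= complex.Im (e * f x)) H.
have k1 := IH p (e / 2) (m / 2); have k2 := IH (p + e / 2) (e / 2) (m / 2).
rewrite raddfD /= (splitr m) lerD //; [apply: k1|apply: k2] => t tt.
  by rewrite Ih ler_pM2r ?invr_gt0 //; exact: h1.
by rewrite Ih ler_pM2r ?invr_gt0 //; exact: h2.
Qed.

(** The sum over the boundary of the square with lower left corner p and side s. *)
Definition sqsum (f : C -> C) N (p s : C) : C :=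
  segsum f N p s + segsum f N (p + s) (ci * s)
  + segsum f N (p + s + ci * s) (- s) + segsum f N (p + ci * s) (- (ci * s)).

Lemma sqsumE f N p s : sqsum f N p s =
  segsum f N p s + segsum f N (p + s) (ci * s)
  - segsum f N (p + ci * s) s - segsum f N p (ci * s).
Proof.
rewrite /sqsum -!segsum_rev; congr (_ + segsum f N _ _ + _); ring.
Qed.

Lemma sqsum_split f N p s : sqsum f N.+1 p s =
  sqsum f N p (s / 2) + sqsum f N (p + s / 2) (s / 2)
  + sqsum f N (p + ci * (s / 2)) (s / 2)
  + sqsum f N (p + s / 2 + ci * (s / 2)) (s / 2).
Proof.
rewrite !sqsumE /=.
have -> : ci * s / 2 = ci * (s / 2) by rewrite mulrA.
set h := s / 2; set k := ci * h.
have e1 : p + h + h = p + s by rewrite /h; field.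
have e2 : p + ci * s = p + k + k by rewrite /k /h; field.
have e3 : p + k + h = p + h + k by ring.
have e4 : p + h + k + h = p + s + k by rewrite -e1; ring.
have e5 : p + h + k + k = p + k + k + h by ring.
rewrite e1 e2 e3 e4 e5; ring.
Qed.

Lemma sqsum_linear f g a b N p s :
  sqsum (fun x => a * f x + b * g x) N p s =
  a * sqsum f N p s + b * sqsum g N p s.
Proof. by rewrite !sqsumE !segsum_linear; ring. Qed.

Lemma sqsum_affine a b N p s : sqsum (fun x => a * x + b) N p s = 0.
Proof. by rewrite sqsumE !segsum_affine; ring. Qed.

Lemma i_sqr : ci * ci = -1.
Proof. exact: sqr_i. Qed.

Lemma nm_i : nm ci = 1.
Proof. by rewrite /nm normc_def /= expr0n expr1n add0r sqrtr1. Qed.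

Lemma sqsum_bound f N p (s m : R) : 0 <= s ->
  (forall x, nm (x - p) <= 2 * s -> nm (f x) <= m) ->
  nm (sqsum f N p (rc s)) <= 4 * s * m.
Proof.
move=> s0 H.
have ns : nm (rc s) = s by rewrite nm_rc ger0_norm.
have nis : nm (ci * rc s) = s by rewrite nmM nm_i mul1r ns.
have B q e : nm (q - p) <= s -> nm e = s -> nm (segsum f N q e) <= m * s.
  move=> qp es; rewrite -es; apply: segsum_bound => t /andP [t0 t1]; apply: H.
  have -> : q + rc t * e - p = (q - p) + rc t * e by ring.
  apply: le_trans (nmD _ _) _; rewrite nmM nm_rc ger0_norm // es.
  have : t * s <= 1 * s by rewrite ler_wpM2r.
  lra.
have n0 : nm (p - p) <= s by rewrite subrr nm0.
have n1 : nm (p + rc s - p) <= s by rewrite addrAC subrr add0r ns.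
have n2 : nm (p + ci * rc s - p) <= s by rewrite addrAC subrr add0r nis.
have h1 := B _ _ n0 ns; have h2 := B _ _ n1 nis.
have h3 := B _ _ n2 ns; have h4 := B _ _ n0 nis.
rewrite sqsumE.
have k1 := nmD (segsum f N p (rc s)) (segsum f N (p + rc s) (ci * rc s)).
have k2 := nmB (segsum f N p (rc s) + segsum f N (p + rc s) (ci * rc s))
               (segsum f N (p + ci * rc s) (rc s)).
have k3 := nmB (segsum f N p (rc s) + segsum f N (p + rc s) (ci * rc s)
               - segsum f N (p + ci * rc s) (rc s)) (segsum f N p (ci * rc s)).
lra.
Qed.

(** Near a point where f is differentiable, f is affine up to a small multiple
    of the distance, and affine functions have sum zero over a square. *)
Lemma sqsum_near (f : C -> C) (w : C) : dv f w -> forall e : R, 0 < e ->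
  exists2 r : R, 0 < r & forall N p s, 0 <= s -> nm (p - w) <= 2 * s ->
    4 * s < r -> nm (sqsum f N p (rc s)) <= e * s ^+ 2.
Proof.
move=> [a /dv_nmP H] e e0.
have [r r0 Hr] := H _ (divr_gt0 e0 (ltr0n R 16)).
exists r => // N p s s0 pw sr.
pose g x := f x - (a * x + (f w - a * w)).
have E : sqsum f N p (rc s) = sqsum g N p (rc s).
  rewrite -[RHS]addr0 -(sqsum_affine a (f w - a * w) N p (rc s)).
  rewrite -[sqsum g _ _ _]mul1r -[X in _ + X]mul1r -sqsum_linear.
  by congr (sqsum _ _ _ _); apply/funext => x; rewrite /g; ring.
rewrite E.
have -> : e * s ^+ 2 = 4 * s * (e / 16 * (4 * s)) by field.
apply: sqsum_bound => // x xp.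
have xw : nm (x - w) <= 4 * s by have := nm_tri x p w; lra.
have := Hr (x - w) (le_lt_trans xw sr).
rewrite [w + _]addrC subrK => h.
have -> : g x = f x - f w - (x - w) * a by rewrite /g; ring.
apply: le_trans h _; rewrite ler_wpM2l // ltW // divr_gt0 //.
Qed.

(** The classical bisection argument: if the sums over a square do not become
    small, the same holds, in proportion to the area, for one of its quarters,
    and the nested squares shrink to a point where [sqsum_near] gives a
    contradiction. *)
Lemma goursat (f : C -> C) (p0 : C) (s0 : R) : 0 < s0 ->
  (forall w, nm (w - p0) <= 2 * s0 -> dv f w) ->
  forall e : R, 0 < e ->
    exists N0, forall N, (N0 <= N)%N -> nm (sqsum f N p0 (rc s0)) <= e.
Proof.
move=> s0p df e e0.
pose good q (s : R) := exists N0, forall N, (N0 <= N)%N ->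
  nm (sqsum f N q (rc s)) <= e / s0 ^+ 2 * s ^+ 2.
suff [N0 HN0] : good p0 s0.
  by exists N0 => N /HN0; rewrite divfK // lt0r_neq0 // exprn_gt0.
have s20 : 0 < e / s0 ^+ 2 by rewrite divr_gt0 // exprn_gt0.
(* A bad square has a bad quarter. *)
have merge q (s : R) : 0 < s -> ~ good q s ->
    exists q', nm (q' - q) <= s /\ ~ good q' (s / 2).
  move=> sp nq; apply: contrapT => nex.
  have G q' : nm (q' - q) <= s -> good q' (s / 2).
    by move=> qq; apply: contrapT => ng; apply: nex; exists q'.
  have rs : rc (s / 2) = rc s / 2 by rewrite rcM rc_half.
  have nh : nm (rc (s / 2)) = s / 2 by rewrite nm_rc ger0_norm // divr_ge0 // ltW.
  have nih : nm (ci * rc (s / 2)) = s / 2 by rewrite nmM nm_i mul1r.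
  have [|N1 H1] := G q; first by rewrite subrr nm0 ltW.
  have [|N2 H2] := G (q + rc (s / 2)).
    by rewrite addrAC subrr add0r nh; lra.
  have [|N3 H3] := G (q + ci * rc (s / 2)).
    by rewrite addrAC subrr add0r nih; lra.
  have [|N4 H4] := G (q + rc (s / 2) + ci * rc (s / 2)).
    have -> : q + rc (s / 2) + ci * rc (s / 2) - q =
      rc (s / 2) + ci * rc (s / 2) by ring.
    by apply: le_trans (nmD _ _) _; rewrite nh nih; lra.
  apply: nq; exists (maxn (maxn N1 N2) (maxn N3 N4)).+1 => -[//|N].
  rewrite ltnS !geq_max => /andP [/andP [/H1 h1 /H2 h2] /andP [/H3 h3 /H4 h4]].
  rewrite sqsum_split -rs.
  by have := nmD4 h1 h2 h3 h4; lra.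
apply: contrapT => bad0.
(* Bad squares of side s0 / 2 ^ k, each a quarter of the one before. *)
pose st (k : nat) : R := s0 / 2 ^+ k.
have stp k : 0 < st k by rewrite divr_gt0 ?exprn_gt0.
have stS k : st k.+1 = st k / 2 by rewrite /st exprS invfM mulrCA mulrC.
have /choice [F HF] : forall kp : nat * C, exists q, ~ good kp.2 (st kp.1) ->
    nm (q - kp.2) <= st kp.1 /\ ~ good q (st kp.1.+1).
  move=> [k q] /=.
  have [gq|ngq] := EM (good q (st k)); first by exists 0.
  by have [q' Hq'] := merge _ _ (stp k) ngq; exists q'; rewrite stS.
pose u := fix u k : C := if k is k'.+1 then F (k', u k') else p0.
have ub k : ~ good (u k) (st k).
  elim: k => [|k IH]; first by rewrite /st expr0 divr1.
  by have [] := HF (k, u k) IH.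
have [||| w Hw] := @nm_geometric u s0 (2^-1).
- exact: ltW.
- by apply/andP; split; lra.
- move=> k; have [h _] := HF (k, u k) (ub k).
  by rewrite exprVn.
have wn k : nm (u k - w) <= 2 * st k.
  apply: le_trans (Hw k) _; rewrite exprVn /st.
  rewrite le_eqVlt; apply/orP; left; apply/eqP.
  by have k0 : (2 : R) ^+ k != 0 by []; field.
have [|r r0 Hr] := sqsum_near (w := w) (f := f) _ s20.
  by apply: df; have := wn 0%N; rewrite /= /st expr0 divr1 nm_distC.
have [k Hk] : exists k, 4 * st k < r.
  have c : (fun n => 4 * s0 * 2^-1 ^+ n) @ \oo --> (0 : R).
    rewrite -(mulr0 (4 * s0)); apply: cvgM; first exact: cvg_cst.
    by apply: cvg_expr; rewrite ger0_norm //; lra.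
  move/cvgrPdist_lt : c => /(_ _ r0) [N _ HN]; exists N.
  have := HN N (leqnn _); rewrite /= sub0r normrN /st -mulrA -exprVn; apply: le_lt_trans.
  exact: ler_norm.
by apply: (ub k); exists 0%N => N _; apply: Hr => //; exact: ltW.
Qed.

(** Points of the bottom side of the square of half side s centred at 0: they
    lie in the annulus s <= |x| <= 2 s, and dx / x has imaginary part bounded
    below, the angle seen from the centre. *)
Lemma edge_point (s t : R) : 0 < s -> 0 <= t <= 1 ->
  let x : C := (rc (2 * s * t - s) - ci * rc s) in
  [/\ s <= nm x, nm x <= 2 * s & 1 <= complex.Im (rc (2 * s) / x)].
Proof.
move=> s0 /andP [t0 t1] x.
set a := 2 * s * t - s.
have xE : x = Complex a (- s).
  by rewrite /x /rc /ci /a; apply/eqP; rewrite eq_complex /=; apply/andP; split; apply/eqP; ring.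
have [a1 a2] : - s <= a /\ a <= s by rewrite /a; split; nra.
have Im1 : s <= nm x by rewrite -nmN; have := nm_Im (- x); rewrite {1}xE /= opprK.
split => //.
  have := nm_ReIm x; rewrite {2 3}xE /= normrN (ger0_norm (ltW s0)).
  have : `|a| <= s by rewrite ler_norml a1 a2.
  lra.
rewrite xE /rc /=.
set E := (X in 1 <= X).
have -> : E = 2 * s ^+ 2 / (a ^+ 2 + s ^+ 2).
  by rewrite /E sqrrN; field; apply/eqP; nra.
rewrite ler_pdivlMr ?mul1r; nra.
Qed.

(** The function is about (x - z) f'(z) ^ 2 near z; squaring the increment is
    what makes this elementary. *)
Lemma sq_quot_derivable (f : C -> C) (z : C) : dv f z ->
  dv (fun x => (f x - f z) ^+ 2 / (x - z)) z.
Proof.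
move=> [a /dv_nmP H]; exists (a ^+ 2); apply/dv_nmP => e e0.
pose e1 : R := Num.min 1 (e / (2 * nm a + 1)).
have na := nm_ge0 a.
have e10 : 0 < e1 by rewrite lt_min ltr01 divr_gt0 // ltr_wpDl // mulr_ge0.
have e11 : e1 <= 1 by rewrite ge_min lexx.
have e12 : e1 * (2 * nm a + 1) <= e.
  by rewrite -ler_pdivlMr ?ltr_wpDl ?mulr_ge0 // ge_min lexx orbT.
have [r r0 Hr] := H _ e10; exists r => // h hr.
have {}Hr := Hr h hr.
have [->|h0] := eqVneq h 0; first by rewrite addr0 !subrr mul0r subrr !nm0 mulr0.
rewrite [z + h - z]addrAC !subrr add0r invr0 mulr0 subr0.
set D := f (z + h) - f z in Hr *.
set q := D - h * a in Hr *.
have -> : D ^+ 2 / h - h * a ^+ 2 = 2 * a * q + q ^+ 2 / h.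
  by rewrite /q; field.
have nh : 0 < nm h by rewrite nm_gt0.
have h2 : nm (q ^+ 2 / h) <= e1 * nm h.
  rewrite nmf nmX ler_pdivrMr // -mulrA.
  have : nm q ^+ 2 <= (e1 * nm h) ^+ 2.
    by rewrite ler_pXn2r // nnegrE ?nm_ge0 // mulr_ge0 ?ltW.
  have : 0 <= nm h ^+ 2 by rewrite exprn_ge0 // nm_ge0.
  rewrite exprMn -!expr2; nra.
have h1 : nm (2 * a * q) <= 2 * nm a * (e1 * nm h).
  by rewrite !nmM nm_nat ler_wpM2l // mulr_ge0.
have := nmD (2 * a * q) (q ^+ 2 / h).
have := nm_ge0 h.
nra.
Qed.

(** Apply [goursat] to (f w - f z) ^ 2 / (w - z) on a square centred at z and
    expand the square. With K the sum of 1 / (w - z), of modulus at least 4,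
    this gives 4 |f z| ^ 2 <= 16 m |f z| + 8 m ^ 2. *)
Lemma crude_max (f : C -> C) (z : C) (s m : R) : 0 < s -> 0 <= m ->
  (forall w, nm (w - z) <= 6 * s -> dv f w) ->
  (forall w, s <= nm (w - z) <= 2 * s -> nm (f w) <= m) ->
  nm (f z) <= 5 * m.
Proof.
move=> s0 m0 df fm.
pose k (x : C) := (x - z)^-1.
pose g (x : C) := (f x - f z) ^+ 2 / (x - z).
pose p := z - rc s - ci * rc s.
have dg w : nm (w - p) <= 2 * (2 * s) -> dv g w.
  move=> wp; have wz : nm (w - z) <= 6 * s.
    have -> : w - z = (w - p) - rc s - ci * rc s by rewrite /p; ring.
    have h1 := nmB (w - p) (rc s); have h2 := nmB (w - p - rc s) (ci * rc s).
    have n1 : nm (rc s) = s by rewrite nm_rc ger0_norm // ltW.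
    have n2 : nm (ci * rc s) = s by rewrite nmM nm_i mul1r.
    lra.
  have [->|nwz] := eqVneq w z; first by apply: sq_quot_derivable; apply: df; rewrite subrr nm0 mulr_ge0 // ltW.
  apply: dvM.
    apply: dvX; apply: dvB; [exact: df|exact: dv_cst].
  apply: dvV; first by rewrite subr_eq0.
  by apply: dvB; [exact: dv_id|exact: dv_cst].
have s20 : 0 < 2 * s by rewrite mulr_gt0.
pose A N := sqsum (fun x => f x ^+ 2 * k x) N p (rc (2 * s)).
pose B N := sqsum (fun x => f x * k x) N p (rc (2 * s)).
pose K N := sqsum k N p (rc (2 * s)).
have gE N : sqsum g N p (rc (2 * s)) = A N - 2 * f z * B N + f z ^+ 2 * K N.
  rewrite /A /B /K -[_ - _]/(_ + _) -mulNr -[X in X + _ * B N]mul1r -sqsum_linear.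
  rewrite -[X in X + _ * K N]mul1r -sqsum_linear; congr (sqsum _ _ _ _).
  by apply/funext => x; rewrite /g /k; ring.
(* The side om of the square is traversed as om times the bottom side. *)
have edge h N (b : R) : (forall w, s <= nm (w - z) <= 2 * s -> nm (h w) <= b) ->
    nm (sqsum h N p (rc (2 * s))) <= 8 * s * b.
  move=> hb.
  have E (om : C) q e : nm om = 1 -> q = z - om * rc s - om * ci * rc s ->
      e = om * rc (2 * s) -> nm (segsum h N q e) <= b * (2 * s).
    move=> om1 -> ->.
    have ne : nm (om * rc (2 * s)) = 2 * s by rewrite nmM om1 mul1r nm_rc ger0_norm ?ltW.
    rewrite -[X in _ <= _ * X]ne.
    apply: segsum_bound => t tt; have [h1 h2 _] := edge_point s0 tt; apply: hb.
    pose x : C := rc (2 * s * t - s) - ci * rc s; rewrite -/x in h1 h2.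
    have -> : z - om * rc s - om * ci * rc s + rc t * (om * rc (2 * s)) - z = om * x.
      by rewrite /x rcD rcN !rcM; ring.
    by rewrite nmM om1 mul1r h1 h2.
  have ii := i_sqr.
  rewrite /sqsum.
  have e1 := E 1 p (rc (2 * s)) nm1.
  have e2 := E ci (p + rc (2 * s)) (ci * rc (2 * s)) nm_i.
  have e3 := E (- 1) (p + rc (2 * s) + ci * rc (2 * s)) (- rc (2 * s)).
  have e4 := E (- ci) (p + ci * rc (2 * s)) (- (ci * rc (2 * s))).
  have r2 : rc (2 * s) = 2 * rc s by rewrite rcM rc_nat.
  have -> : 8 * s * b = b * (2 * s) + b * (2 * s) + b * (2 * s) + b * (2 * s) by ring.
  apply: nmD4.
  - by apply: e1; rewrite ?mul1r // /p; ring.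
  - by apply: e2 => //; rewrite ii r2 /p; ring.
  - by apply: e3; rewrite ?nmN ?nm1 ?mulN1r // r2 /p; ring.
  - by apply: e4; rewrite ?nmN ?nm_i ?mulNr // ii r2 /p; ring.
have kb w : s <= nm (w - z) <= 2 * s -> nm (k w) <= s^-1.
  by move=> /andP [h1 _]; rewrite nmV lef_pV2 // posrE (lt_le_trans s0).
have AB N : nm (A N) <= 8 * m ^+ 2.
  have -> : 8 * m ^+ 2 = 8 * s * (m ^+ 2 * s^-1) by field; rewrite lt0r_neq0.
  apply: edge => w ww; rewrite nmM nmX ler_pM ?exprn_ge0 ?nm_ge0 ?kb //.
  by rewrite ler_pXn2r ?nnegrE ?nm_ge0 // fm.
have BB N : nm (B N) <= 8 * m.
  have -> : 8 * m = 8 * s * (m * s^-1) by field; rewrite lt0r_neq0.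
  by apply: edge => w ww; rewrite nmM ler_pM ?nm_ge0 ?kb // fm.
(* Each side contributes at least 1 to the imaginary part. *)
have KB N : 4 <= nm (K N).
  apply: le_trans (nm_Im _).
  have E (om : C) q e : nm om = 1 -> q = z - om * rc s - om * ci * rc s ->
      e = om * rc (2 * s) -> 1 <= complex.Im (segsum k N q e).
    move=> om1 -> ->; apply: segsum_Im => t tt; have [h1 _ h3] := edge_point s0 tt.
    pose x : C := rc (2 * s * t - s) - ci * rc s; rewrite -/x in h1 h3.
    apply: le_trans h3 _; rewrite le_eqVlt; apply/orP; left; apply/eqP.
    congr (complex.Im _); rewrite /k.
    have -> : z - om * rc s - om * ci * rc s + rc t * (om * rc (2 * s)) - z = om * x.
      by rewrite /x rcD rcN !rcM; ring.
    have om0 : om != 0 by rewrite -nm_eq0 om1 oner_eq0.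
    have x0 : x != 0 by rewrite -nm_gt0 (lt_le_trans s0).
    by field; rewrite x0.
  have ii := i_sqr.
  have e1 := E 1 p (rc (2 * s)) nm1.
  have e2 := E ci (p + rc (2 * s)) (ci * rc (2 * s)) nm_i.
  have e3 := E (- 1) (p + rc (2 * s) + ci * rc (2 * s)) (- rc (2 * s)).
  have e4 := E (- ci) (p + ci * rc (2 * s)) (- (ci * rc (2 * s))).
  have r2 : rc (2 * s) = 2 * rc s by rewrite rcM rc_nat.
  have := e1; have := e2; have := e3; have := e4.
  rewrite /K /sqsum !(raddfD (@complex.Im R)) /= => {}e4 {}e3 {}e2 {}e1.
  have -> : (4 : R) = 1 + 1 + 1 + 1 by ring.
  do !apply: lerD.
  - by apply: e1; rewrite ?mul1r // /p; ring.
  - by apply: e2 => //; rewrite ii r2 /p; ring.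
  - by apply: e3; rewrite ?nmN ?nm1 ?mulN1r // r2 /p; ring.
  - by apply: e4; rewrite ?nmN ?nm_i ?mulNr // ii r2 /p; ring.
have Q : 4 * nm (f z) ^+ 2 <= 16 * m * nm (f z) + 8 * m ^+ 2.
  apply/ler_addgt0Pl => e e0.
  have [N0 HN] := goursat s20 dg e0.
  have := HN N0 (leqnn _); rewrite gE => h.
  have h1 : nm (f z ^+ 2 * K N0) <= nm (A N0 - 2 * f z * B N0 + f z ^+ 2 * K N0)
     + nm (A N0) + nm (2 * f z * B N0).
    have E : f z ^+ 2 * K N0 = (A N0 - 2 * f z * B N0 + f z ^+ 2 * K N0)
      - A N0 + 2 * f z * B N0 by ring.
    rewrite {1}E.
    apply: le_trans (nmD _ _) _; rewrite lerD2r.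
    exact: nmB.
  have h2 : nm (f z) ^+ 2 * 4 <= nm (f z ^+ 2 * K N0).
    by rewrite nmM nmX ler_wpM2l // exprn_ge0 // nm_ge0.
  have h3 : nm (2 * f z * B N0) <= 2 * nm (f z) * (8 * m).
    by rewrite !nmM nm_nat ler_wpM2l // mulr_ge0 // nm_ge0.
  have := AB N0; lra.
have F0 := nm_ge0 (f z).
rewrite leNgt; apply/negP => lt; nra.
Qed.

(** Applying [crude_max] to the powers of f removes the factor 5. *)
Lemma max_principle (f : C -> C) (z : C) (s m : R) : 0 < s -> 0 <= m ->
  (forall w, nm (w - z) <= 6 * s -> dv f w) ->
  (forall w, s <= nm (w - z) <= 2 * s -> nm (f w) <= m) ->
  nm (f z) <= m.
Proof.
move=> s0 m0 df fm; apply: (@le_of_expr _ _ 5 1); rewrite ?nm_ge0 // => k.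
rewrite mul1r -nmX.
have mk : 0 <= m ^+ k by exact: exprn_ge0.
apply: (crude_max (f := fun x => f x ^+ k) s0 mk) => w hw.
  by apply: dvX; exact: df.
by rewrite nmX; apply: lerXn2r; rewrite ?nnegrE ?nm_ge0 // fm.
Qed.

Lemma dv_quadratic (f : C -> C) (z a : C) (K r : R) : 0 < r ->
  (forall h, nm h < r -> nm (f (z + h) - f z - h * a) <= K * nm h ^+ 2) ->
  dva f z a.
Proof.
move=> r0 H; apply/dv_nmP => e e0.
have K0 : 0 < `|K| + 1 by rewrite ltr_wpDl.
exists (Num.min r (e / (`|K| + 1))); first by rewrite lt_min r0 divr_gt0.
move=> h; rewrite lt_min => /andP [hr hK].
apply: le_trans (H _ hr) _; rewrite expr2 mulrA ler_wpM2r ?nm_ge0 //.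
move: hK; rewrite ltr_pdivlMr // => hK; apply: le_trans (ltW hK).
rewrite mulrC ler_wpM2l ?nm_ge0 // (le_trans (ler_norm _)) // lerDl //.
Qed.

(** Two exceptional points are allowed if f stays bounded: the factor ((w - a)
    (w - b)) ^ 2 makes the product with a power of f differentiable there, and
    it disappears by the power trick. *)
Lemma max_principle2 (f : C -> C) (z a b : C) (s r m B : R) : 0 < s -> 6 * s < r ->
  0 <= m -> z != a -> z != b ->
  (forall w, nm (w - z) < r -> w != a -> w != b -> dv f w /\ nm (f w) <= B) ->
  (forall w, s <= nm (w - z) <= 2 * s -> nm (f w) <= m) ->
  nm (f z) <= m.
Proof.
move=> s0 sr m0 za zb H fm.
have r60 : 0 < r - 6 * s by rewrite subr_gt0.
(* The product is differentiable at the exceptional points, being O(h ^ 2). *)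
have exc (c d : C) (k : nat) : (forall w, nm (w - z) < r -> w != c -> w != d ->
    nm (f w) <= B) -> nm (c - z) <= 6 * s ->
    dv (fun w => ((w - c) * (w - d)) ^+ 2 * f w ^+ k) c.
  move=> H' cz; set g := (fun w => _).
  exists 0.
  apply: (dv_quadratic (K := (nm (c - d) + 1) ^+ 2 * `|B| ^+ k) (r := Num.min 1 (r - 6 * s))).
    by rewrite lt_min ltr01.
  move=> h; rewrite lt_min => /andP [h1 h6].
  have -> : g (c + h) - g c - h * 0 = g (c + h).
    by rewrite /g subrr mul0r expr0n /= mul0r mulr0 !subr0.
  have nn : 0 <= (nm (c - d) + 1) ^+ 2 * `|B| ^+ k * nm h ^+ 2.
    by rewrite !mulr_ge0 ?exprn_ge0 ?addr_ge0 ?nm_ge0.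
  have [h0|hn0] := eqVneq h 0.
    rewrite h0 in nn *; by rewrite /g addr0 subrr mul0r expr0n /= mul0r nm0 -{2}(nm0 (V := C)).
  have [hd|hnd] := eqVneq (c + h) d.
    by rewrite /g hd subrr mulr0 expr0n /= mul0r nm0.
  have e1 : nm (c + h - c) = nm h by rewrite addrAC subrr add0r.
  have e2 : nm (c + h - d) <= nm (c - d) + 1.
    by rewrite addrAC; apply: le_trans (nmD _ _) _; rewrite lerD2l ltW.
  have e3 : nm (f (c + h)) <= `|B|.
    apply: le_trans (ler_norm _); apply: H' => //.
      have -> : c + h - z = (c - z) + h by ring.
      by have := nmD (c - z) h; lra.
    by rewrite -subr_eq0 addrAC subrr add0r.
  have -> : nm (g (c + h)) =
      nm h ^+ 2 * (nm (c + h - d) ^+ 2 * nm (f (c + h)) ^+ k).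
    by rewrite /g nmM !nmX nmM exprMn e1 mulrA.
  rewrite [leRHS]mulrC ler_wpM2l ?exprn_ge0 ?nm_ge0 //.
  by apply: ler_pM; rewrite ?exprn_ge0 ?nm_ge0 //; apply: lerXn2r;
    rewrite ?nnegrE ?nm_ge0 ?addr_ge0 ?nm_ge0.
pose A := (2 * s + nm (z - a)) * (2 * s + nm (z - b)).
have A0 : 0 <= A by rewrite mulr_ge0 // addr_ge0 ?nm_ge0 // mulr_ge0 // ltW.
apply: (@le_of_expr _ _ (A ^+ 2) ((nm (z - a) * nm (z - b)) ^+ 2)) => //.
- exact: nm_ge0.
- by rewrite exprn_gt0 // mulr_gt0 // nm_gt0 subr_eq0.
- by rewrite exprn_ge0.
move=> k; rewrite -nmM -!nmX -nmM.
have mk : 0 <= A ^+ 2 * m ^+ k by rewrite mulr_ge0 // exprn_ge0.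
apply: (max_principle (f := fun w => ((w - a) * (w - b)) ^+ 2 * f w ^+ k) s0 mk) => w hw.
  have [wa|wa] := eqVneq w a.
    rewrite wa.
    apply: exc; last by rewrite -wa.
    by move=> v v1 v2 v3; case: (H v v1 v2 v3).
  have [wb|wb] := eqVneq w b.
    rewrite wb.
    rewrite (_ : (fun v => _) = fun v => ((v - b) * (v - a)) ^+ 2 * f v ^+ k).
      apply: exc; last by rewrite -wb.
      by move=> v v1 v2 v3; case: (H v v1 v3 v2).
    by apply/funext => v; rewrite [(v - b) * _]mulrC.
  apply: dvM; apply: dvX; last by case: (H w (le_lt_trans hw sr) wa wb).
  by apply: dvM; apply: dvB; [exact: dv_id|exact: dv_cst|exact: dv_id|exact: dv_cst].
rewrite nmM !nmX nmM; apply: ler_pM; rewrite ?exprn_ge0 ?mulr_ge0 ?nm_ge0 //.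
  apply: lerXn2r; [by rewrite nnegrE mulr_ge0 // nm_ge0|by rewrite nnegrE|].
  move: hw => /andP [_ hw].
  apply: ler_pM; rewrite ?nm_ge0 //.
    by apply: le_trans (nm_tri _ z _) _; rewrite lerD2r.
  by apply: le_trans (nm_tri _ z _) _; rewrite lerD2r.
by apply: lerXn2r; rewrite ?nnegrE ?nm_ge0 // fm.
Qed.

(** * Removable singularities and Taylor coefficients in one variable *)

(** Holomorphic and bounded on a punctured disc. *)
Definition punct (phi : C -> C) (r M : R) :=
  forall w : C, w != 0 -> nm w < r -> dv phi w /\ nm (phi w) <= M.

(** The quotient (phi w - phi b) / (w - b) is holomorphic and bounded away from
    0 and b, and is small on the annulus of radius r / 8 to r / 4 around z;
    [max_principle2] carries this bound to z. *)
Lemma punct_lip (phi : C -> C) (r M : R) (z b : C) : 0 < r -> punct phi r M -> z != 0 -> b != 0 ->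
  nm z < r / 32 -> nm b < r / 32 -> nm (phi z - phi b) <= 32 * M / r * nm (z - b).
Proof.
move=> r0 H z0 b0 zr br.
have zr' : nm z < r by lra.
have M0 : 0 <= M by have [_] := H z z0 zr'; apply: le_trans; exact: nm_ge0.
have [->|zb] := eqVneq z b; first by rewrite !subrr !nm0 mulr0.
have nzb : 0 < nm (z - b) by rewrite nm_gt0 subr_eq0.
rewrite -ler_pdivrMr // -nmf.
have rb : nm b < r by lra.
have [db _] := H _ b0 rb.
move: db => [a /dv_nmP /(_ _ ltr01) [d d0 Hd]].
pose B := Num.max (nm a + 1) (2 * M / d).
have sr : 6 * (r / 8) < r - nm z by lra.
apply: (max_principle2 (f := fun w => (phi w - phi b) / (w - b)) (a := 0) (b := b)
  (B := B) _ sr) => //.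
- by rewrite divr_gt0.
- by rewrite divr_ge0 ?mulr_ge0 // ltW.
- move=> w wz w0 wb.
  have wr : nm w < r.
    by have := nmD (w - z) z; rewrite subrK; lra.
  have [dw mw] := H w w0 wr.
  split.
    apply: dvM; first by apply: dvB; [exact: dw|exact: dv_cst].
    apply: dvV; first by rewrite subr_eq0.
    by apply: dvB; [exact: dv_id|exact: dv_cst].
  have nwb : 0 < nm (w - b) by rewrite nm_gt0 subr_eq0.
  rewrite nmf ler_pdivrMr //.
  have [wd|dw'] := ltP (nm (w - b)) d.
    have := Hd _ wd; rewrite mul1r [b + _]addrC subrK => h.
    have h1 : nm (phi w - phi b) <= nm (phi w - phi b - (w - b) * a) + nm ((w - b) * a).
      by apply: le_trans (nmD _ _); rewrite subrK.
    apply: le_trans h1 _; rewrite nmM.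
    apply: le_trans (lerD h (lexx _)) _.
    rewrite -{1}[nm (w - b)]mulr1 -mulrDr mulrC ler_wpM2r ?nm_ge0 //.
    by rewrite addrC /B le_max lexx.
  have [_ mb] := H b b0 rb.
  apply: le_trans (nmB _ _) _.
  apply: (@le_trans _ _ (2 * M / d * d)); first by rewrite divfK ?lt0r_neq0 //; lra.
  apply: ler_pM => //; [|exact: ltW|by rewrite /B le_max lexx orbT].
  by rewrite divr_ge0 ?mulr_ge0 // ltW.
move=> w /andP [w1 w2].
have wr : nm w < r by have := nmD (w - z) z; rewrite subrK; lra.
have wn0 : w != 0.
  apply/eqP => w0; move: w1; rewrite w0 sub0r nmN; lra.
have [_ mw] := H w wn0 wr; have [_ mb] := H b b0 rb.
have wb : r / 16 <= nm (w - b).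
  have := nm_tri w b z; have := nmB b z; lra.
rewrite nmf ler_pdivrMr; last by lra.
apply: le_trans (nmB _ _) _.
apply: (@le_trans _ _ (32 * M / r * (r / 16))).
  have -> : 32 * M / r * (r / 16) = 2 * M by field; rewrite lt0r_neq0.
  lra.
by rewrite ler_wpM2l // divr_ge0 ?mulr_ge0 // ltW.
Qed.

Lemma punct_limit (phi : C -> C) (r M : R) : 0 < r -> punct phi r M ->
  exists L : C, forall z : C,
  z != 0 -> nm z < r / 32 -> nm (phi z - L) <= 32 * M / r * nm z.
Proof.
move=> r0 H.
pose u n := rc (r / 64 * 2^-1 ^+ n).
have un n : nm (u n) = r / 64 * 2^-1 ^+ n.
  by rewrite nm_rc ger0_norm // mulr_ge0 ?exprn_ge0 ?divr_ge0 // ltW.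
have hn n : 2^-1 ^+ n <= 1 :> R by rewrite exprn_ile1 //; lra.
have unr n : nm (u n) < r / 32.
  rewrite un; have := ler_wpM2l (ltW (divr_gt0 r0 (ltr0n R 64))) (hn n); lra.
have u0 n : u n != 0 by rewrite -nm_gt0 un mulr_gt0 ?divr_gt0 ?exprn_gt0.
have u0r : nm (u 0%N) < r by have := unr 0%N; lra.
have M0 : 0 <= M by have [_] := H _ (u0 0%N) u0r; apply: le_trans; exact: nm_ge0.
have K0 : 0 <= 32 * M / r by rewrite divr_ge0 ?mulr_ge0 // ltW.
have [||| L HL] := @nm_geometric (fun n => phi (u n)) (32 * M / r * (r / 64)) (2^-1).
- by rewrite mulr_ge0 // divr_ge0 // ltW.
- by apply/andP; split; lra.
- move=> k; apply: le_trans (punct_lip r0 H _ _ _ _) _ => //.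
  rewrite -[leRHS]mulrA ler_wpM2l //.
  have : 0 <= r / 64 * 2^-1 ^+ k by rewrite -un nm_ge0.
  rewrite /u -rcN -rcD nm_rc exprS => h; rewrite ler_norml; apply/andP; split; lra.
exists L => z z0 zr.
apply/ler_addgt0Pl => e e0.
pose A := 32 * M / r * (r / 64) / (1 - 2^-1) + 32 * M / r * (r / 64).
have cv : (fun n => A * 2^-1 ^+ n) @ \oo --> (0 : R).
  rewrite -(mulr0 A); apply: cvgM; first exact: cvg_cst.
  by apply: cvg_expr; rewrite ger0_norm //; lra.
move/cvgrPdist_le : cv => /(_ _ e0) [N _ /(_ N (leqnn _))] /=.
rewrite sub0r normrN => /(le_trans (ler_norm _)); rewrite /A mulrDl => hN.
have h1 := HL N.
have h2 := punct_lip r0 H z0 (u0 N) zr (unr N).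
have h3 : 32 * M / r * nm (z - u N) <= 32 * M / r * (nm z + nm (u N)).
  by rewrite ler_wpM2l // nmB.
have h4 := nm_tri (phi z) (phi (u N)) L.
move: h3; rewrite mulrDr un mulrA => h3.
lra.
Qed.

(** The limit L of phi exists by [punct_limit], and (phi - L) / w is again
    bounded by [punct_lip], so it has a limit, which is the derivative at 0. *)
Lemma removable (phi : C -> C) (r M : R) : 0 < r -> punct phi r M ->
  exists L a : C, dva (fun w => if w == 0 then L else phi w) 0 a.
Proof.
move=> r0 H; have [L HL] := punct_limit r0 H.
have r320 : 0 < r / 32 by rewrite divr_gt0.
have H2 : punct (fun w => (phi w - L) / w) (r / 32) (32 * M / r).
  move=> w w0 wr; have wr' : nm w < r by lra.
  have [dw _] := H w w0 wr'; split; last by rewrite nmf ler_pdivrMr ?nm_gt0 // HL.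
  apply: dvM; first by apply: dvB; [exact: dw|exact: dv_cst].
  exact: dv_inv.
have [a Ha] := punct_limit r320 H2.
exists L, a; apply: (dv_quadratic (K := 32 * (32 * M / r) / (r / 32)) (r := r / 32 / 32)).
  by rewrite divr_gt0.
move=> h hr; rewrite add0r eqxx.
have [->|h0] := eqVneq h 0.
  by rewrite subrr mul0r subr0 !nm0 expr0n /= mulr0.
have -> : phi h - L - h * a = ((phi h - L) / h - a) * h by field.
by rewrite nmM expr2 mulrA ler_wpM2r ?nm_ge0 // Ha.
Qed.

Definition hol (r : R) (f : C -> C) := forall w : C, nm w < r -> dv f w.

(** Division of f - f 0 by the variable. The Taylor coefficients of f are the
    values at 0 of its iterates. *)
Definition shiftf (f : C -> C) (w : C) : C :=
  if w == 0 then der f 0 (1 : C) else (f w - f 0) / w.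

Lemma hol_le r r' f : r' <= r -> hol r f -> hol r' f.
Proof. by move=> rr H w wr; apply: H; exact: lt_le_trans rr. Qed.

Lemma dv_bound (f : C -> C) (z : C) : dv f z -> exists K r : R, [/\ 0 < r, 0 <= K &
  forall w, nm (w - z) < r -> nm (f w - f z) <= K * nm (w - z)].
Proof.
move=> [a /dv_nmP /(_ _ ltr01) [d d0 Hd]].
exists (nm a + 1), d; split => //; first by rewrite addr_ge0 // nm_ge0.
move=> w /Hd; rewrite mul1r [z + _]addrC subrK => h.
have E : f w - f z = f w - f z - (w - z) * a + (w - z) * a by rewrite subrK.
rewrite E; apply: le_trans (nmD _ _) _.
have -> : (nm a + 1) * nm (w - z) = nm (w - z) + nm (w - z) * nm a by ring.
by rewrite nmM lerD2r.
Qed.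

(** The quotient is bounded near 0, so its singularity there is removable; the
    value that removes it is the derivative of f. *)
Lemma hol_shift r f : hol r f -> hol r (shiftf f).
Proof.
move=> H w wr.
have dq (v : C) : v != 0 -> nm v < r -> dv (fun v => (f v - f 0) / v) v.
  move=> v0 vr; apply: dvM; first by apply: dvB; [exact: H|exact: dv_cst].
  exact: dv_inv.
have [w0|w0] := eqVneq w 0; last first.
  have [a dw] := dq w w0 wr; exists a.
  have nw : 0 < nm w by rewrite nm_gt0.
  apply: deriv_at_local nw _ dw => v vw; rewrite /shiftf.
  have [v0|//] := eqVneq v 0.
  by move: vw; rewrite v0 sub0r nmN ltxx.
have r0 : 0 < r by apply: le_lt_trans wr; exact: nm_ge0.
have d0 : dv f 0 by apply: H; rewrite nm0.
have [K [d [dp K0 Hd]]] := dv_bound d0.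
have P : punct (fun v => (f v - f 0) / v) (Num.min r d) K.
  move=> v v0; rewrite lt_min => /andP [v1 v2]; split; first exact: dq.
  by rewrite nmf ler_pdivrMr ?nm_gt0 //; have := Hd v; rewrite subr0; apply.
have rd : 0 < Num.min r d by rewrite lt_min r0.
have [L [a Ha]] := removable rd P.
have [L' HL'] := punct_limit rd P.
suff LE : L = der f 0 (1 : C) by rewrite w0; exists a; rewrite LE in Ha.
move: d0 => /der_at; set b := der _ _ _ => db.
(* Both L and the derivative are limits of the difference quotient. *)
have [K' [d' [d'p K'0 Hd']]] := dv_bound (dvable_at Ha).
apply/eqP; rewrite -subr_eq0 -nm_eq0 eq_le nm_ge0 andbT.
apply/ler_addgt0Pl => e e0; rewrite addr0.
have /dv_nmP /(_ _ (divr_gt0 e0 (ltr0n R 2))) [d2 d2p Hd2] := db.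
pose t := Num.min (Num.min d' d2) (e / (2 * (K' + 1))) / 2.
have m0 : 0 < Num.min (Num.min d' d2) (e / (2 * (K' + 1))).
  by rewrite !lt_min d'p d2p divr_gt0 // mulr_gt0 // ltr_wpDl.
have t0 : 0 < t by rewrite divr_gt0.
have : t < Num.min (Num.min d' d2) (e / (2 * (K' + 1))).
  by rewrite /t ltr_pdivrMr // ltr_pMr // ltr1n.
rewrite !lt_min => /andP [/andP [t1 t2] t3].
have nt : nm (rc t) = t by rewrite nm_rc ger0_norm // ltW.
have tn0 : rc t != 0 by rewrite -nm_gt0 nt.
have h1 := Hd' (rc t); rewrite subr0 nt eqxx (negbTE tn0) in h1.
have h2 := Hd2 (rc t); rewrite nt add0r in h2.
have -> : L - b = ((f (rc t) - f 0 - rc t * b) / rc t) - ((f (rc t) - f 0) / rc t - L) by field.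
apply: le_trans (nmB _ _) _.
have h3 : nm ((f (rc t) - f 0 - rc t * b) / rc t) <= e / 2.
  by rewrite nmf nt ler_pdivrMr // h2.
have h4 : K' * t <= e / 2.
  have k1 : 0 < K' + 1 by rewrite ltr_wpDl.
  move: t3; rewrite ltr_pdivlMr ?mulr_gt0 // => t3; nra.
have := h1 t1; lra.
Qed.

(** The bound is clear for |w| >= r / 32, and the maximum principle extends it
    to the smaller w. *)
Lemma shift_bound r f M : 0 < r -> hol r f -> (forall w, nm w < r -> nm (f w) <= M) ->
  forall w, nm w < r -> nm (shiftf f w) <= 64 / r * M.
Proof.
move=> r0 H HM.
have M0 : 0 <= M by apply: le_trans (HM 0 _); rewrite ?nm_ge0 // nm0.
have far w : r / 32 <= nm w -> nm w < r -> nm (shiftf f w) <= 64 / r * M.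
  move=> rw wr; rewrite /shiftf.
  have wp : 0 < nm w by apply: lt_le_trans rw; rewrite divr_gt0.
  have wn0 : w != 0 by rewrite -nm_gt0.
  rewrite (negbTE wn0) nmf ler_pdivrMr //.
  have h0 := HM 0; rewrite nm0 in h0.
  apply: le_trans (nmB _ _) _; apply: (@le_trans _ _ (64 / r * M * (r / 32))).
    have -> : 64 / r * M * (r / 32) = 2 * M by field; rewrite lt0r_neq0.
    by have := HM w wr; have := h0 r0; lra.
  by rewrite ler_wpM2l // mulr_ge0 // divr_ge0 // ltW.
move=> w wr; have [rw|rw] := leP (r / 32) (nm w); first exact: far.
apply: (max_principle (s := r / 8)).
- by rewrite divr_gt0.
- by rewrite mulr_ge0 // divr_ge0 // ltW.
- move=> v vw; apply: (hol_shift H).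
  by have := nmD (v - w) w; rewrite subrK; lra.
move=> v /andP [v1 v2]; apply: far.
  by have := nmB v w; lra.
by have := nmD (v - w) w; rewrite subrK; lra.
Qed.

Definition tcoef (q : nat) (f : C -> C) : C := iter q shiftf f 0.

Lemma tcoefS q f : tcoef q.+1 f = tcoef q (shiftf f).
Proof. by rewrite /tcoef iterSr. Qed.

(** Iterating f w = f 0 + w * shiftf f w. *)
Lemma taylor q f w :
  f w = \sum_(k < q) tcoef k f * w ^+ k + w ^+ q * iter q shiftf f w.
Proof.
elim: q f => [|q IH] f; first by rewrite big_ord0 add0r mul1r.
have E : f w = f 0 + w * shiftf f w.
  rewrite /shiftf; have [->|w0] := eqVneq w 0; first by rewrite mul0r addr0.
  by field.
rewrite big_ord_recl /= {1}E (IH (shiftf f)) mulrDr mulr1 -addrA; congr (_ + (_ + _)).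
  rewrite mulr_sumr; apply: eq_bigr => k _.
  by rewrite /bump /= add1n tcoefS exprS mulrCA mulrA.
by rewrite -iterSr /= exprS mulrA.
Qed.

Lemma hol_iter q r f : hol r f -> hol r (iter q shiftf f).
Proof.
move=> H; elim: q => [|q IH]; first exact: H.
exact: (hol_shift IH).
Qed.

Lemma iter_bound q r f M : 0 < r -> hol r f -> (forall w, nm w < r -> nm (f w) <= M) ->
  forall w, nm w < r -> nm (iter q shiftf f w) <= (64 / r) ^+ q * M.
Proof.
move=> r0 H HM; elim: q => [|q IH]; first by move=> w /HM; rewrite mul1r.
move=> w wr; rewrite exprS -mulrA; apply: (shift_bound r0 _ IH wr).
exact: hol_iter.
Qed.

Lemma tcoef_bound q r f M : 0 < r -> hol r f -> (forall w, nm w < r -> nm (f w) <= M) ->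
  nm (tcoef q f) <= (64 / r) ^+ q * M.
Proof. by move=> r0 H HM; apply: (iter_bound q r0 H HM); rewrite nm0. Qed.

Lemma der_ext (V : normedModType C) (f g : V -> C) (x v : V) (r : R) : 0 < r ->
  (forall y, nm (y - x) < r -> f y = g y) -> der f x v = der g x v.
Proof.
by move=> r0 E; apply: near_eq_derive; apply/nearE_nm; exists r.
Qed.

Lemma shift_ext r f g : 0 < r -> (forall w, nm w < r -> f w = g w) ->
  forall w, nm w < r -> shiftf f w = shiftf g w.
Proof.
move=> r0 E w wr; have E0 : f 0 = g 0 by apply: E; rewrite nm0.
rewrite /shiftf (E _ wr) E0; case: eqP => [_|//]; apply: (der_ext _ r0) => v.
by rewrite subr0; exact: E.
Qed.

Lemma tcoef_ext q r f g : 0 < r -> (forall w, nm w < r -> f w = g w) ->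
  tcoef q f = tcoef q g.
Proof.
move=> r0; elim: q f g => [|q IH] f g E; first by apply: E; rewrite nm0.
by rewrite !tcoefS; apply: IH => w wr; apply: (shift_ext r0).
Qed.

End RealNorm.
Notation dv f z := (dvable f z 1).
Notation dva f z a := (deriv_at f z 1 a).

(** * Holomorphic functions on normed spaces: Cauchy, Weierstrass, second derivatives *)

#[global] Transparent der deriv_at.

Section Several.
Context {R : realType}.
Local Notation C := (Cplx R).

Section V.
Context {V : normedModType C}.
Implicit Types (f g : V -> C) (x y v w : V) (r M : R).

Definition fdiff f x : Prop := differentiable (f : V -> C^o) x.

Lemma fdiff_deriv f x v : fdiff f x -> deriv_at f x v (der f x v).
Proof.
move=> H; apply: der_at; exists (derive (f : V -> C^o) x v).
by split; first exact: diff_derivable.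
Qed.

Lemma der0 f x : der f x 0 = 0.
Proof. exact: derive0. Qed.

Lemma fdiff_linear f x (a : C) v w : fdiff f x ->
  der f x (a *: v + w) = a * der f x v + der f x w.
Proof.
move=> H; rewrite /der !deriveE //; try exact: H.
by rewrite linearP.
Qed.

Lemma fdiff_cst (c : C) x : fdiff (fun=> c) x.
Proof. exact: differentiable_cst. Qed.
Lemma fdiffD f g x : fdiff f x -> fdiff g x -> fdiff (fun y => f y + g y) x.
Proof. exact: differentiableD. Qed.
Lemma fdiffB f g x : fdiff f x -> fdiff g x -> fdiff (fun y => f y - g y) x.
Proof. exact: differentiableB. Qed.
Lemma fdiffM f g x : fdiff f x -> fdiff g x -> fdiff (fun y => f y * g y) x.
Proof. exact: differentiableM. Qed.
Lemma fdiffV f x : f x != 0 -> fdiff f x -> fdiff (fun y => (f y)^-1) x.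
Proof. by move=> fx df; exact: differentiableV. Qed.
Lemma fdiff_sum (I : Type) (s : seq I) (F : I -> V -> C) x :
  (forall i, fdiff (F i) x) -> fdiff (fun y => \sum_(i <- s) F i y) x.
Proof.
move=> H; elim: s => [|i s IH].
  rewrite (_ : (fun y => _) = fun=> 0); first exact: fdiff_cst.
  by apply/funext => y; rewrite big_nil.
rewrite (_ : (fun y => _) = fun y => F i y + \sum_(j <- s) F j y); first exact: fdiffD.
by apply/funext => y; rewrite big_cons.
Qed.
(** The differential of f at x is bounded since it is continuous at 0; with this
    bound differentiability is a statement about norms on a small ball. *)
Lemma fdiff_local f g x r : 0 < r -> (forall y, nm (y - x) < r -> f y = g y) ->
  fdiff f x -> fdiff g x.
Proof.
move=> r0 E fx.
have Ld y : 'd (f : V -> C^o) x y = der f x y by rewrite /der deriveE.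
have fK : continuous ('d (f : V -> C^o) x) by exact: diff_continuous.
have [d d0 Hd] := proj1 (continuous_nmP _ 0) (fK 0) 1 ltr01.
apply: (differentiable_nmP (L := 'd (f : V -> C^o) x) (K := 2 / d)).
  move=> v; rewrite Ld; have [->|v0] := eqVneq v 0; first by rewrite der0 !nm0 mulr0.
  have nv : 0 < nm v by rewrite nm_gt0.
  have nd : nm (rc (d / 2 / nm v)) = d / 2 / nm v.
    by rewrite nm_rc gtr0_norm // !divr_gt0.
  have := Hd (rc (d / 2 / nm v) *: v).
  rewrite !Ld der0 -[_ *: v]addr0 fdiff_linear // der0 !addr0 !subr0 nmZ nmM nd.
  rewrite divfK ?lt0r_neq0 // => h.
  have {}h := h (ltac:(lra)).
  have -> : nm (der f x v) = (d / 2 / nm v * nm (der f x v)) * (2 / d * nm v).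
    by field; rewrite !lt0r_neq0.
  by rewrite ler_piMl ?ltW // mulr_gt0 // divr_gt0.
move=> e e0; have [d1 d10 H1] := diff_nm fx e0.
exists (Num.min r d1); first by rewrite lt_min r0.
move=> v; rewrite lt_min => /andP [vr vd].
rewrite -!E ?subrr ?nm0 //; first exact: H1.
by rewrite addrAC subrr add0r.
Qed.

Lemma fdiff_cont f x : fdiff f x -> forall e : R, 0 < e ->
  exists2 r : R, 0 < r & forall y, nm (y - x) < r -> nm (f y - f x) < e.
Proof.
by move=> H; apply/continuous_nmP; exact: differentiable_continuous.
Qed.

Lemma fdiff_bounded f x : fdiff f x -> exists M r : R, [/\ 0 < r, 0 <= M &
  forall y, nm (y - x) < r -> nm (f y) <= M].
Proof.
move=> /fdiff_cont /(_ _ ltr01) [r r0 H]; exists (nm (f x) + 1), r; split => //.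
  by rewrite addr_ge0 ?nm_ge0.
move=> y /H h; rewrite -(subrK (f x) (f y)) addrC.
by apply: le_trans (nmD _ _) _; rewrite lerD2l ltW.
Qed.

Lemma line_deriv f x v (t a : C) : deriv_at f (x + t *: v) v a ->
  dva (fun t : C => f (x + t *: v)) t a.
Proof.
move=> /deriv_atP H; apply/dv_nmP => e /H [r r0 Hr]; exists r => // h /Hr.
by rewrite scalerDl addrA.
Qed.

#[global] Opaque fdiff der deriv_at.

Definition holb x r f := forall y, nm (y - x) < r -> fdiff f y.

Lemma holb_sub x r y r' f : holb x r f -> nm (y - x) + r' <= r -> holb y r' f.
Proof.
move=> H h z zy; apply: H; apply: le_lt_trans (nm_tri _ y _) _.
by apply: lt_le_trans h; rewrite addrC ltrD2l.
Qed.

Lemma holb_line x r f v (r' : R) : holb x r f ->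
  (forall t : C, nm t < r' -> nm (t *: v) < r) ->
  hol r' (fun t : C => f (x + t *: v)).
Proof.
move=> H vr t tr; exists (der f (x + t *: v) v); apply: line_deriv.
by apply: fdiff_deriv; apply: H; rewrite addrAC subrr add0r vr.
Qed.

Lemma tcoef1 (g : C -> C) : tcoef 1 g = der g 0 1.
Proof. by rewrite /tcoef /= /shiftf eqxx. Qed.

Section Cauchy.
Variables (x : V) (r M : R) (f : V -> C).
Hypotheses (r0 : 0 < r) (H : holb x r f)
  (HM : forall y, nm (y - x) < r -> nm (f y) <= M).

Lemma line_setup v : v != 0 -> [/\ 0 < r / nm v,
  hol (r / nm v) (fun t : C => f (x + t *: v)),
  (forall t, nm t < r / nm v -> nm (f (x + t *: v)) <= M) &
  tcoef 1 (fun t : C => f (x + t *: v)) = der f x v].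
Proof.
move=> v0; have nv : 0 < nm v by rewrite nm_gt0.
have vr (t : C) : nm t < r / nm v -> nm (t *: v) < r.
  by rewrite nmZ ltr_pdivlMr.
split.
- exact: divr_gt0.
- exact: holb_line vr.
- by move=> t /vr tv; apply: HM; rewrite addrAC subrr add0r.
rewrite tcoef1; apply: deriv_at_der; apply: line_deriv; rewrite scale0r addr0.
by apply: fdiff_deriv; apply: H; rewrite subrr nm0.
Qed.

(** Cauchy's inequality, from the bound on the first Taylor coefficient along
    the line directed by v. *)
Lemma cauchy1 v : nm (der f x v) <= 64 / r * M * nm v.
Proof.
have [->|v0] := eqVneq v 0.
  by rewrite der0 !nm0 mulr0.
have [r'0 h1 h2 <-] := line_setup v0.
apply: le_trans (tcoef_bound 1 r'0 h1 h2) _.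
rewrite expr1 le_eqVlt; apply/orP; left; apply/eqP.
by field; rewrite lt0r_neq0 // nm_eq0.
Qed.

(** The remainder of order two, uniform in f: this uniformity is what lets
    differentiability pass to limits. *)
Lemma cauchy2 v : nm v < r ->
  nm (f (x + v) - f x - der f x v) <= (64 / r) ^+ 2 * M * nm v ^+ 2.
Proof.
have [->|v0 vr] := eqVneq v 0.
  by rewrite addr0 subrr der0 subr0 !nm0 expr0n mulr0.
have [r'0 h1 h2 <-] := line_setup v0.
have n1 : nm (1 : C) < r / nm v by rewrite nm1 ltr_pdivlMr ?mul1r ?nm_gt0.
have := taylor 2 (fun t : C => f (x + t *: v)) 1.
rewrite scale1r !big_ord_recl big_ord0 !expr1n !mulr1 mul1r addr0 => ->.
rewrite {1}/tcoef /= scale0r addr0.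
have -> : forall a b c : C, a + b + c - a - b = c by move=> *; ring.
apply: le_trans (iter_bound 2 r'0 h1 h2 n1) _.
rewrite le_eqVlt; apply/orP; left; apply/eqP.
by field; rewrite lt0r_neq0 // nm_eq0.
Qed.
End Cauchy.

Lemma fdiff_of_linear f x (L : V -> C) (K K' r : R) : 0 < r ->
  (forall (a : C) v w, L (a *: v + w) = a * L v + L w) ->
  (forall v, nm (L v) <= K * nm v) ->
  (forall v, nm v < r -> nm (f (x + v) - f x - L v) <= K' * nm v ^+ 2) ->
  fdiff f x /\ forall v, der f x v = L v.
Proof.
move=> r0 Llin LK H.
have T (e : R) : 0 < e -> exists2 r : R, 0 < r &
    forall v, nm v < r -> nm (f (x + v) - f x - L v) <= e * nm v.
  move=> e0; have K0 : 0 < `|K'| + 1 by rewrite ltr_wpDl.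
  exists (Num.min r (e / (`|K'| + 1))); first by rewrite lt_min r0 divr_gt0.
  move=> h; rewrite lt_min => /andP [hr hK].
  apply: le_trans (H _ hr) _; rewrite expr2 mulrA ler_wpM2r ?nm_ge0 //.
  move: hK; rewrite ltr_pdivlMr // => hK; apply: le_trans (ltW hK).
  rewrite mulrC ler_wpM2l ?nm_ge0 // (le_trans (ler_norm _)) // lerDl //.
pose Lm := GRing.isLinear.Build C V C^o *:%R L Llin.
pose L' : {linear V -> C^o} := HB.pack L Lm.
have fx : fdiff f x by exact: (@differentiable_nmP _ _ _ _ _ L' K).
split => // v.
apply: deriv_at_der; apply/deriv_atP => e e0.
have v1 : 0 < nm v + 1 by rewrite ltr_wpDl ?nm_ge0.
have [d d0 Hd] := T _ (divr_gt0 e0 v1).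
exists (d / (nm v + 1)); first by rewrite divr_gt0.
move=> h; rewrite ltr_pdivlMr // => hd.
have LZ : L (h *: v) = h * L v.
  have L0 : L 0 = 0 by have := Llin (-1) 0 0; rewrite scaler0 addr0 mulN1r addNr.
  by have := Llin h v 0; rewrite addr0 L0 addr0.
rewrite -LZ; apply: le_trans (Hd _ _) _.
  rewrite nmZ; apply: le_lt_trans hd.
  by rewrite ler_wpM2l ?nm_ge0 // lerDl.
rewrite nmZ mulrAC ler_pdivrMr // mulrA ler_wpM2l //.
  by rewrite mulr_ge0 ?nm_ge0 // ltW.
by rewrite lerDl.
Qed.

End V.

#[global] Transparent fdiff deriv_at der.
Lemma dv_fdiff (f : C -> C) (z : C) : dv f z -> fdiff f z.
Proof.
move=> /der_at [df _]; rewrite /fdiff.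
by apply/(derivable1_diffP (f : C -> C^o) z).
Qed.

#[global] Opaque fdiff deriv_at der.

#[global] Opaque shiftf tcoef.

(** By [cauchy1] the differentials form a Cauchy sequence; by [cauchy2] the
    remainders of order two have a common bound, inherited by the limit. *)
Lemma weierstrass (V : normedModType C) (phi : nat -> V -> C) (f : V -> C) (x : V) (r M : R) :
  0 < r -> (forall N, holb x r (phi N)) ->
  (forall N y, nm (y - x) < r -> nm (phi N y) <= M) ->
  (forall e : R, 0 < e -> exists N0, forall N, (N0 <= N)%N ->
    forall y, nm (y - x) < r -> nm (phi N y - f y) <= e) ->
  fdiff f x /\ forall v (e : R), 0 < e -> exists N0, forall N, (N0 <= N)%N ->
    nm (der (phi N) x v - der f x v) <= e.
Proof.
move=> r0 H HM U.
have dB N N' v (e : R) : (forall y, nm (y - x) < r -> nm (phi N y - phi N' y) <= e) ->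
    nm (der (phi N) x v - der (phi N') x v) <= 64 / r * e * nm v.
  move=> He; have xx : nm (x - x) < r by rewrite subrr nm0.
  have <- : der (fun y => phi N y - phi N' y) x v = der (phi N) x v - der (phi N') x v.
    apply: deriv_at_der.
    by apply: deriv_atB; apply: fdiff_deriv; apply: H.
  apply: (cauchy1 r0 _ He) => y yr; apply: fdiffB; exact: H.
have rr : 0 < 64 / r by rewrite divr_gt0.
have lim v : exists l, forall e : R, 0 < e -> exists N, forall n, (N <= n)%N ->
    nm (der (phi n) x v - l) <= e.
  apply: nm_complete => e e0.
  have v1 : 0 < nm v + 1 by rewrite ltr_wpDl ?nm_ge0.
  have e'0 : 0 < e / (64 / r * (nm v + 1)) / 2 by rewrite !divr_gt0 // mulr_gt0.
  have [N0 HN] := U _ e'0; exists N0 => m n Nm Nn.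
  apply: le_trans (dB m n v (e / (64 / r * (nm v + 1))) _) _.
    move=> y yr; apply: le_trans (nm_tri _ (f y) _) _.
    by rewrite (splitr (e / _)) lerD ?[nm (f y - _)]nm_distC ?HN.
  have -> : 64 / r * (e / (64 / r * (nm v + 1))) * nm v = e * (nm v / (nm v + 1)).
    by field; rewrite !lt0r_neq0.
  by rewrite ler_piMr ?(ltW e0) // ler_pdivrMr // mul1r lerDl.
have [L HL] := choice lim.
(* The limit of the differentials is linear and bounded. *)
have Llin (a : C) v w : L (a *: v + w) = a * L v + L w.
  apply/eqP; rewrite -subr_eq0 -nm_eq0 eq_le nm_ge0 andbT.
  apply/ler_addgt0Pl => e e0; rewrite addr0.
  have a1 : 0 < nm a + 2 by rewrite ltr_wpDl ?nm_ge0.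
  have e'0 : 0 < e / (nm a + 2) by rewrite divr_gt0.
  have [N1 H1] := HL (a *: v + w) _ e'0; have [N2 H2] := HL v _ e'0.
  have [N3 H3] := HL w _ e'0.
  pose n := maxn N1 (maxn N2 N3).
  have := H1 n (leq_maxl _ _).
  have := H2 n (leq_trans (leq_maxl _ _) (leq_maxr _ _)).
  have := H3 n (leq_trans (leq_maxr _ _) (leq_maxr _ _)).
  rewrite fdiff_linear; last by apply: H; rewrite subrr nm0.
  set dv' := der _ _ v; set dw := der _ _ w => h3 h2 h1.
  have -> : L (a *: v + w) - (a * L v + L w) =
     a * (dv' - L v) + (dw - L w) - (a * dv' + dw - L (a *: v + w)) by ring.
  apply: le_trans (nmB _ _) _; apply: le_trans (lerD (nmD _ _) h1) _.
  rewrite nmM.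
  have h4 : nm a * nm (dv' - L v) <= nm a * (e / (nm a + 2)) by rewrite ler_wpM2l ?nm_ge0.
  have E : e = nm a * (e / (nm a + 2)) + e / (nm a + 2) + e / (nm a + 2).
    by field; rewrite lt0r_neq0.
  rewrite [leRHS]E; lra.
have limle (u : nat -> C) l B : (forall n, nm (u n) <= B) ->
   (forall e : R, 0 < e -> exists N, forall n, (N <= n)%N -> nm (u n - l) <= e) -> nm l <= B.
  move=> uB ul; apply/ler_addgt0Pl => e e0; have [N /(_ N (leqnn _)) h] := ul _ e0.
  have -> : l = u N - (u N - l) by ring.
  by apply: le_trans (nmB _ _) _; rewrite addrC lerD.
have LK v : nm (L v) <= 64 / r * M * nm v.
  apply: (limle (fun n => der (phi n) x v)) => [n|]; last exact: HL.
  by apply: cauchy1 => // y; exact: HM.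
have rem v : nm v < r -> nm (f (x + v) - f x - L v) <= (64 / r) ^+ 2 * M * nm v ^+ 2.
  move=> vr; apply: (limle (fun n => phi n (x + v) - phi n x - der (phi n) x v)) => [n|].
    by apply: cauchy2 => // y; exact: HM.
  move=> e e0; have e3 : 0 < e / 3 by rewrite divr_gt0.
  have [N1 H1] := U _ e3; have [N2 H2] := HL v _ e3.
  exists (maxn N1 N2) => n; rewrite geq_max => /andP [/H1 h1 /H2 h2].
  have -> : phi n (x + v) - phi n x - der (phi n) x v - (f (x + v) - f x - L v) =
    (phi n (x + v) - f (x + v)) - (phi n x - f x) - (der (phi n) x v - L v) by ring.
  apply: le_trans (nmB _ _) _; apply: le_trans (lerD (nmB _ _) h2) _.
  have := h1 x; rewrite subrr nm0 => /(_ r0) k1.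
  have := h1 (x + v); rewrite addrAC subrr add0r => /(_ vr) k2.
  lra.
have [fx dL] := fdiff_of_linear r0 Llin LK rem.
by split => // v e e0; have [N HN] := HL v _ e0; exists N => n /HN; rewrite dL.
Qed.

Lemma fdiff_shift (V : normedModType C) (f : V -> C) (x u : V) :
  fdiff f (x + u) -> fdiff (fun y => f (y + u)) x.
Proof.
move=> df; exact: (@differentiable_comp _ _ _ _ (fun y => y + u) (f : V -> C^o)).
Qed.

Section Regularity.
Context {V : normedModType C}.
Variables (x : V) (r M : R) (f : V -> C).
Hypotheses (r0 : 0 < r) (H : holb x r f)
  (HM : forall y, nm (y - x) < r -> nm (f y) <= M).

(** By [cauchy2] the difference quotients of f in the direction v converge
    uniformly to the derivative, so that [weierstrass] applies to them. *)
Lemma diffquot_setup (v : V) : exists t : nat -> R, [/\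
  forall N, 0 < t N,
  forall N, nm (rc (t N) *: v) < r / 2,
  forall N, holb x (r / 2) (fun y => (f (y + rc (t N) *: v) - f y) / rc (t N)),
  exists M', forall N y, nm (y - x) < r / 2 ->
     nm ((f (y + rc (t N) *: v) - f y) / rc (t N)) <= M' &
  (forall e : R, 0 < e -> exists N0, forall N, (N0 <= N)%N ->
    (t N <= e) /\ forall y, nm (y - x) < r / 2 ->
      nm ((f (y + rc (t N) *: v) - f y) / rc (t N) - der f y v) <= e)].
Proof.
have M0 : 0 <= M.
  by apply: le_trans (HM (y := x) _); rewrite ?nm_ge0 // subrr nm0.
have v1 : 0 < nm v + 1 by rewrite ltr_wpDl ?nm_ge0.
pose t N := r / 2 / (nm v + 1) / (N.+1)%:R.
have r2 : 0 < r / 2 by rewrite divr_gt0.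
have t0 N : 0 < t N by rewrite !divr_gt0.
have tv N : nm (rc (t N) *: v) < r / 2.
  rewrite nmZ nm_rc ger0_norm ?ltW // /t.
  have -> : r / 2 / (nm v + 1) / N.+1%:R * nm v = (r / 2) * (nm v / ((nm v + 1) * N.+1%:R)).
    have : N.+1%:R != 0 :> R by rewrite pnatr_eq0.
    by move: (N.+1%:R : R) => b b0; field; rewrite b0 lt0r_neq0.
  rewrite gtr_pMr // ltr_pdivrMr ?mul1r; last by rewrite mulr_gt0.
  have : 1 <= N.+1%:R :> R by rewrite ler1n.
  have := nm_ge0 v; nra.
have tn0 N : rc (t N) != 0 by rewrite -nm_gt0 nm_rc gtr0_norm.
have sub y : nm (y - x) < r / 2 -> holb y (r / 2) f.
  by move=> yx; apply: holb_sub H _; lra.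
have subM y : nm (y - x) < r / 2 -> forall z, nm (z - y) < r / 2 -> nm (f z) <= M.
  by move=> yx z zy; apply: HM; have := nm_tri z y x; lra.
pose K := (64 / (r / 2)) ^+ 2 * M * nm v ^+ 2.
have K0 : 0 <= K.
  have : 0 <= 64 / (r / 2) by rewrite divr_ge0 // ltW.
  move=> h; apply: mulr_ge0; last by rewrite exprn_ge0 // nm_ge0.
  by apply: mulr_ge0 => //; rewrite exprn_ge0.
have Q N y : nm (y - x) < r / 2 ->
    nm ((f (y + rc (t N) *: v) - f y) / rc (t N) - der f y v) <= K * t N.
  move=> yx.
  have := cauchy2 r2 (sub y yx) (subM y yx) (tv N).
  have -> : der f y (rc (t N) *: v) = rc (t N) * der f y v.
    have fy : fdiff f y by apply: (sub y yx); rewrite subrr nm0.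
    have := fdiff_linear (rc (t N)) v 0 fy.
    by rewrite addr0 der0 addr0.
  have -> : f (y + rc (t N) *: v) - f y - rc (t N) * der f y v =
    ((f (y + rc (t N) *: v) - f y) / rc (t N) - der f y v) * rc (t N).
    by field; exact: tn0.
  rewrite nmM nm_rc gtr0_norm // nmZ nm_rc gtr0_norm // => h.
  rewrite -(ler_pM2r (t0 N)); apply: le_trans h _.
  by rewrite le_eqVlt; apply/orP; left; apply/eqP; rewrite /K; ring.
have tle N : t N <= t 0%N.
  by rewrite /t ler_pM2l ?divr_gt0 // lef_pV2 ?posrE ?ltr0n // ler_nat.
exists t; split; [exact: t0|exact: tv| | |].
- move=> N y yx; apply: fdiffM; last exact: fdiff_cst.
  apply: fdiffB; last by apply: H; lra.
  apply: fdiff_shift; apply: H; rewrite addrAC.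
  by apply: le_lt_trans (nmD _ _) _; have := tv N; lra.
- exists (K * t 0%N + 64 / (r / 2) * M * nm v) => N y yx.
  rewrite -[X in nm X](subrK (der f y v)); apply: le_trans (nmD _ _) _.
  apply: lerD; first by apply: le_trans (Q _ _ yx) _; rewrite ler_wpM2l.
  exact: cauchy1 r2 (sub y yx) (subM y yx) v.
move=> e e0.
have K1 : 0 < K + 1 by rewrite ltr_wpDl.
have [N0 HN] : exists N0, forall N, (N0 <= N)%N -> (K + 1) * t N <= e.
  pose B := (K + 1) * (r / 2 / (nm v + 1)).
  have B0 : 0 < B by rewrite !mulr_gt0 ?invr_gt0.
  exists (Num.bound (B / e)) => N Nn.
  rewrite /t mulrA -/B ler_pdivrMr ?ltr0n // mulrC -ler_pdivrMr //.
  apply: ltW; apply: lt_trans (archi_boundP _) _; first by rewrite divr_ge0 ?ltW.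
  by rewrite ltr_nat ltnS.
exists N0 => N /HN hN; split => [|y yx].
  by have := t0 N; nra.
apply: le_trans (Q _ _ yx) _; have := t0 N; nra.
Qed.

Lemma der_fdiff v : fdiff (fun y => der f y v) x.
Proof.
have [t [t0 tv th [M' tM] tl]] := diffquot_setup v.
have r2 : 0 < r / 2 by rewrite divr_gt0.
have [] // := weierstrass r2 th tM (f := fun y => der f y v).
by move=> e /tl [N0 HN]; exists N0 => N /HN [].
Qed.
End Regularity.

(** The derivative along w of the difference quotients along v converges, on one
    hand to the derivative of the limit, on the other to the derivative along v
    of the derivative along w. *)
Lemma der_comm (V : normedModType C) (x : V) (r M : R) (f : V -> C) (v w : V) :
  0 < r -> holb x r f -> (forall y, nm (y - x) < r -> nm (f y) <= M) ->
  der (fun y => der f y v) x w = der (fun y => der f y w) x v.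
Proof.
move=> r0 H HM.
have [t [t0 tv th [M' tM] tl]] := diffquot_setup r0 H HM v.
have r2 : 0 < r / 2 by rewrite divr_gt0.
have U : forall e : R, 0 < e -> exists N0, forall N, (N0 <= N)%N ->
    forall y, nm (y - x) < r / 2 ->
    nm ((f (y + rc (t N) *: v) - f y) / rc (t N) - der f y v) <= e.
  by move=> e /tl [N0 HN]; exists N0 => N /HN [].
have [_ hW] := weierstrass r2 th tM U.
have fw : fdiff (fun y => der f y w) x := der_fdiff r0 H HM w.
have /deriv_atP fwv := fdiff_deriv v fw.
apply/eqP; rewrite -subr_eq0 -nm_eq0 eq_le nm_ge0 andbT.
apply/ler_addgt0Pl => e e0; rewrite addr0.
have e2 : 0 < e / 2 by rewrite divr_gt0.
have [N1 H1] := hW w _ e2; have [d d0 Hd] := fwv _ e2.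
have [N2 H2] := tl _ (divr_gt0 d0 (ltr0n R 2)).
pose N := maxn N1 N2.
have h1 := H1 N (leq_maxl _ _); have [h2 _] := H2 N (leq_maxr _ _).
have tN : nm (rc (t N)) < d by rewrite nm_rc gtr0_norm //; lra.
have tn0 : rc (t N) != 0 by rewrite -nm_gt0 nm_rc gtr0_norm.
have h3 := Hd _ tN.
have E : der (fun y => (f (y + rc (t N) *: v) - f y) / rc (t N)) x w =
   (der f (x + rc (t N) *: v) w - der f x w) / rc (t N).
  apply: deriv_at_der; apply: deriv_atZ; apply: deriv_atB.
    apply: deriv_at_shift; apply: fdiff_deriv; apply: H.
    by rewrite addrAC subrr add0r; have := tv N; lra.
  by apply: fdiff_deriv; apply: H; rewrite subrr nm0.
have key (A B q D u : C) : u != 0 -> nm (q - A) <= e / 2 -> q = D / u ->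
    nm (D - u * B) <= e / 2 * nm u -> nm (A - B) <= e.
  move=> u0 k1 k2 k3.
  have -> : A - B = (D - u * B) / u - (q - A) by rewrite k2; field.
  apply: le_trans (nmB _ _) _; rewrite (splitr e) lerD //.
  by rewrite nmf ler_pdivrMr ?nm_gt0.
exact: key tn0 h1 E h3.
Qed.

(** * Algebra of the Taylor coefficients *)

#[global] Transparent shiftf tcoef.
Lemma shift0 (f : C -> C) : shiftf f 0 = der f 0 1.
Proof. by rewrite /shiftf eqxx. Qed.
Lemma shiftN0 (f : C -> C) w : w != 0 -> shiftf f w = (f w - f 0) / w.
Proof. by rewrite /shiftf => /negbTE ->. Qed.
Lemma tcoef0 (f : C -> C) : tcoef 0 f = f 0.
Proof. by []. Qed.
#[global] Opaque shiftf tcoef.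

Lemma hol0 (r : R) (f : C -> C) : 0 < r -> hol r f -> dv f 0.
Proof. by move=> r0; apply; rewrite nm0. Qed.

Lemma shiftD (f g : C -> C) : dv f 0 -> dv g 0 ->
  shiftf (fun w => f w + g w) = fun w => shiftf f w + shiftf g w.
Proof.
move=> df dg; apply/funext => w; have [->|w0] := eqVneq w 0.
  by rewrite !shift0; apply: deriv_at_der; apply: deriv_atD; exact: der_at.
by rewrite !shiftN0 //; field.
Qed.

Lemma shiftM (f g : C -> C) : dv f 0 -> dv g 0 ->
  shiftf (fun w => f w * g w) = fun w => shiftf f w * g w + f 0 * shiftf g w.
Proof.
move=> df dg; apply/funext => w; have [->|w0] := eqVneq w 0.
  rewrite !shift0; apply: deriv_at_der.
  rewrite addrC [X in _ + X]mulrC; apply: deriv_atM; exact: der_at.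
by rewrite !shiftN0 //; field.
Qed.

Lemma shiftZ (c : C) (f : C -> C) : dv f 0 ->
  shiftf (fun w => f w * c) = fun w => shiftf f w * c.
Proof.
move=> df; apply/funext => w; have [->|w0] := eqVneq w 0.
  by rewrite !shift0; apply: deriv_at_der; apply: deriv_atZ; exact: der_at.
by rewrite !shiftN0 //; field.
Qed.

Lemma shift_cst (c : C) : shiftf (fun=> c) = fun=> 0.
Proof.
apply/funext => w; have [->|w0] := eqVneq w 0.
  by rewrite shift0; apply: deriv_at_der; exact: deriv_at_cst.
by rewrite shiftN0 // subrr mul0r.
Qed.

Lemma tcoef_cst q (c : C) : tcoef q.+1 (fun=> c) = 0.
Proof. by elim: q c => [|q IH] c; rewrite tcoefS shift_cst ?tcoef0 ?IH. Qed.

Lemma tcoefD q (r : R) (f g : C -> C) : 0 < r -> hol r f -> hol r g ->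
  tcoef q (fun w => f w + g w) = tcoef q f + tcoef q g.
Proof.
move=> r0; elim: q f g => [|q IH] f g hf hg; first by [].
rewrite !tcoefS shiftD; [|exact: hol0 hf|exact: hol0 hg].
by apply: IH; exact: hol_shift.
Qed.

Lemma tcoefZ q (r : R) (c : C) (f : C -> C) : 0 < r -> hol r f ->
  tcoef q (fun w => f w * c) = tcoef q f * c.
Proof.
move=> r0; elim: q f => [|q IH] f hf; first by [].
rewrite !tcoefS shiftZ; [|exact: hol0 hf].
by apply: IH; exact: hol_shift.
Qed.

Lemma holM r (f g : C -> C) : hol r f -> hol r g -> hol r (fun w => f w * g w).
Proof. by move=> hf hg w wr; apply: dvM; [exact: hf|exact: hg]. Qed.

(** If the coefficients below k vanish, then f w = a_k w ^ k + O(w ^ (k + 1)),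
    so a_k is O(w). *)
Lemma tcoef_small q (r : R) (K : R) (f : C -> C) : 0 < r -> hol r f ->
  (forall w, nm w < r -> nm (f w) <= K * nm w ^+ q) ->
  forall k, (k < q)%N -> tcoef k f = 0.
Proof.
move=> r0 hf HK k; elim/ltn_ind: k => k IH kq.
have K0 : 0 <= `|K| by [].
have hk := hol_iter k.+1 hf.
have [B [d [d0 B0 Hd]]] := dv_bound (hol0 r0 hk).
pose A := B * d + nm (iter k.+1 shiftf f 0) + `|K|.
have A0 : 0 <= A by rewrite !addr_ge0 ?nm_ge0 // mulr_ge0 // ltW.
have key (w : C) : w != 0 -> nm w < Num.min (Num.min r d) 1 -> nm (tcoef k f) <= A * nm w.
  move=> w0; rewrite !lt_min => /andP [/andP [wr wd] w1].
  have nw : 0 < nm w by rewrite nm_gt0.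
  have := taylor k.+1 f w; rewrite big_ord_recr /= big1 ?add0r; last first.
    by move=> j _; rewrite IH ?mul0r // (ltn_trans _ kq).
  rewrite -iterS => E.
  have {}E : tcoef k f * w ^+ k = f w - w ^+ k.+1 * iter k.+1 shiftf f w.
    by rewrite E addrK.
  have nk : 0 < nm w ^+ k by rewrite exprn_gt0.
  rewrite -(ler_pM2r nk) -nmX -nmM E.
  apply: le_trans (nmB _ _) _; rewrite nmM !nmX.
  have h1 : nm (iter k.+1 shiftf f w) <= B * d + nm (iter k.+1 shiftf f 0).
    rewrite -[X in nm X](subrK (iter k.+1 shiftf f 0)).
    apply: le_trans (nmD _ _) _; rewrite lerD2r.
    have := Hd w; rewrite subr0 => /(_ wd) h; apply: le_trans h _.
    by rewrite ler_wpM2l // ltW.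
  have h2 : nm (f w) <= `|K| * nm w ^+ k.+1.
    apply: le_trans (HK _ wr) _.
    apply: le_trans (ler_wpM2r _ (ler_norm K)) _; first by rewrite exprn_ge0 ?nm_ge0.
    by rewrite ler_wpM2l // ler_wiXn2l // ?nm_ge0 // ltW.
  rewrite /A mulrDl mulrDl addrC -mulrA -exprS; apply: lerD => //.
  - by rewrite mulrC ler_wpM2r // exprn_ge0 ?nm_ge0.
  - by rewrite -mulrA -exprS.
apply/eqP; rewrite -nm_eq0 eq_le nm_ge0 andbT.
apply/ler_addgt0Pl => e e0; rewrite addr0.
have A1 : 0 < A + 1 by rewrite ltr_wpDl.
have m0 : 0 < Num.min (Num.min (Num.min r d) 1) (e / (A + 1)).
  by rewrite !lt_min r0 d0 ltr01 divr_gt0.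
pose t := Num.min (Num.min (Num.min r d) 1) (e / (A + 1)) / 2.
have t0 : 0 < t by rewrite divr_gt0.
have : t < Num.min (Num.min (Num.min r d) 1) (e / (A + 1)).
  by rewrite /t ltr_pdivrMr // ltr_pMr // ltr1n.
rewrite lt_min ltr_pdivlMr // => /andP [t1 t2].
have nt : nm (rc t) = t by rewrite nm_rc gtr0_norm.
have := key (rc t); rewrite nt -nm_gt0 nt => /(_ t0 t1); nra.
Qed.

Lemma hol_der r (f : C -> C) : hol r f -> hol r (fun w => der f w 1).
Proof.
move=> H w wr.
have rw : 0 < r - nm w by rewrite subr_gt0.
have hb : holb w (r - nm w) f.
  move=> y yw; apply: dv_fdiff; apply: H.
  by have := nmD (y - w) w; rewrite subrK; lra.
have [M [d [d0 M0 Hd]]] := fdiff_bounded (hb w ltac:(by rewrite subrr nm0)).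
have m0 : 0 < Num.min d (r - nm w) by rewrite lt_min d0.
have fd := @der_fdiff C w (Num.min d (r - nm w)) M f m0 _ _ 1.
exists (der (fun w => der f w 1) w 1); apply: fdiff_deriv; apply: fd.
  by apply: holb_sub hb _; rewrite subrr nm0 add0r ge_min lexx orbT.
by move=> y; rewrite lt_min => /andP [/Hd].
Qed.

Lemma tcoef_mulX q (r : R) (g : C -> C) : 0 < r -> hol r g ->
  tcoef q.+1 (fun w => w * g w) = tcoef q g.
Proof.
move=> r0 hg; rewrite tcoefS shiftM; [|exact: dv_id|exact: hol0 hg].
congr (tcoef q _); apply/funext => w; rewrite mul0r addr0.
suff -> : shiftf id w = 1 by rewrite mul1r.
have [->|w0] := eqVneq w 0; last by rewrite shiftN0 // subr0 divff.
by rewrite shift0; apply: deriv_at_der; exact: dva_id.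
Qed.

Lemma shift_eq (f : C -> C) w : f w = f 0 + w * shiftf f w.
Proof.
have [->|w0] := eqVneq w 0; first by rewrite mul0r addr0.
by rewrite shiftN0 //; field.
Qed.

(** Differentiate f w = f 0 + w * shiftf f w and use induction on q. *)
Lemma tcoef_deriv q (r : R) (f : C -> C) : 0 < r -> hol r f ->
  tcoef q (fun w => der f w 1) = q.+1%:R * tcoef q.+1 f.
Proof.
move=> r0; elim: q f => [|q IH] f hf; first by rewrite tcoefS !tcoef0 shift0 mul1r.
have hs := hol_shift hf; have hd := hol_der hs.
have E w : nm w < r -> der f w 1 = shiftf f w + w * der (shiftf f) w 1.
  move=> wr; apply: deriv_at_der.
  have := deriv_atD (deriv_at_cst (f 0) w 1) (deriv_atM (dva_id w) (der_at (hs w wr))).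
  rewrite add0r mulr1 [X in deriv_at _ _ _ X]addrC.
  by congr deriv_at; apply/funext => y; rewrite -shift_eq.
rewrite (tcoef_ext _ r0 E) (tcoefD _ r0 hs); last by apply: holM => // w _; exact: dv_id.
rewrite (tcoef_mulX _ r0 hd) IH // [in RHS]tcoefS -[q.+2%:R]natr1 mulrDl mul1r addrC.
by [].
Qed.

End Several.

(** * Germs, order of vanishing and Taylor expansion along lines *)

Section Vanishing.
Context {R : realType}.
Local Notation C := (Cplx R).

Section V.
Context {V : normedModType C}.
Implicit Types (f g : V -> C) (x y v w : V) (r M : R).

(** Neighbourhoods of x, through balls of real radius; germs of functions at x
    are handled by such statements. *)
Definition nearx x (P : V -> Prop) := exists2 r : R, 0 < r & forall y, nm (y - x) < r -> P y.

Lemma nearx_and x P Q : nearx x P -> nearx x Q -> nearx x (fun y => P y /\ Q y).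
Proof.
move=> [r r0 H] [s s0 K]; exists (Num.min r s); first by rewrite lt_min r0.
by move=> y; rewrite lt_min => /andP [/H ? /K ?].
Qed.
Lemma nearx_imp x (P Q : V -> Prop) : (forall y, P y -> Q y) -> nearx x P -> nearx x Q.
Proof. by move=> PQ [r r0 H]; exists r => // y /H /PQ. Qed.
Lemma nearx_at x P : nearx x P -> P x.
Proof. by move=> [r r0]; apply; rewrite subrr nm0. Qed.
Lemma nearx_near x P : nearx x P -> nearx x (fun y => nearx y P).
Proof.
move=> [r r0 H]; exists (r / 2); first by rewrite divr_gt0.
move=> y yx; exists (r / 2); first by rewrite divr_gt0.
by move=> z zy; apply: H; have := nm_tri z y x; lra.
Qed.
Lemma nearx_all (I : finType) x (P : I -> V -> Prop) :
  (forall i, nearx x (P i)) -> nearx x (fun y => forall i, P i y).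
Proof.
move=> H.
have [F HF] : {F : I -> R & forall i, 0 < F i /\ forall y, nm (y - x) < F i -> P i y}.
  by apply: (@choice _ _ (fun i r => 0 < r /\ forall y, nm (y - x) < r -> P i y)) => i;
     have [r r0 Hr] := H i; exists r.
exists (\big[Num.min/1]_i F i).
  by elim/big_ind: _ => // [a b a0 b0|i _]; [rewrite lt_min a0|case: (HF i)].
move=> y yx i; case: (HF i) => _; apply; apply: lt_le_trans yx _.
exact: bigmin_le_cond.
Qed.

(** Germs at x of holomorphic functions. *)
Definition hg x f := nearx x (fdiff f).
Definition germeq x f g := nearx x (fun y => f y = g y).
(** The order of vanishing at x is at least q. It is the language in which jets
    are compared. *)
Definition van q x f := exists2 K : R, 0 <= K &
  nearx x (fun y => nm (f y) <= K * nm (y - x) ^+ q).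

Lemma hg_near x f : hg x f -> nearx x (fun y => hg y f).
Proof. exact: nearx_near. Qed.
Lemma hg_cst (c : C) x : hg x (fun=> c).
Proof. by exists 1 => // y _; exact: fdiff_cst. Qed.
Lemma hgD x f g : hg x f -> hg x g -> hg x (fun y => f y + g y).
Proof. by move=> hf /(nearx_and hf); apply: nearx_imp => y [? ?]; exact: fdiffD. Qed.
Lemma hgB x f g : hg x f -> hg x g -> hg x (fun y => f y - g y).
Proof. by move=> hf /(nearx_and hf); apply: nearx_imp => y [? ?]; exact: fdiffB. Qed.
Lemma hgM x f g : hg x f -> hg x g -> hg x (fun y => f y * g y).
Proof. by move=> hf /(nearx_and hf); apply: nearx_imp => y [? ?]; exact: fdiffM. Qed.
Lemma hgN x f : hg x f -> hg x (fun y => - f y).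
Proof.
move=> hf; rewrite (_ : (fun y => _) = fun y => 0 - f y).
  exact: hgB (hg_cst 0 x) hf.
by apply/funext => y; rewrite sub0r.
Qed.
Lemma hg_sum x (I : Type) (s : seq I) (F : I -> V -> C) :
  (forall i, hg x (F i)) -> hg x (fun y => \sum_(i <- s) F i y).
Proof.
move=> H; elim: s => [|i s IH].
  rewrite (_ : (fun y => _) = fun=> 0); first exact: hg_cst.
  by apply/funext => y; rewrite big_nil.
rewrite (_ : (fun y => _) = fun y => F i y + \sum_(j <- s) F j y); first exact: hgD.
by apply/funext => y; rewrite big_cons.
Qed.
Lemma hg_prod x (I : Type) (s : seq I) (F : I -> V -> C) :
  (forall i, hg x (F i)) -> hg x (fun y => \prod_(i <- s) F i y).
Proof.
move=> H; elim: s => [|i s IH].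
  rewrite (_ : (fun y => _) = fun=> 1); first exact: hg_cst.
  by apply/funext => y; rewrite big_nil.
rewrite (_ : (fun y => _) = fun y => F i y * \prod_(j <- s) F j y); first exact: hgM.
by apply/funext => y; rewrite big_cons.
Qed.
Lemma hgX x f n : hg x f -> hg x (fun y => f y ^+ n).
Proof.
move=> hf; elim: n => [|n IH]; first exact: hg_cst.
rewrite (_ : (fun y => _) = (fun y => f y * f y ^+ n)); first exact: hgM.
by apply/funext => y; rewrite exprS.
Qed.
Lemma hg_neq0 x f : hg x f -> f x != 0 -> nearx x (fun y => f y != 0).
Proof.
move=> /nearx_at hf fx.
have nf : 0 < nm (f x) by rewrite nm_gt0.
have [r r0 Hr] := fdiff_cont hf nf; exists r => // y /Hr h.
by apply/eqP => fy; move: h; rewrite fy sub0r nmN ltxx.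
Qed.
Lemma hgV x f : hg x f -> f x != 0 -> hg x (fun y => (f y)^-1).
Proof.
move=> hf /(hg_neq0 hf) /(nearx_and hf); apply: nearx_imp => y [? ?]; exact: fdiffV.
Qed.
Lemma germeq_near x f g : germeq x f g -> nearx x (fun y => germeq y f g).
Proof. exact: nearx_near. Qed.
Lemma germeq_refl x f : germeq x f f.
Proof. by exists 1. Qed.
Lemma germeq_sym x f g : germeq x f g -> germeq x g f.
Proof. by apply: nearx_imp => y ->. Qed.
Lemma germeq_trans x f g h : germeq x f g -> germeq x g h -> germeq x f h.
Proof. by move=> fg /(nearx_and fg); apply: nearx_imp => y [-> ->]. Qed.
Lemma hg_ext x f g : germeq x f g -> hg x f -> hg x g.
Proof.
move=> /germeq_near e hf; have := nearx_and e hf; apply: nearx_imp => y [[r r0 E] fy].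
exact: fdiff_local r0 E fy.
Qed.
Lemma germeq_der x f g v : germeq x f g -> germeq x (fun y => der f y v) (fun y => der g y v).
Proof.
move=> /germeq_near; apply: nearx_imp => y [r r0 E]; exact: der_ext r0 E.
Qed.

Lemma hg_ball x f : hg x f -> exists r M, [/\ 0 < r, 0 <= M, holb x r f &
  forall y, nm (y - x) < r -> nm (f y) <= M].
Proof.
move=> hf; have [M [d [d0 M0 Hd]]] := fdiff_bounded (nearx_at hf).
have [r r0 Hr] := hf.
exists (Num.min r d), M; split => //; first by rewrite lt_min r0.
  by move=> y; rewrite lt_min => /andP [/Hr].
by move=> y; rewrite lt_min => /andP [_ /Hd].
Qed.

Lemma hg_der x f v : hg x f -> hg x (fun y => der f y v).
Proof.
move=> /hg_near; apply: nearx_imp => y /hg_ball [r [M [r0 M0 H HM]]].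
exact: der_fdiff r0 H HM v.
Qed.

Lemma hg_comm x f v w : hg x f ->
  germeq x (fun y => der (fun z => der f z v) y w) (fun y => der (fun z => der f z w) y v).
Proof.
move=> /hg_near; apply: nearx_imp => y /hg_ball [r [M [r0 M0 H HM]]].
exact: der_comm r0 H HM.
Qed.

Lemma der_hgM x f g v : hg x f -> hg x g ->
  der (fun y => f y * g y) x v = f x * der g x v + g x * der f x v.
Proof.
move=> /nearx_at hf /nearx_at hg.
by apply: deriv_at_der; apply: deriv_atM; exact: fdiff_deriv.
Qed.
Lemma der_hgD x f g v : hg x f -> hg x g ->
  der (fun y => f y + g y) x v = der f x v + der g x v.
Proof.
move=> /nearx_at hf /nearx_at hg.
by apply: deriv_at_der; apply: deriv_atD; exact: fdiff_deriv.
Qed.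
Lemma der_hgB x f g v : hg x f -> hg x g ->
  der (fun y => f y - g y) x v = der f x v - der g x v.
Proof.
move=> /nearx_at hf /nearx_at hg.
by apply: deriv_at_der; apply: deriv_atB; exact: fdiff_deriv.
Qed.
Lemma der_cst (c : C) x v : der (fun=> c) x v = 0.
Proof. by apply: deriv_at_der; exact: deriv_at_cst. Qed.
Lemma der_hgZ x f (c : C) v : hg x f -> der (fun y => f y * c) x v = der f x v * c.
Proof.
by move=> /nearx_at hf; apply: deriv_at_der; apply: deriv_atZ; exact: fdiff_deriv.
Qed.
Lemma der_hg_sum x (I : Type) (s : seq I) (F : I -> V -> C) v :
  (forall i, hg x (F i)) ->
  der (fun y => \sum_(i <- s) F i y) x v = \sum_(i <- s) der (F i) x v.
Proof.
move=> H; elim: s => [|i s IH].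
  rewrite (_ : (fun y => _) = fun=> 0); first by rewrite der_cst big_nil.
  by apply/funext => y; rewrite big_nil.
rewrite (_ : (fun y => _) = fun y => F i y + \sum_(j <- s) F j y).
  by rewrite der_hgD ?IH ?big_cons //; exact: hg_sum.
by apply/funext => y; rewrite big_cons.
Qed.

Lemma van_ext q x f g : germeq x f g -> van q x f -> van q x g.
Proof.
move=> e [K K0 H]; exists K => //.
by have := nearx_and e H; apply: nearx_imp => y [<-].
Qed.
Lemma vanD q x f g : van q x f -> van q x g -> van q x (fun y => f y + g y).
Proof.
move=> [K K0 H] [L L0 G]; exists (K + L); first exact: addr_ge0.
have := nearx_and H G; apply: nearx_imp => y [h1 h2].
by apply: le_trans (nmD _ _) _; rewrite mulrDl lerD.
Qed.
Lemma van0 q x : van q x (fun=> 0).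
Proof. by exists 0 => //; exists 1 => // y _; rewrite nm0 mul0r. Qed.
Lemma vanN q x f : van q x f -> van q x (fun y => - f y).
Proof. by move=> [K K0 H]; exists K => //; apply: nearx_imp H => y; rewrite nmN. Qed.
Lemma vanB q x f g : van q x f -> van q x g -> van q x (fun y => f y - g y).
Proof. by move=> hf /vanN; exact: vanD. Qed.
Lemma van_sum q x (I : Type) (s : seq I) (F : I -> V -> C) :
  (forall i, van q x (F i)) -> van q x (fun y => \sum_(i <- s) F i y).
Proof.
move=> H; elim: s => [|i s IH].
  rewrite (_ : (fun y => _) = fun=> 0); first exact: van0.
  by apply/funext => y; rewrite big_nil.
rewrite (_ : (fun y => _) = fun y => F i y + \sum_(j <- s) F j y); first exact: vanD.
by apply/funext => y; rewrite big_cons.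
Qed.
Lemma van_le q q' x f : (q' <= q)%N -> van q x f -> van q' x f.
Proof.
move=> qq [K K0 H]; exists K => //.
have N1 : nearx x (fun y => nm (y - x) < 1) by exists 1.
have := nearx_and H N1; apply: nearx_imp => y [h1 h2]; apply: le_trans h1 _.
by rewrite ler_wpM2l // ler_wiXn2l // ?nm_ge0 // ltW.
Qed.
Lemma hg_van0 x f : hg x f -> van 0 x f.
Proof.
by move=> /hg_ball [r [M [r0 M0 _ HM]]]; exists M => //; exists r => // y /HM; rewrite mulr1.
Qed.
Lemma vanM p q x f g : van p x f -> van q x g -> van (p + q) x (fun y => f y * g y).
Proof.
move=> [K K0 H] [L L0 G]; exists (K * L); first exact: mulr_ge0.
have := nearx_and H G; apply: nearx_imp => y [h1 h2].
by rewrite nmM exprD mulrACA ler_pM ?nm_ge0.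
Qed.
Lemma vanMr q x f g : van q x f -> hg x g -> van q x (fun y => f y * g y).
Proof. by move=> vf /hg_van0 vg; have := vanM vf vg; rewrite addn0. Qed.
Lemma vanMl q x f g : hg x f -> van q x g -> van q x (fun y => f y * g y).
Proof. by move=> /hg_van0 vf vg; exact: (vanM vf vg). Qed.
Lemma van_at q x f : van q.+1 x f -> f x = 0.
Proof.
move=> [K K0 /nearx_at]; rewrite subrr nm0 expr0n /= mulr0 => h.
by apply/eqP; rewrite -nm_eq0 eq_le h nm_ge0.
Qed.

(** The Taylor coefficients at x of f restricted to the line directed by v. *)
Definition tau q x f v : C := tcoef q (fun t : C => f (x + t *: v)).

Lemma hol_line x f v : hg x f -> exists r M, [/\ 0 < r, 0 <= M,
  hol r (fun t : C => f (x + t *: v)) &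
  forall t : C, nm t < r -> nm (f (x + t *: v)) <= M].
Proof.
move=> /hg_ball [r [M [r0 M0 H HM]]].
have v1 : 0 < nm v + 1 by rewrite ltr_wpDl ?nm_ge0.
have vr (t : C) : nm t < r / (nm v + 1) -> nm (t *: v) < r.
  rewrite ltr_pdivlMr // => tr; apply: le_lt_trans tr.
  by rewrite nmZ ler_wpM2l ?nm_ge0 // lerDl.
exists (r / (nm v + 1)), M; split => //; first by rewrite divr_gt0.
  exact: holb_line H vr.
by move=> t /vr tr; apply: HM; rewrite addrAC subrr add0r.
Qed.

Lemma van_tau q x f : hg x f -> van q x f -> forall v k, (k < q)%N -> tau k x f v = 0.
Proof.
move=> hf [K K0 [s s0 HK]] v k kq.
have [r [M [r0 M0 H HM]]] := hol_line v hf.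
have v1 : 0 < nm v + 1 by rewrite ltr_wpDl ?nm_ge0.
have m0 : 0 < Num.min r (s / (nm v + 1)) by rewrite lt_min r0 divr_gt0.
apply: (tcoef_small (K := K * nm v ^+ q) m0 _ _ kq).
  by apply: hol_le H; rewrite ge_min lexx.
move=> t; rewrite lt_min ltr_pdivlMr // => /andP [_ ts].
have := HK (x + t *: v); rewrite addrAC subrr add0r nmZ => h.
apply: le_trans (h _) _.
  by apply: le_lt_trans ts; rewrite ler_wpM2l ?nm_ge0 // lerDl.
by rewrite exprMn -mulrA [nm v ^+ _ * _]mulrC.
Qed.

(** The points near x are reached along unit vectors, over which [taylor_unif]
    is uniform. *)
Lemma polar x y : y != x -> exists v (t : C), [/\ nm v = 1, nm t = nm (y - x) & x + t *: v = y].
Proof.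
move=> yx; have n0 : 0 < nm (y - x) by rewrite nm_gt0 subr_eq0.
have rn : nm (rc (nm (y - x))) = nm (y - x) by rewrite nm_rc gtr0_norm.
have rn0 : rc (nm (y - x)) != 0 by rewrite -nm_gt0 rn.
exists ((rc (nm (y - x)))^-1 *: (y - x)), (rc (nm (y - x))); split => //.
  by rewrite nmZ nmV rn mulVf ?lt0r_neq0.
by rewrite scalerKV // addrC subrK.
Qed.

(** The Taylor expansion along lines, with a remainder uniform over the unit
    directions. *)
Lemma taylor_unif x f : hg x f -> exists r M, [/\ 0 < r, 0 <= M &
  forall q v (t : C), nm v <= 1 -> nm t < r ->
    nm (f (x + t *: v) - \sum_(k < q) tau k x f v * t ^+ k) <= M * (64 / r * nm t) ^+ q].
Proof.
move=> /hg_ball [r [M [r0 M0 H HM]]]; exists r, M; split => // q v t v1 tr.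
have vr (u : C) : nm u < r -> nm (u *: v) < r.
  by move=> ur; apply: le_lt_trans ur; rewrite nmZ ler_piMr ?nm_ge0.
have hl : hol r (fun t : C => f (x + t *: v)) by exact: holb_line H vr.
have hb (u : C) : nm u < r -> nm (f (x + u *: v)) <= M.
  by move=> /vr ur; apply: HM; rewrite addrAC subrr add0r.
rewrite {1}(taylor q (fun t : C => f (x + t *: v)) t) addrAC subrr add0r.
rewrite nmM nmX exprMn mulrA mulrC ler_wpM2r ?exprn_ge0 ?nm_ge0 //.
by rewrite [M * _]mulrC (iter_bound q r0 hl hb).
Qed.

Lemma tau_van q x f : hg x f -> (forall v k, (k < q)%N -> tau k x f v = 0) -> van q x f.
Proof.
move=> hf H; have [r [M [r0 M0 HT]]] := taylor_unif hf.
exists (M * (64 / r) ^+ q + nm (f x)); first by rewrite addr_ge0 ?nm_ge0 // mulr_ge0 // exprn_ge0 // divr_ge0 // ltW.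
exists r => // y yr.
have [->|yx] := eqVneq y x.
  rewrite subrr nm0; case: q H HT => [|q] H HT.
    by rewrite !mulr1 lerDr.
  have := H 0 0%N isT; rewrite /tau tcoef0 scaler0 addr0 => ->.
  by rewrite nm0 addr0 mulr_ge0 ?mulr_ge0 ?exprn_ge0 // divr_ge0 // ltW.
have [v [t [v1 tn E]]] := polar yx.
have := HT q v t; rewrite v1 tn => /(_ (lexx _) yr).
rewrite big1 ?subr0 => [|k _]; last by rewrite H ?mul0r.
rewrite E exprMn mulrA => h; apply: le_trans h _.
by rewrite ler_wpM2r ?exprn_ge0 ?nm_ge0 // lerDl nm_ge0.
Qed.

(** A germ with zero Taylor expansion is zero: on a ball of radius r / 128 the
    remainders in [taylor_unif] tend to 0. *)
Lemma ident x f : hg x f -> (forall q, van q x f) -> germeq x f (fun=> 0).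
Proof.
move=> hf H; have [r [M [r0 M0 HT]]] := taylor_unif hf.
exists (r / 128); first by rewrite divr_gt0.
move=> y yr; have [->|yx] := eqVneq y x; first exact: van_at (H 1%N).
have [v [t [v1 tn E]]] := polar yx.
apply/eqP; rewrite -nm_eq0 eq_le nm_ge0 andbT.
rewrite leNgt; apply/negP => fy.
suff : (1 : R) <= 2^-1 by lra.
apply: (le_of_expr (A := M) (c := nm (f y))) => //.
move=> q; rewrite expr1n mulr1.
have tr : nm t < r by rewrite tn; lra.
have := HT q v t; rewrite v1 => /(_ (lexx _) tr).
rewrite big1 ?subr0 => [|k _]; last by rewrite (van_tau hf (H q)) ?mul0r.
rewrite E => h; apply: le_trans h _; rewrite ler_wpM2l //.
apply: lerXn2r; rewrite ?nnegrE ?invr_ge0 //.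
  by rewrite mulr_ge0 ?nm_ge0 // divr_ge0 // ltW.
have -> : 64 / r * nm t = nm t / (r / 64) by field; rewrite lt0r_neq0.
rewrite ler_pdivrMr ?divr_gt0 // tn; lra.
Qed.

Lemma tau_der q x f v : hg x f ->
  q.+1%:R * tau q.+1 x f v = tau q x (fun y => der f y v) v.
Proof.
move=> hf; have [r [M [r0 M0 H HM]]] := hol_line v hf.
rewrite /tau -(tcoef_deriv q r0 H).
have [d d0 Hd] := hf.
have v1 : 0 < nm v + 1 by rewrite ltr_wpDl ?nm_ge0.
have d10 : 0 < d / (nm v + 1) by rewrite divr_gt0.
apply: (tcoef_ext q d10) => t; rewrite (ltr_pdivlMr _ _ v1) => td.
apply: deriv_at_der; apply: line_deriv; apply: fdiff_deriv; apply: Hd.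
rewrite addrAC subrr add0r nmZ; apply: le_lt_trans td.
by rewrite ler_wpM2l ?nm_ge0 // lerDl.
Qed.

Lemma tau0 x f v : tau 0 x f v = f x.
Proof. by rewrite /tau tcoef0 scale0r addr0. Qed.

Lemma tau_ext q x f g v : germeq x f g -> tau q x f v = tau q x g v.
Proof.
move=> [d d0 Hd]; have v1 : 0 < nm v + 1 by rewrite ltr_wpDl ?nm_ge0.
have d10 : 0 < d / (nm v + 1) by rewrite divr_gt0.
apply: (tcoef_ext q d10) => t; rewrite (ltr_pdivlMr _ _ v1) => td.
apply: Hd; rewrite addrAC subrr add0r nmZ; apply: le_lt_trans td.
by rewrite ler_wpM2l ?nm_ge0 // lerDl.
Qed.

Lemma hol_line2 x f g v : hg x f -> hg x g -> exists2 r : R, 0 < r &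
  hol r (fun t : C => f (x + t *: v)) /\ hol r (fun t : C => g (x + t *: v)).
Proof.
move=> /(hol_line v) [r [_ [r0 _ H _]]] /(hol_line v) [s [_ [s0 _ K _]]].
exists (Num.min r s); first by rewrite lt_min r0.
by split; [apply: hol_le H|apply: hol_le K]; rewrite ge_min lexx ?orbT.
Qed.

Lemma tauD q x f g v : hg x f -> hg x g ->
  tau q x (fun y => f y + g y) v = tau q x f v + tau q x g v.
Proof. by move=> hf hg; have [r r0 [H K]] := hol_line2 v hf hg; exact: tcoefD r0 H K. Qed.
Lemma tauZ q x f (c : C) v : hg x f -> tau q x (fun y => f y * c) v = tau q x f v * c.
Proof. by move=> hf; have [r [_ [r0 _ H _]]] := hol_line v hf; exact: tcoefZ r0 H. Qed.
Lemma tau_cst0 q x v : tau q x (fun=> 0) v = 0.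
Proof. by case: q => [|q]; [exact: tau0|exact: tcoef_cst]. Qed.
Lemma tau_sum q x (I : Type) (s : seq I) (F : I -> V -> C) v :
  (forall i, hg x (F i)) ->
  tau q x (fun y => \sum_(i <- s) F i y) v = \sum_(i <- s) tau q x (F i) v.
Proof.
move=> H; elim: s => [|i s IH].
  rewrite (_ : (fun y => _) = fun=> 0); first by rewrite tau_cst0 big_nil.
  by apply/funext => y; rewrite big_nil.
rewrite (_ : (fun y => _) = fun y => F i y + \sum_(j <- s) F j y).
  by rewrite tauD ?IH ?big_cons //; exact: hg_sum.
by apply/funext => y; rewrite big_cons.
Qed.

End V.
#[global] Opaque tau.

Section Rows.
Context {n : nat}.
Local Notation V := 'rV[C]_n.
Implicit Types (f g : V -> C) (x y v w : V).

Definition pd (l : 'I_n) f : V -> C := fun y => der f y (delta_mx 0 l).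

Lemma fdiff_pd f x v : fdiff f x -> der f x v = \sum_l v 0 l * pd l f x.
Proof.
move=> fx; rewrite {1}(row_sum_delta v).
elim/big_rec2: _ => [|l a w _ <-]; first by rewrite der0.
by rewrite fdiff_linear.
Qed.

Lemma hg_pd x f l : hg x f -> hg x (pd l f).
Proof. exact: hg_der. Qed.

(** Euler's relation between the homogeneous parts of f and of its derivatives. *)
Lemma tau_pd q x f v : hg x f ->
  q.+1%:R * tau q.+1 x f v = \sum_l v 0 l * tau q x (pd l f) v.
Proof.
move=> hf; rewrite tau_der //.
pose g : V -> C := fun y => \sum_l pd l f y * v 0 l.
transitivity (tau q x g v).
  apply: tau_ext; apply: nearx_imp hf => y fy.
  by rewrite (fdiff_pd _ fy); apply: eq_bigr => l _; rewrite mulrC.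
rewrite tau_sum => [|l]; last by apply: hgM; [exact: hg_pd|exact: hg_cst].
by apply: eq_bigr => l _; rewrite mulrC; apply: tauZ; exact: hg_pd.
Qed.

(** By [tau_pd] the homogeneous parts of f of degree 1 to q are determined by
    those of its derivatives of degree less than q. *)
Lemma van_pd q x f : hg x f -> f x = 0 -> (forall l, van q x (pd l f)) -> van q.+1 x f.
Proof.
move=> hf fx H; apply: tau_van => // v [|k]; first by rewrite tau0.
rewrite ltnS => kq; apply: (mulfI (x := k.+1%:R)); first by rewrite pnatr_eq0.
rewrite mulr0 tau_pd // big1 // => l _.
by rewrite (van_tau (hg_pd l hf) (H l)) ?mulr0.
Qed.

(** Cauchy's inequality on the ball centred at y of radius |y - x|. *)
Lemma pd_van q x f l : hg x f -> van q.+1 x f -> van q x (pd l f).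
Proof.
move=> hf vf; have [K K0 [d d0 HK]] := vf.
have [r [M [r0 M0 H HM]]] := hg_ball hf.
pose v : V := delta_mx 0 l.
have m0 : 0 < Num.min r d / 2 by rewrite divr_gt0 // lt_min r0.
pose L := 64 * (K * 2 ^+ q.+1) * nm v.
have L0 : 0 <= L by rewrite !mulr_ge0 ?exprn_ge0 ?nm_ge0.
exists (L + nm (pd l f x)); first by rewrite addr_ge0 ?nm_ge0.
exists (Num.min r d / 2) => // y yr.
have [->|yx] := eqVneq y x.
  rewrite subrr nm0; (* At x itself the bound is trivial for q = 0; otherwise the derivative is 0. *)
 case: q vf HK L L0 => [|q] vf HK L L0; first by rewrite mulr1 lerDr.
  suff -> : pd l f x = 0 by rewrite nm0 addr0 expr0n mulr0.
  have := tau_pd 0 v hf; rewrite (van_tau hf vf) // mulr0.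
  rewrite (bigD1 l) //= big1 ?addr0 => [|j jl]; last first.
    by rewrite /v mxE eqxx (negbTE jl) mul0r.
  by rewrite tau0 /v mxE !eqxx mul1r.
have n0 : 0 < nm (y - x) by rewrite nm_gt0 subr_eq0.
have near z : nm (z - y) < nm (y - x) -> nm (z - x) < r /\ nm (z - x) < d.
  move=> zy; have : Num.min r d <= r by rewrite ge_min lexx.
  have : Num.min r d <= d by rewrite ge_min lexx orbT.
  move: (nm_tri z y x) zy yr; clear => h1 h2 h3 h4 h5; split; lra.
have Hy : holb y (nm (y - x)) f by move=> z /near [zr _]; apply: H.
have My z : nm (z - y) < nm (y - x) -> nm (f z) <= K * (2 * nm (y - x)) ^+ q.+1.
  move=> zy; have [zr zd] := near z zy; apply: le_trans (HK _ zd) _.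
  rewrite ler_wpM2l //; apply: lerXn2r; rewrite ?nnegrE ?nm_ge0 ?mulr_ge0 ?nm_ge0 //.
  by move: (nm_tri z y x) zy; clear => h1 h2; lra.
apply: le_trans (cauchy1 n0 Hy My v) _.
apply: (@le_trans _ _ (L * nm (y - x) ^+ q)).
  rewrite le_eqVlt; apply/orP; left; apply/eqP.
  by rewrite /L exprMn [nm (y - x) ^+ q.+1]exprS; field; rewrite lt0r_neq0.
by rewrite ler_wpM2r ?exprn_ge0 ?nm_ge0 // lerDl nm_ge0.
Qed.

Lemma germeq_pd x f g l : germeq x f g -> germeq x (pd l f) (pd l g).
Proof. exact: germeq_der. Qed.
Lemma pd_comm x f l m : hg x f -> germeq x (pd l (pd m f)) (pd m (pd l f)).
Proof. exact: hg_comm. Qed.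

Lemma hg_iter x f l k : hg x f -> hg x (iter k (pd l) f).
Proof. by move=> hf; elim: k => // k; exact: hg_pd. Qed.
Lemma germeq_iter x f g l k : germeq x f g -> germeq x (iter k (pd l) f) (iter k (pd l) g).
Proof. by move=> e; elim: k => // k; exact: germeq_pd. Qed.
Lemma iter_comm x f l m k : hg x f ->
  germeq x (iter k (pd l) (pd m f)) (pd m (iter k (pd l) f)).
Proof.
move=> hf; elim: k => [|k IH]; first exact: germeq_refl.
apply: germeq_trans (germeq_pd l IH) _.
by apply: pd_comm; exact: hg_iter.
Qed.

(** The derivative of multi-index a, restricted to the variables listed in s. *)
Definition dpl (s : seq 'I_n) (a : {ffun 'I_n -> nat}) f : V -> C :=
  foldr (fun l g => iter (a l) (pd l) g) f s.
Definition dp (a : {ffun 'I_n -> nat}) f := dpl (enum 'I_n) a f.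

Lemma hg_dpl x f s a : hg x f -> hg x (dpl s a f).
Proof. by move=> hf; elim: s => //= l s; exact: hg_iter. Qed.
Lemma dpl_comm x f s a m : hg x f -> germeq x (dpl s a (pd m f)) (pd m (dpl s a f)).
Proof.
move=> hf; elim: s => [|l s IH] /=; first exact: germeq_refl.
apply: germeq_trans (germeq_iter l (a l) IH) _.
by apply: iter_comm; exact: hg_dpl.
Qed.

Definition incr (a : {ffun 'I_n -> nat}) (l : 'I_n) : {ffun 'I_n -> nat} :=
  [ffun k => (a k + (k == l))%N].

Lemma dpl_incr_notin s a l f : l \notin s -> dpl s (incr a l) f = dpl s a f.
Proof.
elim: s => //= k s IH; rewrite inE negb_or => /andP [lk ls].
by rewrite IH // ffunE eq_sym (negbTE lk) addn0.
Qed.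

Lemma dpl_incr x f s a l : hg x f -> uniq s -> l \in s ->
  germeq x (dpl s (incr a l) f) (dpl s a (pd l f)).
Proof.
move=> hf; elim: s => //= k s IH /andP [ks us]; rewrite inE => /orP [/eqP lk|ls].
  rewrite -lk dpl_incr_notin ?lk // ffunE eqxx addn1 iterSr.
  by apply: germeq_iter; apply: germeq_sym; exact: dpl_comm.
have kl : k != l by apply: contraNneq ks => ->.
by rewrite ffunE (negbTE kl) addn0; apply: germeq_iter; exact: IH.
Qed.

Lemma degree_incr a l : degree (incr a l) = (degree a).+1.
Proof.
rewrite /degree (eq_bigr (fun k => a k + (k == l))%N) => [|k _]; last by rewrite ffunE.
rewrite big_split /= -[RHS]addn1; congr addn.
by rewrite (bigD1 l) //= eqxx big1 // => k /negbTE ->.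
Qed.

Lemma dp_incr x f a l : hg x f -> germeq x (dp (incr a l) f) (dp a (pd l f)).
Proof. by move=> hf; apply: dpl_incr; rewrite ?enum_uniq ?mem_enum. Qed.

Lemma dp0 f : dp [ffun=> 0%N] f = f.
Proof. by rewrite /dp; elim: (enum _) => //= l s ->; rewrite ffunE. Qed.

(** Induction on q, by [van_pd]. *)
Lemma dp_van x f q : hg x f -> (forall a, (degree a < q)%N -> dp a f x = 0) -> van q x f.
Proof.
elim: q f => [|q IH] f hf H; first exact: hg_van0.
apply: van_pd => //.
  by rewrite -[f]dp0 H // /degree big1 // => l _; rewrite ffunE.
move=> l; apply: IH; first exact: hg_pd.
move=> a aq; rewrite -(nearx_at (dp_incr a l hf)); apply: H.
by rewrite degree_incr.
Qed.

Lemma van_dpl x f q s (a : {ffun 'I_n -> nat}) : hg x f -> van q x f -> van (q - \sum_(l <- s) a l)%N x (dpl s a f).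
Proof.
move=> hf vf; elim: s => [|l s IH] /=; first by rewrite big_nil subn0.
rewrite big_cons addnC subnDA; move: (_ - _)%N IH => p.
have := hg_dpl s a hf; move: (dpl s a f) => g hgg vg.
elim: (a l) => [|k IHk]; first by rewrite subn0.
rewrite iterS; case: (ltnP k p) => kp.
  apply: pd_van; first exact: hg_iter.
  by rewrite subnS prednK ?subn_gt0.
have -> : (p - k.+1 = 0)%N by apply/eqP; rewrite subn_eq0 ltnW.
by apply: hg_van0; apply: hg_pd; exact: hg_iter.
Qed.

Lemma van_dp x f q a : hg x f -> van q x f -> (degree a < q)%N -> dp a f x = 0.
Proof.
move=> hf vf aq; have := van_dpl (enum 'I_n) a hf vf.
have -> : (\sum_(l <- enum 'I_n) a l = degree a)%N.
  by rewrite /degree big_enum.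
by rewrite -(subnSK aq); exact: van_at.
Qed.

Lemma dpB x f g a : hg x f -> hg x g ->
  germeq x (dp a (fun y => f y - g y)) (fun y => dp a f y - dp a g y).
Proof.
move=> hf hg'; rewrite /dp; elim: (enum _) => [|l s IH] /=; first exact: germeq_refl.
apply: germeq_trans (germeq_iter l (a l) IH) _.
have := hg_dpl s a hf; have := hg_dpl s a hg'.
move: (dpl s a f) (dpl s a g) => u v hv hu.
elim: (a l) => [|k IHk] /=; first exact: germeq_refl.
apply: germeq_trans (germeq_pd l IHk) _.
have := nearx_and (hg_near (hg_iter l k hu)) (hg_near (hg_iter l k hv)).
by apply: nearx_imp => y [h1 h2]; rewrite /pd der_hgB.
Qed.

Lemma dpD x f g a : hg x f -> hg x g ->
  germeq x (dp a (fun y => f y + g y)) (fun y => dp a f y + dp a g y).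
Proof.
move=> hf hg'; rewrite /dp; elim: (enum _) => [|l s IH] /=; first exact: germeq_refl.
apply: germeq_trans (germeq_iter l (a l) IH) _.
have := hg_dpl s a hf; have := hg_dpl s a hg'.
move: (dpl s a f) (dpl s a g) => u v hv hu.
elim: (a l) => [|k IHk] /=; first exact: germeq_refl.
apply: germeq_trans (germeq_pd l IHk) _.
have := nearx_and (hg_near (hg_iter l k hu)) (hg_near (hg_iter l k hv)).
by apply: nearx_imp => y [h1 h2]; rewrite /pd der_hgD.
Qed.

Lemma dpZ x f (c : C) a : hg x f ->
  germeq x (dp a (fun y => f y * c)) (fun y => dp a f y * c).
Proof.
move=> hf; rewrite /dp; elim: (enum _) => [|l s IH] /=; first exact: germeq_refl.
apply: germeq_trans (germeq_iter l (a l) IH) _.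
have := hg_dpl s a hf; move: (dpl s a f) => u hu.
elim: (a l) => [|k IHk] /=; first exact: germeq_refl.
apply: germeq_trans (germeq_pd l IHk) _.
by apply: nearx_imp (hg_near (hg_iter l k hu)) => y h1; rewrite /pd der_hgZ.
Qed.

End Rows.
End Vanishing.
#[global] Opaque pd.

(** * Jets of matrix-valued germs *)

#[global] Transparent der deriv_at fdiff.

Section MatrixValued.
Context {R : realType}.
Local Notation C := (Cplx R).

Lemma nm_mx_le p q (A : 'M[C]_(p, q)) (b : R) : 0 <= b ->
  (forall i j, nm (A i j) <= b) -> nm A <= b.
Proof.
move=> b0 H; rewrite -rc_le -nmE.
have [A0|/mx_norm_neq0 [[i j] E]] := eqVneq (mx_norm A) 0.
  by rewrite [leLHS]A0 rc_le.
by rewrite [leLHS]E /= nmE rc_le.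
Qed.

Section V.
Context {V : normedModType C} {p q : nat}.
Implicit Types F : V -> 'M[C]_(p, q).

Lemma fdiff_coord F x i j : differentiable F x -> fdiff (fun y => F y i j) x.
Proof.
move=> dF; apply: (@differentiable_comp _ _ _ _ F (fun A : 'M[C]_(p, q) => A i j : C^o)) => //.
exact: differentiable_coord.
Qed.

Lemma is_derive_mx F x v (D : 'M[C]_(p, q)) :
  (forall i j, deriv_at (fun y => F y i j) x v (D i j)) -> is_derive x v F D.
Proof.
move=> H; apply/is_derive_nmP => e e0.
have [r r0 Hr] : nearx (0 : C) (fun h => forall ij : 'I_p * 'I_q,
    nm (F (x + h *: v) ij.1 ij.2 - F x ij.1 ij.2 - h * D ij.1 ij.2) <= e * nm h).
  apply: nearx_all => -[i j] /=; have /deriv_atP := H i j.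
  by move=> /(_ _ e0) [r r0 Hr]; exists r => // h; rewrite subr0; exact: Hr.
exists r => // h hr; apply: nm_mx_le => [|i j].
  by rewrite mulr_ge0 ?nm_ge0 // ltW.
by have := Hr h; rewrite subr0 => /(_ hr (i, j)); rewrite !mxE.
Qed.

Lemma derive_mxE F x v i j : (forall i j, fdiff (fun y => F y i j) x) ->
  derive F x v i j = der (fun y => F y i j) x v.
Proof.
move=> H.
have [_ ->] : is_derive x v F (\matrix_(i, j) der (fun y => F y i j) x v).
  by apply: is_derive_mx => k l; rewrite mxE; exact: fdiff_deriv.
by rewrite mxE.
Qed.
End V.

#[local] Opaque der deriv_at fdiff.

Section Jets.
Context {n d : nat}.
Local Notation V := 'rV[C]_n.

Definition hgm {p q} (x : V) (F : V -> 'M[C]_(p, q)) :=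
  forall i j, hg x (fun y => F y i j).

Lemma hgm_near p q (x : V) (F : V -> 'M[C]_(p, q)) : hgm x F ->
  nearx x (fun y => hgm y F).
Proof.
move=> H; have := nearx_all (I := ('I_p * 'I_q)%type) (fun ij => hg_near (H ij.1 ij.2)).
by apply: nearx_imp => y Hy i j; exact: (Hy (i, j)).
Qed.

Lemma partial_mx p q (F : V -> 'M[C]_(p, q)) x l i j : hgm x F ->
  partial l F x i j = pd l (fun y => F y i j) x.
Proof.
by move=> H; rewrite /partial derive_mxE // => k m; exact: nearx_at (H k m).
Qed.

#[global] Opaque partial.

Lemma partial_mx_germ p q (F : V -> 'M[C]_(p, q)) x l i j : hgm x F ->
  germeq x (fun y => partial l F y i j) (pd l (fun y => F y i j)).
Proof. by move=> /hgm_near; apply: nearx_imp => y /partial_mx. Qed.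

Lemma hgm_partial p q (F : V -> 'M[C]_(p, q)) x l : hgm x F -> hgm x (partial l F).
Proof.
move=> H i j; apply: hg_ext (germeq_sym (partial_mx_germ l i j H)) _.
exact/hg_pd/H.
Qed.

(** Derivatives of matrix-valued functions are computed entrywise, which reduces
    jets to scalar germs. *)
Lemma dpartial_mx p q (F : V -> 'M[C]_(p, q)) x (a : {ffun 'I_n -> nat}) i j : hgm x F ->
  dpartial a F x i j = dp a (fun y => F y i j) x.
Proof.
move=> H; rewrite /dpartial /dp.
suff [_ K] : hgm x (foldr (fun l g => iter (a l) (partial l) g) F (enum 'I_n)) /\
  forall i j, germeq x (fun y => foldr (fun l g => iter (a l) (partial l) g) F (enum 'I_n) y i j)
    (dpl (enum 'I_n) a (fun y => F y i j)) by exact: nearx_at (K i j).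
elim: (enum 'I_n) => [|l s [IH1 IH2]] /=; first by split => // k m; exact: germeq_refl.
move: (foldr _ _ _) IH1 IH2 => G IH1 IH2.
elim: (a l) => [|k [IHk1 IHk2]] //=; split; first exact: hgm_partial.
move=> b c; apply: germeq_trans (partial_mx_germ l b c IHk1) _.
by apply: germeq_pd; exact: IHk2.
Qed.

(** Two sections have the same h-jet iff their difference vanishes to order h +
    1; this replaces multi-indices by orders of vanishing from here on. *)
Lemma jet_eqP p q h (s s' : 'I_d -> V -> 'M[C]_(p, q)) x :
  (forall i, hgm x (s i)) -> (forall i, hgm x (s' i)) ->
  jet h s x = jet h s' x <->
  forall i b c, van h.+1 x (fun y => s i y b c - s' i y b c).
Proof.
move=> H H'; split.
  move=> E i b c; apply: dp_van; first exact: hgB (H i b c) (H' i b c).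
  move=> a; rewrite ltnS => ah.
  have := congr1 (fun J => J a i) E; rewrite /jet /trunc ah => /matrixP /(_ b c).
  rewrite !dpartial_mx // => e.
  by rewrite (nearx_at (dpB a (H i b c) (H' i b c))) e subrr.
move=> E; apply/funext => a; apply/funext => i; rewrite /jet /trunc.
case: ifP => // ah; apply/matrixP => b c; rewrite !dpartial_mx //.
apply/eqP; rewrite -subr_eq0 -(nearx_at (dpB a (H i b c) (H' i b c))); apply/eqP.
apply: van_dp (E i b c) _; last by rewrite ltnS.
exact: hgB (H i b c) (H' i b c).
Qed.

Lemma hgm0 p q x : hgm x (fun=> 0 : 'M[C]_(p, q)).
Proof.
move=> i j; rewrite (_ : (fun y => _) = fun=> 0); first exact: hg_cst.
by apply/funext => y; rewrite mxE.
Qed.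

Lemma jet0 p q h x : jet h (fun (_ : 'I_d) (_ : V) => 0 : 'M[C]_(p, q)) x = 0.
Proof.
apply/funext => a; apply/funext => i; rewrite /jet /trunc.
case: ifP => // ah; apply/matrixP => b c; rewrite dpartial_mx; last exact: hgm0.
have E : (0 : 'M[C]_(p, q)) b c = 0 by rewrite mxE.
transitivity ((0 : 'M[C]_(p, q)) b c); last by [].
by rewrite E; apply: (van_dp (q := h.+1)); [exact: hg_cst|exact: van0|].
Qed.

Lemma jet_eq0P p q h (s : 'I_d -> V -> 'M[C]_(p, q)) x : (forall i, hgm x (s i)) ->
  jet h s x = 0 <-> forall i b c, van h.+1 x (fun y => s i y b c).
Proof.
move=> H; rewrite -(jet0 p q h x); apply: iff_trans (jet_eqP h H _) _.
  by move=> i; exact: hgm0.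
by split=> E i b c; have := E i b c; apply: van_ext; exists 1 => // y _; rewrite mxE subr0.
Qed.

Lemma dform_germ (s : forms R n d) x i l m : hgm x (s i) ->
  germeq x (fun y => dform s i y l m)
    (fun y => pd l (fun z => s i z 0 m) y - pd m (fun z => s i z 0 l) y).
Proof.
move=> /hgm_near; apply: nearx_imp => y H.
have E : dform s i y l m = partial l (s i) y 0 m - partial m (s i) y 0 l.
  by rewrite /dform mxE.
have e1 := partial_mx l 0 m H; have e2 := partial_mx m 0 l H.
exact: etrans E (congr2 (fun u v => u - v) e1 e2).
Qed.

Lemma hgm_dform (s : forms R n d) x i : hgm x (s i) -> hgm x (dform s i).
Proof.
move=> H l m; apply: hg_ext (germeq_sym (dform_germ l m H)) _.
by apply: hgB; apply: hg_pd; exact: H.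
Qed.

Lemma jet_lin h (s s' : 'I_d -> V -> 'rV[C]_n) (c : C) x :
  (forall i, hgm x (s i)) -> (forall i, hgm x (s' i)) ->
  jet h (fun i y => c *: s i y + s' i y) x = c *: jet h s x + jet h s' x.
Proof.
move=> H H'; apply/funext => a; apply/funext => i; rewrite /jet /trunc.
rewrite -[RHS]/(c *: (if (degree a <= h)%N then dpartial a (s i) x else 0)
   + (if (degree a <= h)%N then dpartial a (s' i) x else 0)).
case: ifP => // ah; last by rewrite scaler0 addr0.
have H2 : hgm x (fun y => c *: s i y + s' i y).
  move=> b k; rewrite (_ : (fun y => _) = fun y => s i y b k * c + s' i y b k).
    by apply: hgD (hgM _ _) _; [exact: H|exact: hg_cst|exact: H'].
  by apply/funext => y; rewrite !mxE mulrC.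
apply/matrixP => b k; rewrite dpartial_mx // !mxE !dpartial_mx //.
rewrite (_ : (fun y => _) = fun y => s i y b k * c + s' i y b k); last first.
  by apply/funext => y; rewrite !mxE mulrC.
have hc : hg x (fun y => s i y b k * c) by apply: hgM; [exact: H|exact: hg_cst].
rewrite (nearx_at (dpD a hc (H' i b k))) (nearx_at (dpZ c a (H i b k))).
by rewrite mulrC.
Qed.

End Jets.
End MatrixValued.

#[global] Opaque der deriv_at fdiff.

(** * Functions of the first integrals and the triangular system of their jets *)

Section FirstIntegrals.
Context {R : realType} {n d : nat}.
Local Notation C := (Cplx R).
Local Notation V := 'rV[C]_n.
Variables (x0 : V) (U : 'I_d -> V -> C).
Hypothesis HU : forall i, hg x0 (U i).

(** Divided powers of U_i - U_i(x0): the derivative of one with respect to U_i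
    is the preceding one. *)
Definition dpow m i : V -> C := fun y => (U i y - U i x0) ^+ m / m`!%:R.

Lemma factC_neq0 m : m`!%:R != 0 :> C.
Proof. by rewrite pnatr_eq0 -lt0n fact_gt0. Qed.

Lemma dpow_x0 m i : dpow m i x0 = (m == 0)%:R.
Proof.
rewrite /dpow subrr expr0n; case: m => [|m]; first by rewrite divr1.
by rewrite mul0r.
Qed.

Lemma dpow0 i : dpow 0 i = fun=> 1.
Proof. by apply/funext => y; rewrite /dpow expr0 divr1. Qed.

Lemma hg_dpow m i : hg x0 (dpow m i).
Proof.
apply: hgM; last exact: hg_cst.
by apply: hgX; apply: hgB; [exact: HU|exact: hg_cst].
Qed.

Lemma dpowS m i y : dpow m.+1 i y = dpow m i y * ((U i y - U i x0) * (m.+1%:R)^-1).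
Proof.
rewrite /dpow factS natrM exprS; have := factC_neq0 m.
have : m.+1%:R != 0 :> C by rewrite pnatr_eq0.
by move: (m.+1%:R : C) (m`!%:R : C) => a b a0 b0; field; rewrite a0 b0.
Qed.

#[local] Transparent pd.
Lemma pd_cst (c : C) l : pd l (fun=> c : C) = (fun=> 0) :> (V -> C).
Proof. by apply/funext => y; exact: der_cst. Qed.
Lemma pdM (f g : V -> C) l x : hg x f -> hg x g ->
  pd l (fun y => f y * g y) x = f x * pd l g x + g x * pd l f x.
Proof. exact: der_hgM. Qed.
Lemma pdB (f g : V -> C) l x : hg x f -> hg x g ->
  pd l (fun y => f y - g y) x = pd l f x - pd l g x.
Proof. exact: der_hgB. Qed.
Lemma pdD (f g : V -> C) l x : hg x f -> hg x g ->
  pd l (fun y => f y + g y) x = pd l f x + pd l g x.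
Proof. exact: der_hgD. Qed.
Lemma pdZ (f : V -> C) c l x : hg x f -> pd l (fun y => f y * c) x = pd l f x * c.
Proof. exact: der_hgZ. Qed.
Lemma pd_sum (I : Type) (s : seq I) (F : I -> V -> C) l x : (forall i, hg x (F i)) ->
  pd l (fun y => \sum_(i <- s) F i y) x = \sum_(i <- s) pd l (F i) x.
Proof. exact: der_hg_sum. Qed.
#[local] Opaque pd.

Lemma pd_dpow m i l : germeq x0 (pd l (dpow m.+1 i)) (fun y => dpow m i y * pd l (U i) y).
Proof.
elim: m => [|m IH].
  have hU := hg_near (HU i); apply: nearx_imp hU => y hy.
  have -> : dpow 1 i = fun y => (U i y - U i x0) * 1.
    by apply/funext => z; rewrite dpowS dpow0 mul1r invr1.
  rewrite dpow0 pdZ; last by apply: hgB => //; exact: hg_cst.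
  by rewrite mulr1 mul1r pdB // ?pd_cst ?subr0 //; exact: hg_cst.
have H := nearx_and (nearx_and (hg_near (HU i)) (hg_near (hg_dpow m.+1 i))) IH.
apply: nearx_imp H => y [[hy hd] IHy].
have -> : dpow m.+2 i = fun y => dpow m.+1 i y * ((U i y - U i x0) * (m.+2%:R)^-1).
  by apply/funext => z; rewrite dpowS.
have h1 : hg y (fun z => U i z - U i x0) := hgB hy (hg_cst _ _).
rewrite (pdM _ hd (hgM h1 (hg_cst _ _))) (pdZ _ _ h1) (pdB _ hy (hg_cst _ _)).
rewrite pd_cst subr0 IHy dpowS.
have a0 : m.+1%:R != 0 :> C by rewrite pnatr_eq0.
have b0 : m.+2%:R != 0 :> C by rewrite pnatr_eq0.
have E : m.+2%:R = m.+1%:R + 1 :> C by rewrite -natr1.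
move: (pd l (U i) y) (dpow m i y) (U i y - U i x0) => a b c.
rewrite E in b0 *; move: (m.+1%:R : C) a0 b0 => k a0 b0.
by field; rewrite b0 a0.
Qed.

(** Iterated derivatives along a word of indices, better suited to induction
    than multi-indices. *)
Definition dword (w : seq 'I_n) (f : V -> C) : V -> C := foldr (@pd R n) f w.

(** The coefficients in the chain rule: the derivative along w of F(U_i) is the
    sum over k of chainQ w k i times the k-th derivative of F at U_i. *)
Fixpoint chainQ (w : seq 'I_n) (k : nat) (i : 'I_d) : V -> C :=
  if w is l :: w' then fun y => pd l (chainQ w' k i) y +
    (if k is k'.+1 then chainQ w' k' i y * pd l (U i) y else 0)
  else fun=> (k == 0)%:R.

Lemma hg_chainQ w k i : hg x0 (chainQ w k i).
Proof.
elim: w k => [|l w IH] k /=; first exact: hg_cst.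
apply: hgD; first by apply: hg_pd; exact: IH.
case: k => [|k]; first exact: hg_cst.
by apply: hgM; [exact: IH|exact: hg_pd].
Qed.

Lemma chainQ_big w k i : (size w < k)%N -> chainQ w k i = fun=> 0.
Proof.
elim: w k => [|l w IH] [|k] //= wk; apply/funext => y.
by rewrite (IH k.+1 (ltnW wk)) pd_cst (IH k wk) mul0r addr0.
Qed.

(** The coefficient of the highest derivative involves first derivatives of U_i
    only; these products are the entries of the matrices P_j. *)
Lemma chainQ_top w i y : chainQ w (size w) i y = \prod_(l <- w) pd l (U i) y.
Proof.
elim: w => [|l w IH] /=; first by rewrite big_nil.
by rewrite chainQ_big // pd_cst add0r big_cons IH mulrC.
Qed.

Lemma chainQ0 l w i : chainQ (l :: w) 0 i = fun=> 0.
Proof.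
elim: w l => [|m w IH] l; apply/funext => y /=.
  by rewrite pd_cst addr0.
by have /= := IH m => ->; rewrite pd_cst addr0.
Qed.

(** The k-th derivative of the m-th divided power with respect to U_i, which is
    0 when k > m. *)
Definition esh m k i : V -> C := fun y => if (k <= m)%N then dpow (m - k) i y else 0.

Lemma hg_esh m k i : hg x0 (esh m k i).
Proof. by rewrite /esh; case: leqP => _; [exact: hg_dpow|exact: hg_cst]. Qed.

Lemma pd_esh m k i l : germeq x0 (pd l (esh m k i)) (fun y => esh m k.+1 i y * pd l (U i) y).
Proof.
rewrite /esh; case: (ltngtP k m) => km.
- by rewrite -(subnSK km); exact: pd_dpow.
- by exists 1 => // y _; rewrite pd_cst mul0r.
by rewrite km subnn; exists 1 => // y _; rewrite dpow0 pd_cst mul0r.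
Qed.

(** Here E k stands for the k-th derivative of a function of U_i. *)
Lemma chain_rule_gen (E : nat -> V -> C) w i : (forall k, hg x0 (E k)) ->
  (forall k l, germeq x0 (pd l (E k)) (fun y => E k.+1 y * pd l (U i) y)) ->
  germeq x0 (dword w (E 0%N)) (fun y => \sum_(k < (size w).+1) chainQ w k i y * E k y).
Proof.
move=> hE dE; elim: w => [|l w IH] /=.
  by exists 1 => // y _; rewrite big_ord_recl big_ord0 /= mul1r addr0.
apply: germeq_trans (germeq_pd l IH) _.
have H1 := nearx_all (fun k : 'I_(size w).+1 => hg_near (hg_chainQ w k i)).
have H2 := nearx_all (fun k : 'I_(size w).+1 => hg_near (hE k)).
have H3 := nearx_all (fun k : 'I_(size w).+1 => dE k l).
apply: nearx_imp (nearx_and (nearx_and H1 H2) H3) => y [[h1 h2] h3].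
rewrite pd_sum => [|k]; last by apply: hgM; [exact: h1|exact: h2].
transitivity (\sum_(k < (size w).+1) (pd l (chainQ w k i) y * E k y
    + chainQ w k i y * pd l (U i) y * E k.+1 y)).
  apply: eq_bigr => k _; rewrite pdM; [|exact: h1|exact: h2].
  have e := h3 k; rewrite e.
  move: (chainQ w k i y) (pd l (chainQ w k i) y) (E k y) (E k.+1 y) (pd l (U i) y).
  by move=> a b e1 e2 f; ring.
rewrite big_split /=.
transitivity (\sum_(k < (size w).+2) pd l (chainQ w k i) y * E k y +
  \sum_(k < (size w).+2) (if (k : nat) is k'.+1 then chainQ w k' i y * pd l (U i) y else 0) * E k y).
  congr (_ + _); first by rewrite [RHS]big_ord_recr /= chainQ_big // pd_cst mul0r addr0.
  by rewrite [RHS]big_ord_recl /= mul0r add0r; apply: eq_bigr => k _; rewrite /bump add1n.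
by rewrite -big_split /=; apply: eq_bigr => k _; rewrite mulrDl.
Qed.

Lemma chain_rule w m i : germeq x0 (dword w (dpow m i))
  (fun y => \sum_(k < (size w).+1) chainQ w k i y * esh m k i y).
Proof.
have E0 : esh m 0 i = dpow m i by rewrite /esh leq0n subn0.
rewrite -E0; apply: (chain_rule_gen (E := fun k => esh m k i)) => [k|k l].
  exact: hg_esh.
exact: pd_esh.
Qed.

Lemma esh_x0 m k i : esh m k i x0 = (k == m)%:R.
Proof.
rewrite /esh; case: (ltngtP k m) => km //; last by rewrite km subnn dpow_x0.
by rewrite dpow_x0 subn_eq0 leqNgt km.
Qed.

Lemma chain_rule_x0 w m i : dword w (dpow m i) x0 = chainQ w m i x0.
Proof.
rewrite (nearx_at (chain_rule w m i)).
case: (leqP m (size w)) => mw; last first.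
  rewrite (chainQ_big i mw) big1 // => k _; rewrite esh_x0.
  by case: eqP => [km|_]; [move: (ltn_ord k); rewrite km ltnS leqNgt mw|rewrite mulr0].
have mw' : (m < (size w).+1)%N by [].
rewrite (bigD1 (Ordinal mw')) //= esh_x0 eqxx mulr1 big1 ?addr0 // => k km.
rewrite esh_x0; suff /negbTE -> : (k : nat) != m by rewrite mulr0.
by apply: contraNneq km => km; apply/eqP/val_inj.
Qed.

(** The multi-index a as the sorted word in which l occurs a l times. *)
Definition wordof (a : {ffun 'I_n -> nat}) : seq 'I_n :=
  flatten [seq nseq (a l) l | l <- enum 'I_n].

Lemma dp_word a f : dp a f = dword (wordof a) f.
Proof.
have E k l g : iter k (@pd R n l) g = foldr (@pd R n) g (nseq k l).
  elim: k => [|k IH]; first exact: erefl.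
  by rewrite [LHS]iterS IH.
rewrite /dp /dword /wordof; elim: (enum 'I_n) => [|l s IH]; first exact: erefl.
rewrite [LHS]/= [X in foldr _ f X]/= foldr_cat -E.
by rewrite IH.
Qed.

Lemma size_wordof a : size (wordof a) = degree a.
Proof.
rewrite /wordof size_flatten /shape -map_comp sumnE big_map big_enum /=.
by apply: eq_bigr => l _; rewrite size_nseq.
Qed.

Lemma prod_wordof a (F : 'I_n -> C) : \prod_(l <- wordof a) F l = \prod_l F l ^+ a l.
Proof.
rewrite /wordof big_flatten big_map big_enum /=.
by apply: eq_bigr => l _; rewrite big_nseq; elim: (a l) => //= k ->; rewrite exprS.
Qed.

Implicit Types c : nat -> 'cV[C]_d.

(** The polynomial in U_i of degree h with Taylor coefficients c; [gser] is its
    primitive that vanishes at x0. *)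
Definition fser h c i : V -> C := fun y => \sum_(m < h.+1) dpow m i y * c m i 0.
Definition gser h c i : V -> C := fun y => \sum_(m < h.+1) dpow m.+1 i y * c m i 0.

Lemma hg_fser h c i : hg x0 (fser h c i).
Proof. by apply: hg_sum => m; apply: hgM; [exact: hg_dpow|exact: hg_cst]. Qed.
Lemma hg_gser h c i : hg x0 (gser h c i).
Proof. by apply: hg_sum => m; apply: hgM; [exact: hg_dpow|exact: hg_cst]. Qed.

Lemma pd_gser h c i l : germeq x0 (pd l (gser h c i)) (fun y => fser h c i y * pd l (U i) y).
Proof.
have H1 := nearx_all (fun k : 'I_h.+1 => hg_near (hg_dpow k.+1 i)).
have H3 := nearx_all (fun k : 'I_h.+1 => pd_dpow k i l).
apply: nearx_imp (nearx_and H1 H3) => y [h1 h3].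
rewrite pd_sum => [|k]; last by apply: hgM; [exact: h1|exact: hg_cst].
rewrite /fser mulr_suml; apply: eq_bigr => k _.
by rewrite pdZ ?h3; [rewrite mulrAC|exact: h1].
Qed.

Lemma gser_x0 h c i : gser h c i x0 = 0.
Proof. by rewrite /gser big1 // => m _; rewrite dpow_x0 mul0r. Qed.

Lemma van_dpow m i : van m x0 (dpow m i).
Proof.
elim: m => [|m IH]; first exact: hg_van0 (hg_dpow 0 i).
apply: van_pd; [exact: hg_dpow|by rewrite dpow_x0|] => l.
apply: van_ext (germeq_sym (pd_dpow m i l)) _.
by apply: vanMr IH _; exact: hg_pd.
Qed.

Lemma fser_le h h' c i : (h <= h')%N ->
  van h.+1 x0 (fun y => fser h' c i y - fser h c i y).
Proof.
move=> hh; rewrite -(subnKC hh).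
elim: (h' - h)%N => [|k IH].
  rewrite addn0 (_ : (fun y => _) = fun=> 0); first exact: van0.
  by apply/funext => y; rewrite subrr.
rewrite addnS (_ : (fun y => _) = fun y => (fser (h + k) c i y - fser h c i y)
    + dpow (h + k).+1 i y * c (h + k).+1 i 0).
  apply: vanD IH _; apply: vanMr; last exact: hg_cst.
  by apply: van_le (van_dpow _ _); rewrite ltnS leq_addr.
by apply/funext => y; rewrite /fser big_ord_recr /=; ring.
Qed.

(** The trace of the family (f_i(U_i) dU_i) vanishes to order h + 1. *)
Definition trace_ok h c :=
  forall l, van h.+1 x0 (fun y => \sum_i fser h c i y * pd l (U i) y).

(** The multi-index of degree j that labels a row of P_j. *)
Definition midx j (L : 'I_#|multi_indices n j|) : {ffun 'I_n -> nat} :=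
  [ffun l => nat_of_ord ((enum_val L : {ffun 'I_n -> 'I_j.+1}) l)].

(** The block of the coefficients of c_m in the equations given by the
    derivatives of order j + 1 of the sum of the primitives. *)
Definition sysM j m : 'M[C]_(#|multi_indices n j.+1|, d) :=
  \matrix_(L, i) chainQ (wordof (midx L)) m.+1 i x0.

Lemma degree_midx j (L : 'I_#|multi_indices n j|) : degree (midx L) = j.
Proof.
rewrite /degree (eq_bigr (fun l => nat_of_ord ((enum_val L : {ffun 'I_n -> 'I_j.+1}) l))).
  by have := enum_valP L; rewrite inE => /eqP.
by move=> l _; rewrite ffunE.
Qed.

(** The diagonal blocks are the matrices P_{j+1}. *)
Lemma sysM_diag j : sysM j j =
  \matrix_(L, i) \prod_l pd l (U i) x0 ^+ ((enum_val L : {ffun 'I_n -> 'I_j.+2}) l).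
Proof.
apply/matrixP => L i; rewrite !mxE.
have := chainQ_top (wordof (midx L)) i x0.
rewrite size_wordof degree_midx => ->; rewrite prod_wordof.
by apply: eq_bigr => l _; rewrite ffunE.
Qed.

Lemma dp_gser h c a : dp a (fun y => \sum_i gser h c i y) x0 =
  \sum_i \sum_(m < h.+1) chainQ (wordof a) m.+1 i x0 * c m i 0.
Proof.
have dsum (I : Type) (s : seq I) (F : I -> V -> C) : (forall i, hg x0 (F i)) ->
    dp a (fun y => \sum_(i <- s) F i y) x0 = \sum_(i <- s) dp a (F i) x0.
  move=> hF; elim: s => [|i s IH].
    rewrite big_nil (_ : (fun y => _) = fun=> 0); last first.
      by apply/funext => y; rewrite big_nil.
    apply: (van_dp (q := (degree a).+1)); [exact: hg_cst|exact: van0|by []].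
  rewrite big_cons -IH (_ : (fun y => _) = fun y => F i y + \sum_(j <- s) F j y).
    exact: nearx_at (dpD a (hF i) (hg_sum s hF)).
  by apply/funext => y; rewrite big_cons.
rewrite dsum => [|i]; last exact: hg_gser.
apply: eq_bigr => i _; rewrite dsum => [|m]; last first.
  by apply: hgM; [exact: hg_dpow|exact: hg_cst].
apply: eq_bigr => m _; rewrite (nearx_at (dpZ _ a (hg_dpow m.+1 i))).
by rewrite dp_word chain_rule_x0.
Qed.

Lemma midxP j (a : {ffun 'I_n -> nat}) : degree a = j ->
  exists L : 'I_#|multi_indices n j|, midx L = a.
Proof.
move=> aj.
have al l : (a l < j.+1)%N by rewrite ltnS -aj /degree (bigD1 l) //= leq_addr.
pose L0 : {ffun 'I_n -> 'I_j.+1} := [ffun l => Ordinal (al l)].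
have LA : L0 \in multi_indices n j.
  rewrite inE; apply/eqP; transitivity (degree a); last exact: aj.
  by apply: eq_bigr => l _; rewrite ffunE.
exists (enum_rank_in LA L0); apply/ffunP => l.
by rewrite ffunE enum_rankK_in // ffunE.
Qed.

(** The trace is the differential of the sum of the primitives, which vanishes
    at x0. *)
Lemma trace_gser h c : trace_ok h c <-> van h.+2 x0 (fun y => \sum_i gser h c i y).
Proof.
pose G y := \sum_i gser h c i y.
have hG : hg x0 G by apply: hg_sum => i; exact: hg_gser.
have pG l : germeq x0 (pd l G) (fun y => \sum_i fser h c i y * pd l (U i) y).
  have H1 := nearx_all (fun i => hg_near (hg_gser h c i)).
  have H2 := nearx_all (fun i => pd_gser h c i l).
  apply: nearx_imp (nearx_and H1 H2) => y [h1 h2].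
  rewrite pd_sum; last exact: h1.
  by apply: eq_bigr => i _; exact: h2.
have G0 : G x0 = 0 by rewrite /G big1 // => i _; rewrite gser_x0.
split=> [H|H l]; last first.
  apply: van_ext (pG l) _; exact: pd_van.
apply: van_pd; [exact: hG|exact: G0|move=> l].
apply: van_ext (germeq_sym (pG l)) _; exact: H.
Qed.

(** The condition on the trace says that the derivatives of order 1 to h + 1 of
    the sum of the primitives are 0 at x0. A derivative of order j + 1 involves
    the coefficients c_m with m <= j only. *)
Lemma trace_okP h c : trace_ok h c <->
  forall j, (j <= h)%N -> \sum_(m < j.+1) sysM j m *m c m = 0.
Proof.
pose G y := \sum_i gser h c i y.
have hG : hg x0 G by apply: hg_sum => i; exact: hg_gser.
have sysE j (L : 'I_#|multi_indices n j.+1|) : (j <= h)%N ->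
   dp (midx L) G x0 = (\sum_(m < j.+1) sysM j m *m c m) L 0.
  move=> jh; rewrite dp_gser summxE exchange_big /=.
  rewrite (big_ord_widen_cond h.+1 xpredT (fun m => (sysM j m *m c m) L 0)) //=.
  rewrite [RHS]big_mkcond /=; apply: eq_bigr => m _.
  case: ltnP => jm.
    by rewrite mxE; apply: eq_bigr => i _; rewrite mxE.
  by apply: big1 => i _; rewrite chainQ_big ?mul0r // size_wordof degree_midx.
rewrite trace_gser; split=> [H j jh|H].
  apply/matrixP => L k; rewrite ord1 -sysE // mxE; apply: (van_dp hG H).
  by rewrite degree_midx.
apply: dp_van => // a ah.
case da: (degree a) => [|j].
  have -> : a = [ffun=> 0%N].
    apply/ffunP => l; rewrite ffunE; apply/eqP; rewrite -leqn0 -da /degree.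
    by rewrite (bigD1 l) //= leq_addr.
  by rewrite dp0 /G big1 // => i _; rewrite gser_x0.
have jh : (j <= h)%N by move: ah; rewrite da !ltnS.
by have [L <-] := midxP da; rewrite sysE // H // mxE.
Qed.

End FirstIntegrals.

(** * The system at the points near the base point *)

Section MatrixGerms.
Context {R : realType} {n : nat}.
Local Notation C := (Cplx R).
Local Notation V := 'rV[C]_n.
Variable x0 : V.

Lemma hgm_cst p q (A : 'M[C]_(p, q)) : hgm x0 (fun=> A).
Proof. by move=> i j; exact: hg_cst. Qed.

Lemma hgm_mul p q s (A : V -> 'M[C]_(p, q)) (B : V -> 'M[C]_(q, s)) :
  hgm x0 A -> hgm x0 B -> hgm x0 (fun y => A y *m B y).
Proof.
move=> hA hB i j; rewrite (_ : (fun y => _) = fun y => \sum_k A y i k * B y k j).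
  by apply: hg_sum => k; apply: hgM; [exact: hA|exact: hB].
by apply/funext => y; rewrite mxE.
Qed.

Lemma hg_det p (A : V -> 'M[C]_p) : hgm x0 A -> hg x0 (fun y => \det (A y)).
Proof.
move=> hA; apply: hg_sum => s; apply: hgM; first exact: hg_cst.
by apply: hg_prod => i; exact: hA.
Qed.

Lemma hgm_adj p (A : V -> 'M[C]_p) : hgm x0 A -> hgm x0 (fun y => \adj (A y)).
Proof.
move=> hA i j.
rewrite (_ : (fun y => _) = fun y => (-1) ^+ (j + i) * \det (row' j (col' i (A y)))).
  apply: hgM; first exact: hg_cst.
  apply: hg_det => k l.
  rewrite (_ : (fun y => _) = fun y => A y (lift j k) (lift i l)); first exact: hA.
  by apply/funext => y; rewrite !mxE.
by apply/funext => y; rewrite mxE.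
Qed.

(** The inverse is the adjugate divided by the determinant, which does not
    vanish near x0. *)
Lemma inv_germ p (A : V -> 'M[C]_p) : hgm x0 A -> A x0 = 1%:M ->
  exists2 B : V -> 'M[C]_p, hgm x0 B & nearx x0 (fun y => B y *m A y = 1%:M).
Proof.
move=> hA A1; have hd := hg_det hA.
have d0 : \det (A x0) != 0 by rewrite A1 det1 oner_eq0.
exists (fun y => (\det (A y))^-1 *: \adj (A y)).
  move=> i j; rewrite (_ : (fun y => _) = fun y => (\det (A y))^-1 * \adj (A y) i j).
    by apply: hgM; [exact: hgV|exact: hgm_adj].
  by apply/funext => y; rewrite mxE.
apply: nearx_imp (hg_neq0 hd d0) => y dy.
by rewrite -scalemxAl mul_adj_mx scale_scalar_mx mulVf.
Qed.

End MatrixGerms.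

Section Tower.
Context {R : realType} {n d : nat}.
Local Notation C := (Cplx R).
Local Notation V := 'rV[C]_n.
Variables (x0 : V) (U : 'I_d -> V -> C).
Hypothesis HU : forall i, hg x0 (U i).
Implicit Types c : nat -> 'cV[C]_d.

Local Notation esh := (esh x0 U).
Local Notation fser := (fser x0 U).
Local Notation gser := (gser x0 U).
Local Notation trace_ok := (trace_ok x0 U).
Local Notation sysM := (sysM x0 U).

(** The q-th derivative of the truncated series with respect to U_i. *)
Definition yser h c q i : V -> C := fun y => \sum_(m < h.+1) esh m q i y * c m i 0.

Lemma hg_yser h c q i : hg x0 (yser h c q i).
Proof. by apply: hg_sum => m; apply: hgM; [exact: hg_esh|exact: hg_cst]. Qed.

Lemma yser0 h c i : yser h c 0 i = fser h c i.
Proof.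
by apply/funext => y; apply: eq_bigr => m _; rewrite /esh leq0n subn0.
Qed.

Lemma yser_x0 h c q i : (q <= h)%N -> yser h c q i x0 = c q i 0.
Proof.
rewrite -ltnS => qh; rewrite /yser (bigD1 (Ordinal qh)) //= esh_x0 eqxx mul1r.
rewrite big1 ?addr0 // => k kq; rewrite esh_x0.
suff /negbTE -> : q != k by rewrite mul0r.
by apply: contraNneq kq => kq; apply/eqP/val_inj.
Qed.

Lemma pd_yser h c q i l :
  germeq x0 (pd l (yser h c q i)) (fun y => yser h c q.+1 i y * pd l (U i) y).
Proof.
have H1 := nearx_all (fun k : 'I_h.+1 => hg_near (hg_esh HU k q i)).
have H3 := nearx_all (fun k : 'I_h.+1 => pd_esh HU k q i l).
apply: nearx_imp (nearx_and H1 H3) => y [h1 h3].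
rewrite pd_sum => [|k]; last by apply: hgM; [exact: h1|exact: hg_cst].
rewrite /yser mulr_suml; apply: eq_bigr => k _.
have e := h3 k; rewrite (pdZ _ _ (h1 k)) e; exact: mulrAC.
Qed.

(** The k-th derivative of the primitive with respect to U_i; it is [yser]
    shifted by one for k > 0. *)
Definition gsh h c k i : V -> C := fun y => \sum_(m < h.+1) esh m.+1 k i y * c m i 0.

Lemma gsh0 h c i : gsh h c 0 i = gser h c i.
Proof. by apply/funext => y; apply: eq_bigr => m _; rewrite /esh leq0n subn0. Qed.
Lemma gshS h c k i : gsh h c k.+1 i = yser h c k i.
Proof. by []. Qed.

Lemma hg_gsh h c q i : hg x0 (gsh h c q i).
Proof. by apply: hg_sum => m; apply: hgM; [exact: hg_esh|exact: hg_cst]. Qed.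

Lemma pd_gsh h c q i l :
  germeq x0 (pd l (gsh h c q i)) (fun y => gsh h c q.+1 i y * pd l (U i) y).
Proof.
case: q => [|q]; last by rewrite !gshS; exact: pd_yser.
by rewrite gsh0 gshS yser0; exact: pd_gser.
Qed.

Lemma dword_gser h c w i : germeq x0 (dword w (gser h c i))
  (fun y => \sum_(k < (size w).+1) chainQ U w k i y * gsh h c k i y).
Proof.
rewrite -gsh0; apply: (chain_rule_gen HU (E := fun k => gsh h c k i)) => [k|k l].
  exact: hg_gsh.
exact: pd_gsh.
Qed.

Lemma hg_dword w f : hg x0 f -> hg x0 (dword w f).
Proof. by move=> hf; elim: w => [|l w IH] //=; exact: hg_pd. Qed.

Lemma dword_sum (I : finType) w (F : I -> V -> C) : (forall i, hg x0 (F i)) ->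
  germeq x0 (dword w (fun y => \sum_i F i y)) (fun y => \sum_i dword w (F i) y).
Proof.
move=> hF; elim: w => [|l w IH]; first exact: germeq_refl.
apply: germeq_trans (germeq_pd l IH) _.
have H := nearx_all (fun i => hg_near (hg_dword w (hF i))).
by apply: nearx_imp H => y Hy; exact: pd_sum.
Qed.

Lemma van_dword w q f : hg x0 f -> van (q + size w) x0 f -> van q x0 (dword w f).
Proof.
elim: w q => [|l w IH] q hf /=; first by rewrite addn0.
rewrite addnS -addSn => H; apply: pd_van; [exact: hg_dword|exact: IH].
Qed.

(** The blocks of the system, at all the points near x0 instead of x0 only. *)
Definition sysG J m (y : V) : 'M[C]_(#|multi_indices n J.+1|, d) :=
  \matrix_(L, i) chainQ U (wordof (midx L)) m.+1 i y.

Lemma hgm_sysG J m : hgm x0 (sysG J m).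
Proof.
move=> L i; rewrite (_ : (fun y => _) = chainQ U (wordof (midx L)) m.+1 i).
  exact: hg_chainQ.
by apply/funext => y; rewrite mxE.
Qed.

(** The derivatives of order J + 1 of the sum of the primitives, as germs. Each
    of the J + 1 derivations costs one order of vanishing. *)
Lemma sysG_van h c J L : (J <= h)%N -> trace_ok h c ->
  van (h.+1 - J) x0 (fun y => \sum_(k < J.+1) \sum_i sysG J k y L i * yser h c k i y).
Proof.
move=> Jh /(trace_gser HU) H; pose w := wordof (midx L).
have sw : size w = J.+1 by rewrite size_wordof degree_midx.
have hG : hg x0 (fun y => \sum_i gser h c i y).
  by apply: hg_sum => i; exact: hg_gser.
have K : van (h.+1 - J) x0 (dword w (fun y => \sum_i gser h c i y)).
  by apply: van_dword hG _; rewrite sw addnS (subnK (leqW Jh)).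
apply: van_ext K; apply: germeq_trans (dword_sum w (fun i => hg_gser HU h c i)) _.
apply: nearx_imp (nearx_all (fun i => dword_gser h c w i)) => y E.
rewrite exchange_big /=; apply: eq_bigr => i _; rewrite (E i) sw big_ord_recl.
have w0 : chainQ U w 0 i y = 0.
  by case: w sw {E} => [//|l w' _]; have := chainQ0 U l w' i => ->.
rewrite w0 mul0r add0r; apply: eq_bigr => k _; by rewrite mxE lift0 gshS.
Qed.

(** A left inverse of the diagonal block at x0 is, up to the inverse of a germ
    of square matrices close to the identity, one at the points nearby. So the
    J-th derivatives of the series are combinations of the lower ones, modulo
    terms of high order. *)
Lemma sysG_solve J : row_full (sysM J J) ->
  exists T : 'I_J -> V -> 'M[C]_d, (forall q, hgm x0 (T q)) /\
    forall h c, (J <= h)%N -> trace_ok h c -> forall i,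
      van (h.+1 - J) x0 (fun y => yser h c J i y -
        \sum_(q < J) \sum_b T q y i b * yser h c q b y).
Proof.
move=> /row_fullP [L HL].
have hS := hgm_mul (hgm_cst x0 L) (@hgm_sysG J J).
have S1 : L *m sysG J J x0 = 1%:M by rewrite -HL.
have [B hB HB] := inv_germ hS S1.
exists (fun q y => - (B y *m (L *m sysG J q y))); split.
  move=> q i j; rewrite (_ : (fun y => _) = fun y => - ((B y *m (L *m sysG J q y)) i j)).
    apply: hgN; apply: (hgm_mul hB); apply: hgm_mul; first exact: hgm_cst.
    exact: hgm_sysG.
  by apply/funext => y; rewrite mxE.
move=> h c Jh Hc i.
have K : van (h.+1 - J) x0 (fun y => \sum_a (B y *m L) i a *
    (\sum_(k < J.+1) \sum_b sysG J k y a b * yser h c k b y)).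
  apply: van_sum => a; apply: vanMl; last exact: sysG_van.
  by apply: (hgm_mul hB); exact: hgm_cst.
apply: van_ext K; apply: nearx_imp HB => y HBy.
pose Y k : 'cV[C]_d := \col_b yser h c k b y.
have -> : \sum_a (B y *m L) i a * (\sum_(k < J.+1) \sum_b sysG J k y a b * yser h c k b y)
   = ((B y *m L) *m (\sum_(k < J.+1) sysG J k y *m Y k)) i 0.
  rewrite mxE; apply: eq_bigr => a _; congr (_ * _); rewrite summxE.
  by apply: eq_bigr => k _; rewrite mxE; apply: eq_bigr => b _; rewrite [Y k b 0]mxE.
have EY : B y *m L *m (sysG J J y *m Y J) = Y J.
  by rewrite mulmxA -(mulmxA (B y)) HBy mul1mx.
rewrite big_ord_recr /= mulmxDr EY mxE [Y J i 0]mxE addrC.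
congr (_ + _); rewrite mulmx_sumr summxE -sumrN; apply: eq_bigr => q _.
rewrite -sumrN mulmxA mxE; apply: eq_bigr => b _.
by rewrite [Y q b 0]mxE -mulNr; congr (_ * _); rewrite [in RHS]mxE opprK mulmxA.
Qed.

End Tower.

(** * Convergence of formal solutions *)

Section Iterate.
Context {R : realType} {n : nat}.
Local Notation C := (Cplx R).
Local Notation V := 'rV[C]_n.

Lemma fdiff_pd_near (f : V -> C) x r l : holb x r f -> holb x r (pd l f).
Proof.
move=> H y yx; have [s s0 hs] : hg y (pd l f).
  apply: hg_pd; exists (r - nm (y - x)); first by rewrite subr_gt0.
  move=> z zy; apply: H; apply: le_lt_trans (nm_tri _ y _) _.
  by rewrite -ltrBrDr.
by apply: hs; rewrite subrr nm0.
Qed.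

#[local] Transparent pd.
Lemma pd_bound (f : V -> C) x r M l : 0 < r -> holb x r f ->
  (forall y, nm (y - x) < r -> nm (f y) <= M) ->
  nm (pd l f x) <= 64 / r * M * nm (delta_mx 0 l : V).
Proof. by move=> r0 H HM; exact: (cauchy1 r0 H HM). Qed.
#[local] Opaque pd.

Section Bound.
Variables (B : finType) (l : 'I_n) (x : V) (r M : R).
Variables (w : V -> C) (A : B -> B -> V -> C) (a : nat -> B -> V -> C).
Hypotheses (r0 : 0 < r) (M0 : 0 <= M).
Hypotheses (hw : holb x r w) (hA : forall b b', holb x r (A b b')).
Hypotheses (bw : forall y, nm (y - x) < r -> nm (w y) <= M).
Hypotheses (bA : forall b b' y, nm (y - x) < r -> nm (A b b' y) <= M).
Hypotheses (ha0 : forall b, holb x r (a 0%N b)) (ba0 : forall b y, nm (a 0%N b y) <= 1).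
Hypothesis aS : forall m b, a m.+1 b =
  fun y => w y * (pd l (a m b) y + \sum_b' a m b' y * A b' b y).

Local Notation D := (nm (delta_mx 0 l : V)).

Lemma iterate_holb m b : holb x r (a m b).
Proof.
elim: m b => [|m IH] b; first exact: ha0.
rewrite aS => y yx; apply: fdiffM; first exact: hw.
apply: fdiffD; first exact: fdiff_pd_near (IH b) y yx.
by apply: fdiff_sum => b'; apply: fdiffM; [exact: IH|exact: hA].
Qed.

(** Cauchy's inequality for a derivative costs a factor proportional to 1 /
    delta on a ball whose radius is smaller by delta; m steps shrink the radius
    by m * delta. *)
Lemma iterate_step (delta : R) m b y : 0 < delta -> m%:R * delta < r ->
  nm (y - x) < r - m%:R * delta ->
  nm (a m b y) <= (M * (64 / delta * D + #|B|%:R * M)) ^+ m.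
Proof.
move=> d0; set E := M * _.
have E0 : 0 <= E.
  by rewrite mulr_ge0 // addr_ge0 ?mulr_ge0 ?invr_ge0 ?nm_ge0 // ltW.
elim: m b y => [|m IH] b y mr yx; first by rewrite expr0.
have mS : m.+1%:R * delta = m%:R * delta + delta by rewrite -natr1 mulrDl mul1r.
have mr' : m%:R * delta < r by lra.
have m0 : 0 <= m%:R * delta by rewrite mulr_ge0 // ltW.
have yx' : nm (y - x) < r by lra.
rewrite aS nmM exprS {1}/E -mulrA.
apply: ler_pM; [exact: nm_ge0|exact: nm_ge0|exact: bw|].
rewrite mulrDl; apply: le_trans (nmD _ _) (lerD _ _).
  have hb : holb y delta (a m b) by apply: (holb_sub (iterate_holb m b)); lra.
  have K z : nm (z - y) < delta -> nm (a m b z) <= E ^+ m.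
    by move=> zy; apply: IH => //; have := nm_tri z y x; lra.
  by rewrite mulrAC; exact: pd_bound.
apply: le_trans (nm_sum _ _ _) _.
rewrite (_ : _ * _ = \sum_(b' : B) E ^+ m * M); last first.
  by rewrite sumr_const -[RHS]mulr_natl -mulrA (mulrC M).
apply: ler_sum => b' _; rewrite nmM.
apply: ler_pM; [exact: nm_ge0|exact: nm_ge0| |exact: bA].
by apply: IH => //; lra.
Qed.

(** The choice delta = r / (m + 1) gives a bound of the order of m ^ m, that is,
    m! up to a geometric factor by [pow_fact_bound]. *)
Lemma iterate_bound : exists2 L : R, 0 <= L &
  forall m b, nm (a m b x) <= L ^+ m * m.+1%:R ^+ m.
Proof.
pose L := M * (64 / r * D + #|B|%:R * M).
have h0 : 0 <= 64 / r * D by rewrite !mulr_ge0 ?invr_ge0 ?nm_ge0 // ltW.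
have h1 : 0 <= #|B|%:R * M by rewrite mulr_ge0.
exists L => [|m b]; first by rewrite mulr_ge0 // addr_ge0.
have m1 : 0 < m.+1%:R :> R by rewrite ltr0n.
have d0 : 0 < r / m.+1%:R by rewrite divr_gt0.
have mr : m%:R * (r / m.+1%:R) < r.
  by rewrite mulrA ltr_pdivrMr // mulrC ltr_pM2l // ltr_nat.
apply: le_trans (iterate_step b d0 mr _) _; first by rewrite subrr nm0 subr_gt0.
rewrite -exprMn; apply: lerXn2r; rewrite ?nnegrE.
- by rewrite mulr_ge0 // addr_ge0 // !mulr_ge0 ?invr_ge0 ?nm_ge0 // ltW.
- by apply: mulr_ge0 => //; apply: mulr_ge0 => //; exact: addr_ge0.
have -> : L * m.+1%:R = M * (64 / r * D * m.+1%:R + #|B|%:R * M * m.+1%:R).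
  by rewrite /L -mulrA mulrDl.
rewrite ler_wpM2l // lerD //.
  by rewrite invf_div !mulrA le_eqVlt; apply/orP; left; apply/eqP; ring.
by rewrite ler_peMr // ler1n.
Qed.

End Bound.
End Iterate.

Lemma half_small {R : realType} (A e : R) : 0 < e ->
  exists N0, forall N, (N0 <= N)%N -> A * (1 / 2) ^+ N <= e.
Proof.
move=> e0; have c : (fun N => A * (1 / 2) ^+ N : R^o) @ \oo --> (0 : R^o).
  rewrite -(mulr0 A); apply: cvgM; first exact: cvg_cst.
  by apply: cvg_expr; rewrite ger0_norm; lra.
move/cvgrPdist_le : c => /(_ _ e0) [N _ HN]; exists N => k /HN.
by rewrite sub0r normrN; apply: le_trans; exact: ler_norm.
Qed.

(** Induction on m, using (1 + 1 / (m + 1)) ^ (m + 1) <= e. *)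
Lemma pow_fact_bound {R : realType} m : m.+1%:R ^+ m <= expR 1 ^+ m * m`!%:R :> R.
Proof.
elim: m => [|m IH]; first by rewrite !expr0 mul1r.
have m1 : 0 < m.+1%:R :> R by rewrite ltr0n.
have e1 : (m.+2%:R / m.+1%:R) ^+ m.+1 <= expR 1 :> R.
  have -> : expR 1 = expR (m.+1%:R^-1 : R) ^+ m.+1 by rewrite -expRM_natr mulVf ?gt_eqF.
  apply: lerXn2r; rewrite ?nnegrE ?expR_ge0 ?divr_ge0 //.
  apply: le_trans (expR_ge1Dx _); rewrite le_eqVlt; apply/orP; left; apply/eqP.
  by rewrite -natr1 mulrDl mulfV ?gt_eqF // mul1r.
have -> : m.+2%:R ^+ m.+1 = (m.+2%:R / m.+1%:R) ^+ m.+1 * (m.+1%:R * m.+1%:R ^+ m) :> R.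
  by rewrite -exprS -exprMn divfK ?gt_eqF.
rewrite [expR 1 ^+ _]exprS factS natrM -mulrA ler_pM ?exprn_ge0 ?divr_ge0 ?mulr_ge0 ?exprn_ge0 //.
by rewrite mulrCA ler_pM2l.
Qed.

Section Converge.
Context {R : realType} {n d : nat}.
Local Notation C := (Cplx R).
Local Notation V := 'rV[C]_n.
Variables (x0 : V) (U : 'I_d -> V -> C).
Hypothesis HU : forall i, hg x0 (U i).
Implicit Types c : nat -> 'cV[C]_d.
Local Notation fser := (fser x0 U).
Local Notation dpow := (dpow x0 U).

Lemma fdiff_dpow m i y : fdiff (U i) y -> fdiff (dpow m i) y.
Proof.
move=> H; elim: m => [|m IH]; first by rewrite dpow0; exact: fdiff_cst.
rewrite (_ : dpow m.+1 i = fun z => dpow m i z * ((U i z - U i x0) * (m.+1%:R)^-1)).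
  apply: fdiffM IH _; apply: fdiffM; last exact: fdiff_cst.
  by apply: fdiffB H _; exact: fdiff_cst.
by apply/funext => z; rewrite dpowS.
Qed.

(** With coefficients bounded by Y K ^ m m! the series converges geometrically
    where K |U_i - U_i(x0)| <= 1/2, so its sum is holomorphic by [weierstrass]
    and differs from the partial sums by the expected order. *)
Lemma fser_cvg c i (Y K : R) : 0 <= Y -> 0 < K ->
  (forall m, nm (c m i 0) <= Y * K ^+ m * m`!%:R) ->
  exists2 g, hg x0 g & forall h, van h.+1 x0 (fun y => g y - fser h c i y).
Proof.
move=> Y0 K0 Hc.
(* On a ball where K |u| <= 1/2 the series is dominated by a geometric one. *)
pose u y := U i y - U i x0.
have hu : hg x0 u by apply: hgB => //; exact: hg_cst.
have [L L0 vL] : van 1 x0 u.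
  apply: van_ext (van_dpow HU 1 i); exists 1 => // y _.
  by rewrite /dpow expr1 divr1.
have [s s0 Hs] : nearx x0 (fun y => (fdiff (U i) y /\ nm (u y) <= L * nm (y - x0) ^+ 1)
   /\ K * nm (u y) <= 1 / 2).
  apply: nearx_and; first exact: nearx_and (HU i) vL.
  have e0 : 0 < 1 / 2 / K :> R by rewrite !divr_gt0.
  have [t t0 Ht] := fdiff_cont (nearx_at hu) e0.
  exists t => // y /Ht; rewrite /u subrr subr0 => /ltW.
  by rewrite ler_pdivlMr // mulrC.
have [G HG] : {G : V -> C & forall y, nm (y - x0) < s -> forall k,
    nm (fser k c i y - G y) <= 2 * Y * (K * nm (u y)) ^+ k.+1}.
  apply: (@choice _ _ (fun y l => nm (y - x0) < s -> forall k,
    nm (fser k c i y - l) <= 2 * Y * (K * nm (u y)) ^+ k.+1)) => y.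
  have [ys|ys] := boolP (nm (y - x0) < s); last by exists 0.
  have [_ q1] := Hs y ys; set q := K * nm (u y) in q1 *.
  have q0 : 0 <= q by rewrite mulr_ge0 ?nm_ge0 // ltW.
  have [||k|l Hl] := @nm_geometric _ (fun k => fser k c i y) (Y * q) q.
  - by rewrite mulr_ge0.
  - by rewrite q0 /=; lra.
  - have -> : fser k.+1 c i y - fser k c i y = dpow k.+1 i y * c k.+1 i 0.
      have -> : fser k.+1 c i y = fser k c i y + dpow k.+1 i y * c k.+1 i 0.
        exact: big_ord_recr.
      by rewrite addrAC subrr add0r.
    rewrite nmM /dpow nmf nmX nm_nat -/(u y).
    have f0 : 0 < k.+1`!%:R :> R by rewrite ltr0n fact_gt0.
    have -> : Y * q * q ^+ k = Y * K ^+ k.+1 * nm (u y) ^+ k.+1.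
      by rewrite -mulrA -exprS /q exprMn mulrA.
    rewrite mulrAC ler_pdivrMr //.
    have := ler_wpM2l (exprn_ge0 k.+1 (nm_ge0 (u y))) (Hc k.+1).
    move/le_trans; apply; rewrite le_eqVlt; apply/orP; left; apply/eqP; ring.
  exists l => _ k; apply: le_trans (Hl k) _; rewrite exprS mulrA.
  apply: ler_wpM2r; first exact: exprn_ge0.
  rewrite ler_pdivrMr; last by lra.
  rewrite -(mulrA 2); have := mulr_ge0 Y0 q0; move: (Y * q) => z z0.
  by have : z * (2 * q) <= z * 1; [apply: ler_wpM2l => //; lra|lra].
exists G.
  exists s => // y ys; set r := s - nm (y - x0).
  have r0 : 0 < r by rewrite subr_gt0.
  have sub z : nm (z - y) < r -> nm (z - x0) < s.
    by rewrite /r => zy; have := nm_tri z y x0; lra.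
  have qb z k : nm (z - x0) < s -> (K * nm (u z)) ^+ k.+1 <= (1 / 2) ^+ k.+1.
    move=> /Hs [_ q1]; apply: lerXn2r => //; rewrite nnegrE.
      by rewrite mulr_ge0 ?nm_ge0 // ltW.
    by lra.
  have Gb z k : nm (z - x0) < s -> nm (fser k c i z - G z) <= 2 * Y * (1 / 2) ^+ k.+1.
    move=> zs; apply: le_trans (HG z zs k) _; apply: ler_wpM2l; last exact: qb.
    by rewrite mulr_ge0.
  have half1 k : (1 / 2) ^+ k.+1 <= 1 / 2 :> R.
    by rewrite exprS ler_piMr //; apply: exprn_ile1; lra.
  have Gb' z k : nm (z - x0) < s -> nm (fser k c i z - G z) <= Y.
    move=> zs; apply: le_trans (Gb z k zs) _.
    have Y2 : 0 <= 2 * Y by rewrite mulr_ge0.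
    by have := ler_wpM2l Y2 (half1 k); lra.
  have fb N z : nm (z - y) < r -> nm (fser N c i z) <= 2 * Y + nm (c 0%N i 0).
    move=> /sub zs; have := Gb' z 0%N zs; have := Gb' z N zs.
    have -> : fser 0 c i z = c 0%N i 0.
      by rewrite /fser big_ord1 dpow0 mul1r.
    have e : fser N c i z = (fser N c i z - G z) - (c 0%N i 0 - G z) + c 0%N i 0 by ring.
    move=> h1 h2; rewrite e; apply: le_trans (nmD _ _) _.
    by rewrite lerD2r; apply: le_trans (nmB _ _) _; lra.
  have hb N : holb y r (fser N c i).
    move=> z /sub zs; apply: fdiff_sum => m; apply: fdiffM; last exact: fdiff_cst.
    by apply: fdiff_dpow; case: (Hs z zs) => -[].
  have [|Gd _] := weierstrass (f := G) r0 hb fb; last exact: Gd.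
  move=> e e0.
  have [N0 HN0] : exists N0, forall N, (N0 <= N)%N -> 2 * Y * (1 / 2) ^+ N.+1 <= e.
    have [N0 HN0] := half_small (2 * Y) e0.
    exists N0 => N NN; apply: HN0; exact: leqW.
  by exists N0 => N NN z /sub zs; apply: le_trans (Gb z N zs) (HN0 N NN).
move=> h; exists (2 * Y * (K * L) ^+ h.+1).
  by rewrite mulr_ge0 ?exprn_ge0 // mulr_ge0 // ltW.
exists s => // y ys; rewrite nm_distC; apply: le_trans (HG y ys h) _.
rewrite -[leRHS]mulrA -exprMn; apply: ler_wpM2l; first by rewrite mulr_ge0.
have [[_ Lu] _] := Hs y ys; rewrite expr1 in Lu.
apply: lerXn2r; rewrite ?nnegrE.
- by rewrite mulr_ge0 ?nm_ge0 // ltW.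
- by rewrite !mulr_ge0 ?nm_ge0 // ltW.
by rewrite -mulrA ler_wpM2l // ltW.
Qed.

Section Coef.
Variables (J : nat) (c : nat -> 'cV[C]_d).
Hypotheses (J0 : (0 < J)%N) (Jfull : row_full (sysM x0 U J J)).
Hypothesis Hc : forall h, trace_ok x0 U h c.
Hypothesis Hreg : forall i, exists l, pd l (U i) x0 != 0.

Local Notation B := ('I_J * 'I_d)%type.
Local Notation yser := (yser x0 U).

(** The matrix of the differential system satisfied by the functions [yser], q <
    J, in the direction l: the derivative of the q-th one is the next one times
    that of U_i, and the J-th one is expressed by [sysG_solve]. *)
Definition odeA (T : 'I_J -> V -> 'M[C]_d) (l : 'I_n) (b b' : B) : V -> C :=
  fun y => (if (b.1.+1 < J)%N then ((b'.1 == b.1.+1 :> nat) && (b'.2 == b.2))%:R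
    else T b'.1 y b.2 b'.2) * pd l (U b.2) y.

Lemma hg_odeA T l b b' : (forall q, hgm x0 (T q)) -> hg x0 (odeA T l b b').
Proof.
move=> hT; apply: hgM; last exact: hg_pd.
by case: (b.1.+1 < J)%N; [exact: hg_cst|exact: hT].
Qed.

Lemma pd_ode T : (forall q, hgm x0 (T q)) ->
  (forall h c, (J <= h)%N -> trace_ok x0 U h c -> forall i,
      van (h.+1 - J) x0 (fun y => yser h c J i y -
        \sum_(q < J) \sum_b T q y i b * yser h c q b y)) ->
  forall h l (b : B), (J <= h)%N -> van (h.+1 - J) x0 (fun y =>
    pd l (yser h c b.1 b.2) y - \sum_b' odeA T l b b' y * yser h c b'.1 b'.2 y).
Proof.
move=> hT HT h l [q i] Jh /=.
case: (ltnP q.+1 J) => qJ.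
  apply: van_ext (van0 _ _); apply: nearx_imp (pd_yser HU h c q i l) => y ->.
  rewrite (bigD1 (Ordinal qJ, i)) //= /odeA /= qJ !eqxx mul1r mulrC big1 ?addr0 ?subrr //.
  move=> [q' i'] /= ne; suff -> : (q' == q.+1 :> nat) && (i' == i) = false by rewrite !mul0r.
  apply: contraNF ne => /andP [/eqP e /eqP ->]; apply/eqP; congr (_, _).
  exact: val_inj.
have eJ : q.+1 = J by apply/eqP; rewrite eqn_leq qJ andbT.
have K := vanMr (HT h c Jh (Hc h) i) (hg_pd l (HU i)).
apply: van_ext K; apply: nearx_imp (pd_yser HU h c q i l) => y ->.
rewrite eJ mulrBl; congr (_ - _); rewrite pair_bigA /= mulr_suml.
by apply: eq_bigr => -[q' i'] _; rewrite /odeA /= eJ ltnn mulrAC.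
Qed.

(** The m-th derivative with respect to U_i0 of the series of index i0, as a
    combination of the functions [yser] with q < J; differentiation with respect
    to U_i0 is pd l divided by pd l (U i0). *)
Fixpoint odeI (T : 'I_J -> V -> 'M[C]_d) (l : 'I_n) (i0 : 'I_d) (m : nat) (b : B) : V -> C :=
  if m is m'.+1 then fun y => (pd l (U i0) y)^-1 *
    (pd l (odeI T l i0 m' b) y + \sum_b' odeI T l i0 m' b' y * odeA T l b' b y)
  else fun=> ((b.1 == 0%N :> nat) && (b.2 == i0))%:R.

Lemma hg_odeI T l i0 m b : (forall q, hgm x0 (T q)) -> pd l (U i0) x0 != 0 ->
  hg x0 (odeI T l i0 m b).
Proof.
move=> hT w0; elim: m b => [|m IH] b /=; first exact: hg_cst.
apply: hgM; first by apply: hgV => //; exact: hg_pd.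
apply: hgD; first exact: hg_pd.
by apply: hg_sum => b'; apply: hgM => //; exact: hg_odeA.
Qed.

(** At x0 this expresses c_m through c_0, ..., c_{J-1}; each differentiation
    costs one order of vanishing, so a truncation of order at least m + J is
    needed. *)
Lemma odeI_van T l i0 : (forall q, hgm x0 (T q)) -> pd l (U i0) x0 != 0 ->
  (forall h c, (J <= h)%N -> trace_ok x0 U h c -> forall i,
      van (h.+1 - J) x0 (fun y => yser h c J i y -
        \sum_(q < J) \sum_b T q y i b * yser h c q b y)) ->
  forall m h, (J <= h)%N -> van (h.+1 - J - m) x0 (fun y => yser h c m i0 y -
    \sum_b odeI T l i0 m b y * yser h c b.1 b.2 y).
Proof.
move=> hT w0 HT m h Jh; have hI m' b := hg_odeI m' b hT w0.
elim: m => [|m IH].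
  apply: van_ext (van0 _ _); exists 1 => // y _.
  rewrite (bigD1 (Ordinal J0, i0)) //= !eqxx mul1r big1 ?addr0 ?subrr // => -[q' i'] ne.
  suff -> : (q' == 0%N :> nat) && (i' == i0) = false by rewrite mul0r.
  apply: contraNF ne => /andP [/eqP e /eqP /= ->]; apply/eqP; congr (_, _).
  exact: val_inj.
have hf : hg x0 (fun y => yser h c m i0 y - \sum_b odeI T l i0 m b y * yser h c b.1 b.2 y).
  apply: hgB; first exact: hg_yser.
  by apply: hg_sum => b; apply: hgM; [exact: hI|exact: hg_yser].
case: (posnP (h.+1 - J - m)) => [z|].
  rewrite subnS z; apply: hg_van0; apply: hgB; first exact: hg_yser.
  by apply: hg_sum => b; apply: hgM; [exact: hI|exact: hg_yser].
case E : (h.+1 - J - m)%N => [//|q] _; rewrite subnS E /=; rewrite E in IH.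
have hw : hg x0 (fun y => (pd l (U i0) y)^-1) by apply: hgV w0; exact: hg_pd.
have K1 := vanMl hw (pd_van l hf IH).
have K2 : van q x0 (fun y => (pd l (U i0) y)^-1 * \sum_b odeI T l i0 m b y *
    (pd l (yser h c b.1 b.2) y - \sum_b' odeA T l b b' y * yser h c b'.1 b'.2 y)).
  apply: vanMl hw _; apply: van_sum => b; apply: vanMl; first exact: hI.
  by apply: van_le (pd_ode hT HT l b Jh); rewrite -ltnS -E; exact: leqW (leq_subr _ _).
apply: van_ext (vanD K1 K2).
have N1 := hg_neq0 (hg_pd l (HU i0)) w0.
have N2 := hg_near (hg_yser HU h c m i0).
have N3 := nearx_all (fun b : B => hg_near (hI m b)).
have N4 := nearx_all (fun b : B => hg_near (hg_yser HU h c b.1 b.2)).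
have N5 := pd_yser HU h c m i0 l.
apply: nearx_imp (nearx_and (nearx_and N1 N2) (nearx_and (nearx_and N3 N4) N5)).
move=> y [[w1 n2] [[n3 n4] n5]].
have hs : hg y (fun z => \sum_b odeI T l i0 m b z * yser h c b.1 b.2 z).
  by apply: hg_sum => b; apply: hgM; [exact: n3|exact: n4].
rewrite (pdB _ n2 hs) n5.
have -> : pd l (fun z => \sum_b odeI T l i0 m b z * yser h c b.1 b.2 z) y =
   \sum_b (odeI T l i0 m b y * pd l (yser h c b.1 b.2) y
     + pd l (odeI T l i0 m b) y * yser h c b.1 b.2 y).
  rewrite pd_sum => [|b]; last by apply: hgM; [exact: n3|exact: n4].
  apply: eq_bigr => b _; rewrite (pdM _ (n3 b) (n4 b)); congr (_ + _).
  exact: mulrC.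
have -> : \sum_b odeI T l i0 m.+1 b y * yser h c b.1 b.2 y = (pd l (U i0) y)^-1 *
    (\sum_b pd l (odeI T l i0 m b) y * yser h c b.1 b.2 y +
     \sum_b odeI T l i0 m b y * \sum_b' odeA T l b b' y * yser h c b'.1 b'.2 y).
  transitivity (\sum_b ((pd l (U i0) y)^-1 * (pd l (odeI T l i0 m b) y * yser h c b.1 b.2 y)
     + (pd l (U i0) y)^-1 * \sum_b' odeI T l i0 m b' y * odeA T l b' b y * yser h c b.1 b.2 y)).
    by apply: eq_bigr => b _; rewrite [odeI _ _ _ _.+1 _ _]/= -mulrA mulrDl mulrDr mulr_suml.
  rewrite big_split /= mulrDr !mulr_sumr; congr (_ + _).
  rewrite -[LHS]mulr_sumr -[RHS]mulr_sumr; congr (_ * _).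
  rewrite exchange_big /=; apply: eq_bigr => b _.
  by rewrite mulr_sumr; apply: eq_bigr => b' _; rewrite mulrA.
rewrite big_split /=.
have -> : \sum_b odeI T l i0 m b y * (pd l (yser h c b.1 b.2) y -
     \sum_b' odeA T l b b' y * yser h c b'.1 b'.2 y) =
   \sum_b odeI T l i0 m b y * pd l (yser h c b.1 b.2) y -
   \sum_b odeI T l i0 m b y * \sum_b' odeA T l b b' y * yser h c b'.1 b'.2 y.
  by rewrite -sumrB; apply: eq_bigr => b _; rewrite mulrBr.
move: w1; move: (pd l (U i0) y) (yser h c m.+1 i0 y) => w Y w1.
move: (\sum_b _) (\sum_b _) (\sum_b _) => s1 s2 s3.
by field.
Qed.

Lemma hg_ball_all (I : finType) (F : I -> V -> C) : (forall i, hg x0 (F i)) ->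
  exists r M, [/\ 0 < r, 0 <= M, forall i, holb x0 r (F i) &
    forall i y, nm (y - x0) < r -> nm (F i y) <= M].
Proof.
move=> hF.
have [G HG] : {G : I -> R & forall i, 0 <= G i /\
    nearx x0 (fun y => nm (F i y) <= G i)}.
  apply: (@choice _ _ (fun i M => 0 <= M /\ nearx x0 (fun y => nm (F i y) <= M))) => i.
  by have [r [M [r0 M0 _ HM]]] := hg_ball (hF i); exists M; split => //; exists r.
have [r r0 Hr] := nearx_and (nearx_all hF) (nearx_all (fun i => (HG i).2)).
exists r, (\sum_i G i); split => //.
- by apply: sumr_ge0 => i _; case: (HG i).
- by move=> i y /Hr [].
move=> i y /Hr [_ /(_ i)] /le_trans; apply; rewrite (bigD1 i) //= lerDl.
by apply: sumr_ge0 => j _; case: (HG j).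
Qed.

(** By [odeI_van] the coefficient c_m is a combination of the first J ones with
    multipliers odeI at x0, which [iterate_bound] and [pow_fact_bound] control. *)
Lemma coef_bound i0 : exists Y K, [/\ 0 <= Y, 0 < K &
  forall m, nm (c m i0 0) <= Y * K ^+ m * m`!%:R].
Proof.
have [l w0] := Hreg i0.
have [T [hT HT]] := sysG_solve HU Jfull.
have hw : hg x0 (fun y => (pd l (U i0) y)^-1) by apply: hgV w0; exact: hg_pd.
pose F (o : option (B * B)) := if o is Some bb then odeA T l bb.1 bb.2
   else (fun y => (pd l (U i0) y)^-1).
have hF o : hg x0 (F o) by case: o => [bb|] //=; exact: hg_odeA.
have [r [M [r0 M0 HF bF]]] := hg_ball_all hF.
have [|||L L0 HL] := @iterate_bound _ _ B l x0 r M (F None) (fun b b' => F (Some (b, b')))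
  (odeI T l i0) r0 M0 (HF None) (fun b b' => HF (Some (b, b'))) (bF None)
  (fun b b' => bF (Some (b, b'))).
- by move=> b y _; exact: fdiff_cst.
- by move=> b y; rewrite nm_nat; case: (_ && _); rewrite ?lexx ?ler01.
- by [].
pose Y := \sum_(b : B) nm (c b.1 b.2 0).
exists Y, (L * expR 1 + 1); split.
- by apply: sumr_ge0 => b _; exact: nm_ge0.
- by rewrite ltr_wpDl // mulr_ge0 // expR_ge0.
move=> m.
have Jm : (J <= m + J)%N by rewrite leq_addl.
have := odeI_van hT w0 HT m Jm; rewrite -addSn addnK subSnn => /van_at.
rewrite yser_x0 ?leq_addr // => /eqP; rewrite subr_eq0 => /eqP ->.
apply: le_trans (nm_sum _ _ _) _; rewrite /Y -mulrA mulr_suml; apply: ler_sum => b _.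
rewrite yser_x0; last by rewrite (leq_trans (ltnW (ltn_ord b.1))).
rewrite nmM mulrC; apply: ler_wpM2l; first exact: nm_ge0.
apply: le_trans (HL m b) _.
apply: le_trans (ler_wpM2l (exprn_ge0 m L0) (pow_fact_bound m)) _.
rewrite mulrA -exprMn; apply: ler_wpM2r; first exact: ler0n.
apply: lerXn2r; rewrite ?nnegrE; first by rewrite mulr_ge0 ?expR_ge0.
- by rewrite addr_ge0 // mulr_ge0 // expR_ge0.
by rewrite lerDl.
Qed.

Lemma formal_converges : exists g : 'I_d -> V -> C, (forall i, hg x0 (g i)) /\
  forall i h, van h.+1 x0 (fun y => g i y - fser h c i y).
Proof.
have [g Hg] : {g : 'I_d -> V -> C & forall i, hg x0 (g i) /\
    forall h, van h.+1 x0 (fun y => g i y - fser h c i y)}.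
  apply: (@choice _ _ (fun i (g : V -> C) => hg x0 g /\
    forall h, van h.+1 x0 (fun y => g y - fser h c i y))) => i.
  have [Y [K [Y0 K0 H]]] := coef_bound i.
  by have [g hg0 Hg] := fser_cvg Y0 K0 H; exists g.
by exists g; split=> i; have [] := Hg i.
Qed.

End Coef.
End Converge.

(** * The fibre of R_h in terms of coefficients *)

Section Fibre.
Context {R : realType} {n d : nat}.
Local Notation C := (Cplx R).
Local Notation V := 'rV[C]_n.
Variables (x0 : V) (U : 'I_d -> V -> C).
Hypothesis HU : forall i, hg x0 (U i).
Hypothesis Hreg : forall i, exists l, pd l (U i) x0 != 0.
Hypothesis Hspan : row_full (\matrix_(i < d, l < n) pd l (U i) x0).
Implicit Types (c : nat -> 'cV[C]_d) (g : 'I_d -> V -> C).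

Local Notation fser := (fser x0 U).
Local Notation trace_ok := (trace_ok x0 U).
Local Notation sysM := (sysM x0 U).

(** The family of forms g_i dU_i. *)
Definition fsec g : forms R n d := fun i y => \row_l (g i y * pd l (U i) y).

Lemma fsecE g i b l : (fun y => fsec g i y b l) = fun y => g i y * pd l (U i) y.
Proof. by apply/funext => y; rewrite mxE. Qed.

Lemma hgm_fsec g : (forall i, hg x0 (g i)) -> forall i, hgm x0 (fsec g i).
Proof.
move=> hg0 i b l; rewrite fsecE; apply: hgM; [exact: hg0|exact: hg_pd].
Qed.

(** Some derivative of U_i is invertible at x0, so forms g dU_i and their
    factors g vanish to the same order. *)
Lemma van_div q i f : hg x0 f -> (forall l, van q x0 (fun y => f y * pd l (U i) y)) ->
  van q x0 f.
Proof.
move=> hf H; have [l w0] := Hreg i.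
have hw : hg x0 (fun y => (pd l (U i) y)^-1) by apply: hgV w0; exact: hg_pd.
apply: van_ext (vanMr (H l) hw).
apply: nearx_imp (hg_neq0 (hg_pd l (HU i)) w0) => y w1; exact: mulfK.
Qed.

Lemma jet_fsecP h g g' : (forall i, hg x0 (g i)) -> (forall i, hg x0 (g' i)) ->
  jet h (fsec g) x0 = jet h (fsec g') x0 <->
  forall i, van h.+1 x0 (fun y => g i y - g' i y).
Proof.
move=> hg1 hg2; apply: iff_trans (jet_eqP h (hgm_fsec hg1) (hgm_fsec hg2)) _.
have E i b l : (fun y => fsec g i y b l - fsec g' i y b l) =
    fun y => (g i y - g' i y) * pd l (U i) y.
  by apply/funext => y; rewrite !mxE mulrBl.
split=> H i.
  apply: (van_div (i := i)); first exact: hgB.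
  by move=> l; have := H i 0 l; rewrite E.
by move=> b l; rewrite E; apply: vanMr (H i) _; exact: hg_pd.
Qed.

Lemma dform_fsec g i l m : (forall i, hg x0 (g i)) ->
  germeq x0 (fun y => dform (fsec g) i y l m)
    (fun y => pd l (g i) y * pd m (U i) y - pd m (g i) y * pd l (U i) y).
Proof.
move=> hgg; apply: germeq_trans (dform_germ l m (hgm_fsec hgg i)) _.
have N := nearx_and (nearx_and (hg_near (hgg i)) (pd_comm l m (HU i)))
  (nearx_and (hg_near (hg_pd l (HU i))) (hg_near (hg_pd m (HU i)))).
apply: nearx_imp N => y [[h1 e] [h2 h3]].
rewrite !fsecE (pdM _ h1 h3) (pdM _ h1 h2) e.
move: (g i y) (pd m (pd l (U i)) y) (pd m (U i) y) (pd l (U i) y) (pd l (g i) y) (pd m (g i) y).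
by move=> a1 a2 a3 a4 a5 a6; ring.
Qed.

(** A function of U_i times dU_i is closed. *)
Lemma dform_fser h c i l m : germeq x0 (fun y => dform (fsec (fser h c)) i y l m) (fun=> 0).
Proof.
apply: germeq_trans (dform_fsec i l m (fun i => hg_fser HU h c i)) _.
have N := nearx_and (pd_yser HU h c 0 i l) (pd_yser HU h c 0 i m).
apply: nearx_imp N => y [h1 h2]; rewrite -yser0 h1 h2.
move: (yser x0 U h c 1 i y) (pd m (U i) y) (pd l (U i) y) => a1 a2 a3; ring.
Qed.

Lemma van_dform h g g' : (forall i, hg x0 (g i)) -> (forall i, hg x0 (g' i)) ->
  (forall i, van h.+1 x0 (fun y => g i y - g' i y)) ->
  (forall i l m, van h x0 (fun y => dform (fsec g') i y l m)) ->
  forall i l m, van h x0 (fun y => dform (fsec g) i y l m).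
Proof.
move=> h1 h2 H K i l m.
have hb : hg x0 (fun y => g i y - g' i y) by exact: hgB.
have D k : van h x0 (fun y => pd k (g i) y - pd k (g' i) y).
  apply: van_ext (pd_van k hb (H i)).
  apply: nearx_imp (nearx_and (hg_near (h1 i)) (hg_near (h2 i))) => y [a b].
  exact: pdB.
have K1 := van_ext (dform_fsec i l m h2) (K i l m).
apply: van_ext (germeq_sym (dform_fsec i l m h1)) _.
have P := vanD (vanB (vanMr (D l) (hg_pd m (HU i))) (vanMr (D m) (hg_pd l (HU i)))) K1.
apply: van_ext P; exists 1 => // y _.
move: (pd l (g i) y) (pd m (g i) y) (pd l (g' i) y) (pd m (g' i) y) (pd m (U i) y) (pd l (U i) y).
by move=> a1 a2 a3 a4 a5 a6; ring.
Qed.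

(** The factors of the germs of sections of A. *)
Definition lsec g := (forall i, hg x0 (g i)) /\
  forall l, germeq x0 (fun y => \sum_i g i y * pd l (U i) y) (fun=> 0).

Lemma pd_subM (f1 f2 f3 : V -> C) l y a b : hg y f1 -> hg y f2 -> hg y f3 ->
  pd l f1 y = a -> pd l f3 y = b ->
  pd l (fun z => f1 z - f2 z * f3 z) y = a - (f2 y * b + f3 y * pd l f2 y).
Proof. by move=> h1 h2 h3 <- <-; rewrite (pdB _ h1 (hgM h2 h3)) (pdM _ h2 h3). Qed.

(** If dg and dU_i are proportional to order h, then g is a function of U_i to
    order h + 1. The quotient g' of dg by dU_i satisfies the same condition to
    order h - 1; by induction it is a function of U_i, and so is g, by
    integration. *)
Lemma integrate h (g : V -> C) i : hg x0 g ->
  (forall l m, van h x0 (fun y => pd l g y * pd m (U i) y - pd m g y * pd l (U i) y)) ->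
  exists e : nat -> C, van h.+1 x0 (fun y => g y - \sum_(m < h.+1) dpow x0 U m i y * e m).
Proof.
elim: h g => [|h IH] g hgg H.
  exists (fun=> g x0); apply: van_ext (van_pd (q := 0) (f := fun y => g y - g x0) _ _ _).
  - by exists 1 => // y _; rewrite big_ord1 dpow0 mul1r.
  - by apply: hgB => //; exact: hg_cst.
  - exact: subrr.
  - by move=> l; apply: hg_van0; apply: hg_pd; apply: hgB => //; exact: hg_cst.
have [l0 w0] := Hreg i.
have hl l := hg_pd l (HU i).
have hw : hg x0 (fun y => (pd l0 (U i) y)^-1) by exact: hgV.
(* The derivative of g with respect to U_i. *)
pose g' y := pd l0 g y * (pd l0 (U i) y)^-1.
have hg' : hg x0 g' by apply: hgM => //; exact: hg_pd.
have E1 l : van h.+1 x0 (fun y => pd l g y - g' y * pd l (U i) y).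
  apply: van_ext (vanMr (H l l0) hw).
  apply: nearx_imp (hg_neq0 (hl l0) w0) => y; rewrite /g'.
  move: (pd l g y) (pd l0 g y) (pd l0 (U i) y) (pd l (U i) y) => a1 a2 a3 a4 a30.
  by field.
have alg (a1 a2 a3 a4 a5 a6 a7 : C) :
  a1 - (a2 * a3 + a6 * a5) - (a1 - (a2 * a3 + a7 * a4)) = a4 * a7 - a5 * a6 by ring.
have E2 l m : van h x0 (fun y => pd l g' y * pd m (U i) y - pd m g' y * pd l (U i) y).
  have P1 := pd_van l (hgB (hg_pd m hgg) (hgM hg' (hl m))) (E1 m).
  have P2 := pd_van m (hgB (hg_pd l hgg) (hgM hg' (hl l))) (E1 l).
  apply: van_ext (vanB P2 P1).
  have N := nearx_and (nearx_and (nearx_and (hg_near hg') (pd_comm l m hgg))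
     (nearx_and (hg_near (hg_pd l hgg)) (hg_near (hg_pd m hgg))))
    (nearx_and (nearx_and (hg_near (hl l)) (hg_near (hl m))) (pd_comm l m (HU i))).
  apply: nearx_imp N => y [[[n1 n2] [n3 n4]] [[n5 n6] n7]].
  have e1 := pd_subM n3 n1 n5 (erefl (pd m (pd l g) y)) (erefl (pd m (pd l (U i)) y)).
  have e2 := pd_subM n4 n1 n6 n2 n7.
  apply: etrans (congr2 (fun u v => u - v) e1 e2) _.
  exact: alg.
have [e He] := IH g' hg' E2.
exists (fun m => if m is m'.+1 then e m' else g x0).
pose S y := \sum_(m < h.+1) dpow x0 U m.+1 i y * e m.
have hS : hg x0 S by apply: hg_sum => m; apply: hgM; [exact: hg_dpow|exact: hg_cst].
have ES : (fun y => g y - \sum_(m < h.+2) dpow x0 U m i y *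
    (if (m : nat) is m'.+1 then e m' else g x0)) = fun y => g y - g x0 - S y.
  apply/funext => y; rewrite big_ord_recl dpow0 mul1r /S; move: (g y) => gy.
  by rewrite -addrA -opprD; congr (_ - (_ + _)).
rewrite ES; have hgc : hg x0 (fun y => g y - g x0) by apply: hgB => //; exact: hg_cst.
apply: van_pd; first exact: hgB.
  by rewrite subrr sub0r /S big1 ?oppr0 // => m _; rewrite dpow_x0 mul0r.
move=> l; apply: van_ext (vanD (E1 l) (vanMr He (hl l))).
have N := nearx_and (nearx_and (hg_near hgg) (hg_near hS))
  (nearx_and (nearx_all (fun m : 'I_h.+1 => hg_near (hg_dpow HU m.+1 i)))
             (nearx_all (fun m : 'I_h.+1 => pd_dpow HU m i l))).
apply: nearx_imp N => y [[n1 n2] [n3 n4]].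
rewrite (pdB _ (hgB n1 (hg_cst _ _)) n2) (pdB _ n1 (hg_cst _ _)) pd_cst subr0.
have -> : pd l S y = (\sum_(m < h.+1) dpow x0 U m i y * e m) * pd l (U i) y.
  rewrite /S pd_sum => [|m]; last by apply: hgM; [exact: n3|exact: hg_cst].
  rewrite mulr_suml; apply: eq_bigr => m _; rewrite (pdZ _ _ (n3 m)) n4; exact: mulrAC.
by rewrite mulrBl addrA subrK.
Qed.

(** As the dU_i span, some constant combination of them is a coframe;
    subtracting the trace, expressed in this coframe, corrects the family
    without changing its h-jet. *)
Lemma correct h c : trace_ok h c -> exists g, lsec g /\
  forall i, van h.+1 x0 (fun y => g i y - fser h c i y).
Proof.
move=> Hc; have [L HL] := row_fullP Hspan.
pose G (y : V) : 'M[C]_(d, n) := \matrix_(i, l) pd l (U i) y.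
have hG : hgm x0 G.
  move=> i l; rewrite (_ : (fun y => _) = pd l (U i)); first exact: hg_pd.
  by apply/funext => y; rewrite mxE.
have [B hB HB] := inv_germ (hgm_mul (hgm_cst x0 L) hG) HL.
(* The trace of the family, which has to be removed. *)
pose e y : 'rV[C]_n := \row_l \sum_i fser h c i y * pd l (U i) y.
have he b l : van h.+1 x0 (fun y => e y b l).
  apply: van_ext (Hc l); exists 1 => // y _; by rewrite mxE.
have hge : hgm x0 e.
  move=> b l; rewrite (_ : (fun y => _) = fun y => \sum_i fser h c i y * pd l (U i) y).
    by apply: hg_sum => i; apply: hgM; [exact: hg_fser|exact: hg_pd].
  by apply/funext => y; rewrite mxE.
pose D y := e y *m (B y *m L).
have hD : hgm x0 D by apply: hgm_mul hge _; apply: hgm_mul hB _; exact: hgm_cst.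
have vD i : van h.+1 x0 (fun y => D y 0 i).
  apply: (van_ext (f := fun y => \sum_k e y 0 k * (B y *m L) k i)).
    by exists 1 => // y _; rewrite mxE.
  apply: van_sum => k; apply: vanMr (he 0 k) _.
  by apply: (hgm_mul hB); exact: hgm_cst.
exists (fun i y => fser h c i y - D y 0 i); split; first split.
- by move=> i; apply: hgB; [exact: hg_fser|exact: hD].
- move=> l; apply: nearx_imp HB => y HBy.
  have -> : \sum_i (fser h c i y - D y 0 i) * pd l (U i) y =
      (e y - D y *m G y) 0 l.
    rewrite mxE [e y 0 l]mxE [in RHS]mxE mxE -sumrB; apply: eq_bigr => i _.
    by rewrite [G y i l]mxE mulrBl.
  by rewrite /D -2!mulmxA HBy mulmx1 subrr mxE.
move=> i; apply: van_ext (vanN (vD i)); exists 1 => // y _.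
by rewrite addrAC subrr add0r.
Qed.

Lemma fser_ext h c c' i : (forall m, (m <= h)%N -> c m = c' m) -> fser h c i = fser h c' i.
Proof.
by move=> H; apply/funext => y; apply: eq_bigr => m _; rewrite H // -ltnS.
Qed.

Lemma trace_fser h c g : (forall i, hg x0 (g i)) ->
  (forall i, van h.+1 x0 (fun y => g i y - fser h c i y)) ->
  (forall l, van h.+1 x0 (fun y => \sum_i g i y * pd l (U i) y)) -> trace_ok h c.
Proof.
move=> hgg H K l.
have P : van h.+1 x0 (fun y => \sum_i (g i y - fser h c i y) * pd l (U i) y).
  by apply: van_sum => i; apply: vanMr (H i) _; exact: hg_pd.
apply: van_ext (vanB (K l) P); exists 1 => // y _.
by rewrite -sumrB; apply: eq_bigr => i _; rewrite mulrBl opprB addrC subrK.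
Qed.

(** The fibre of R_h at x0, for sections written as g_i dU_i. The condition on
    the differentials is empty for h = 0. *)
Definition Rloc h : set (jets n d V) := [set J | exists g, [/\ lsec g,
   J = jet h (fsec g) x0 & forall i l m, van h x0 (fun y => dform (fsec g) i y l m)]].

(** The parametrization of R_h by coefficients. *)
Definition Phi h c : jets n d V := jet h (fsec (fser h c)) x0.

Lemma RlocP h J : Rloc h J <-> exists2 c, trace_ok h c & J = Phi h c.
Proof.
split.
  move=> [g [[hgg tr] -> cl]].
  have [e He] : {e : 'I_d -> nat -> C & forall i,
      van h.+1 x0 (fun y => g i y - \sum_(m < h.+1) dpow x0 U m i y * e i m)}.
    apply: (@choice _ _ (fun i (e : nat -> C) => van h.+1 x0 (fun y => g i y -
       \sum_(m < h.+1) dpow x0 U m i y * e m))) => i.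
    apply: integrate => // l m; apply: van_ext (dform_fsec i l m hgg) _; exact: cl.
  pose c m : 'cV[C]_d := \col_i e i m.
  have Hc i : van h.+1 x0 (fun y => g i y - fser h c i y).
    apply: van_ext (He i); exists 1 => // y _; congr (_ - _).
    by apply: eq_bigr => m _; rewrite mxE.
  exists c.
    by apply: (trace_fser hgg Hc) => l; apply: van_ext (germeq_sym (tr l)) (van0 _ _).
  by apply/(jet_fsecP h hgg (fun i => hg_fser HU h c i)); exact: Hc.
move=> [c Hc ->]; have [g [lg Hg]] := correct Hc.
exists g; split => //.
  apply/esym/(jet_fsecP h (proj1 lg) (fun i => hg_fser HU h c i)); exact: Hg.
apply: (van_dform (proj1 lg) (fun i => hg_fser HU h c i) Hg) => i l m.
exact: van_ext (germeq_sym (dform_fser h c i l m)) (van0 _ _).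
Qed.

(** Differentiation with respect to U_i lowers the order of vanishing by one and
    brings each coefficient to the constant term. *)
Lemma fser_inj h c i : van h.+1 x0 (fser h c i) -> forall m, (m <= h)%N -> c m i 0 = 0.
Proof.
move=> H m mh; have [l w0] := Hreg i.
have hw : hg x0 (fun y => (pd l (U i) y)^-1) by apply: hgV w0; exact: hg_pd.
suff K : van (h.+1 - m) x0 (yser x0 U h c m i).
  by move: K; rewrite subSn // => /van_at; rewrite yser_x0.
elim: m mh => [|m IH] mh; first by rewrite subn0 yser0.
have := IH (ltnW mh); rewrite subSn ?(ltnW mh) // => K; rewrite subSS.
have P := vanMr (pd_van l (hg_yser HU h c m i) K) hw.
apply: van_ext P.
apply: nearx_imp (nearx_and (hg_neq0 (hg_pd l (HU i)) w0) (pd_yser HU h c m i l)) => y [w1 ->].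
exact: mulfK.
Qed.

Lemma fser_lin h (a : C) c c' i y :
  fser h (fun m => a *: c m + c' m) i y = a * fser h c i y + fser h c' i y.
Proof.
rewrite /fser mulr_sumr -big_split /=; apply: eq_bigr => m _.
by rewrite !mxE mulrDr mulrCA.
Qed.

Lemma Phi_lin h (a : C) c c' :
  Phi h (fun m => a *: c m + c' m) = a *: Phi h c + Phi h c'.
Proof.
have H k := hgm_fsec (fun i => hg_fser HU h k i).
rewrite -(jet_lin h a (H c) (H c')); congr (jet h _ x0).
apply/funext => i; apply/funext => y; apply/rowP => l.
by rewrite !mxE fser_lin mulrDl mulrA.
Qed.

Lemma trunc_jet h h' (s : forms R n d) : (h <= h')%N ->
  trunc h (jet h' s x0) = jet h s x0.
Proof.
move=> hh; apply/funext => a; apply/funext => i; rewrite /jet /trunc.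
by case: leqP => // ah; rewrite (leq_trans ah hh).
Qed.

Lemma trunc_Phi h h' c : (h <= h')%N -> trunc h (Phi h' c) = Phi h c.
Proof.
move=> hh; rewrite /Phi (trunc_jet _ hh).
apply/(jet_fsecP h (fun i => hg_fser HU h' c i) (fun i => hg_fser HU h c i)) => i.
exact: fser_le.
Qed.

Lemma Phi_ext h c c' : (forall m, (m <= h)%N -> c m = c' m) -> Phi h c = Phi h c'.
Proof.
by move=> H; rewrite /Phi; congr (jet h (fsec _) x0); apply/funext => i; exact: fser_ext.
Qed.

Lemma Phi0 h : Phi h (fun=> 0) = 0.
Proof.
transitivity (Phi h (fun m => (-1) *: (0 : 'cV[C]_d) + 0)).
  by apply: Phi_ext => m _; rewrite scaler0 addr0.
rewrite (Phi_lin h (-1) (fun=> 0) (fun=> 0)) scaleN1r; exact: addNr.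
Qed.

Lemma Phi_inj h c c' : Phi h c = Phi h c' -> forall m, (m <= h)%N -> c m = c' m.
Proof.
move=> /(jet_fsecP h (fun i => hg_fser HU h c i) (fun i => hg_fser HU h c' i)) H m mh.
apply/matrixP => i k; rewrite ord1; apply/eqP; rewrite -subr_eq0; apply/eqP.
have := @fser_inj h (fun m => (-1) *: c' m + c m) i _ m mh.
rewrite !mxE mulN1r addrC; apply.
apply: van_ext (H i); exists 1 => // y _.
by rewrite fser_lin mulN1r addrC.
Qed.

(** The trace and the differentials of the sums of the series agree to every
    order with those of the truncated series; [ident] turns this into equalities
    of germs. *)
Lemma formal_relation c g : (forall h, trace_ok h c) -> (forall i, hg x0 (g i)) ->
  (forall i h, van h.+1 x0 (fun y => g i y - fser h c i y)) ->
  [/\ lsec g, forall i l m, germeq x0 (fun y => dform (fsec g) i y l m) (fun=> 0)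
    & forall h, jet h (fsec g) x0 = Phi h c].
Proof.
move=> Hc hgg Hg.
have hd i l m : hg x0 (fun y => dform (fsec g) i y l m).
  exact: (hgm_dform (hgm_fsec hgg i)).
split.
- split=> // l; apply: ident.
    by apply: hg_sum => i; apply: hgM => //; exact: hg_pd.
  move=> q; apply: (van_le (leqnSn q)).
  have P : van q.+1 x0 (fun y => \sum_i (g i y - fser q c i y) * pd l (U i) y).
    by apply: van_sum => i; apply: vanMr (Hg i q) _; exact: hg_pd.
  apply: van_ext (vanD P (Hc q l)); exists 1 => // y _.
  by rewrite -big_split; apply: eq_bigr => i _; rewrite /= mulrBl subrK.
- move=> i l m; apply: ident => // q.
  apply: (van_dform hgg (fun i => hg_fser HU q c i) (fun i => Hg i q)) => i' l' m'.
  exact: van_ext (germeq_sym (dform_fser q c i' l' m')) (van0 _ _).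
move=> h; apply/(jet_fsecP h hgg (fun i => hg_fser HU h c i)) => i; exact: Hg.
Qed.

Lemma fsec_germ0 g : (forall i, hg x0 (g i)) -> (forall h, jet h (fsec g) x0 = 0) ->
  nearx x0 (fun y => forall i, fsec g i y = 0).
Proof.
move=> hgg H; apply: nearx_all => i.
have H0 : forall i : 'I_d, hg x0 (fun=> 0 : C) by move=> _; exact: hg_cst.
have K : germeq x0 (g i) (fun=> 0).
  apply: ident => // q; apply: (van_le (leqnSn q)).
  have E : jet q (fsec g) x0 = jet q (fsec (fun _ _ => 0)) x0.
    rewrite H -(jet0 (d := d) 1 n q x0); congr (jet q _ x0).
    by apply/funext => j; apply/funext => y; apply/rowP => l; rewrite !mxE mul0r.
  have := (jet_fsecP q hgg H0).1 E i.
  by apply: van_ext; exists 1 => // y _; rewrite subr0.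
by apply: nearx_imp K => y gy; apply/rowP => l; rewrite !mxE gy mul0r.
Qed.

End Fibre.

(** * Dimensions of linear subspaces *)

Section Dimension.
Variables (K : fieldType).

Definition subsp (V : lmodType K) (S : set V) :=
  S 0 /\ forall a u v, S u -> S v -> S (a *: u + v).

Lemma subsp_sum (V : lmodType K) (S : set V) (I : Type) (s : seq I) (c : I -> K) (b : I -> V) :
  subsp S -> (forall i, S (b i)) -> S (\sum_(i <- s) c i *: b i).
Proof.
move=> [S0 SL] Sb; elim: s => [|i s IH]; first by rewrite big_nil.
by rewrite big_cons; exact: SL.
Qed.

Section Transport.
Variables (V W : lmodType K) (S N : set V) (S' N' : set W) (f : V -> W).
Hypotheses (HS : subsp S) (fL : forall a u v, S u -> S v -> f (a *: u + v) = a *: f u + f v).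
Hypotheses (fS : forall v, S v -> S' (f v)) (fN : forall v, S v -> N v <-> N' (f v)).
Hypothesis fsurj : forall w, S' w -> exists2 v, S v & f v = w.

Lemma has_dim_mod_comb r (b : 'I_r -> V) (c : 'rV[K]_r) v : (forall i, S (b i)) -> S v ->
  N (v - \sum_i c 0 i *: b i) <-> N' (f v - \sum_i c 0 i *: f (b i)).
Proof.
move=> Sb Sv.
have f0 : f 0 = 0.
  have := fL (-1) (proj1 HS) (proj1 HS).
  by rewrite scaler0 addr0 scaleN1r addNr.
have fsum (s : seq 'I_r) : f (\sum_(i <- s) c 0 i *: b i) = \sum_(i <- s) c 0 i *: f (b i).
  elim: s => [|i s IH]; first by rewrite !big_nil.
  by rewrite !big_cons fL // ?IH //; exact: subsp_sum.
have SS : S (\sum_i c 0 i *: b i) by exact: subsp_sum.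
have e : v - \sum_i c 0 i *: b i = (-1) *: (\sum_i c 0 i *: b i) + v.
  by rewrite scaleN1r addrC.
have e' : f v - \sum_i c 0 i *: f (b i) = f (v - \sum_i c 0 i *: b i).
  by rewrite e fL // fsum scaleN1r addrC.
rewrite e'; apply: fN; rewrite e; exact: (proj2 HS).
Qed.

(** A linear map of S onto S' that identifies N with the preimage of N' carries
    bases to bases, in both directions. *)
Lemma has_dim_modT r : has_dim_mod S N r <-> has_dim_mod S' N' r.
Proof.
split.
  move=> [b [Sb Hb]]; exists (fun i => f (b i)); split; first by move=> i; exact: fS.
  move=> w /fsurj [v Sv <-]; have [c [Hc uc]] := Hb v Sv; exists c; split.
    exact/has_dim_mod_comb.
  by move=> c' Hc'; apply: uc; exact/has_dim_mod_comb.
move=> [b' [Sb' Hb']].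
have [b Hb] : {b : 'I_r -> V & forall i, S (b i) /\ f (b i) = b' i}.
  apply: (@choice _ _ (fun i v => S v /\ f v = b' i)) => i.
  by have [v Sv fv] := fsurj (Sb' i); exists v.
have Sb i : S (b i) by case: (Hb i).
have E (c : 'rV[K]_r) : \sum_i c 0 i *: f (b i) = \sum_i c 0 i *: b' i.
  by apply: eq_bigr => i _; rewrite (proj2 (Hb i)).
exists b; split => // v Sv; have [c [Hc uc]] := Hb' _ (fS Sv); exists c; split.
  by apply/has_dim_mod_comb => //; rewrite E.
by move=> c' /(has_dim_mod_comb c' Sb Sv); rewrite E // => Hc'; exact: uc.
Qed.

End Transport.

Section Compare.
Variables (V : lmodType K) (S S' : set V).
Hypotheses (HS : subsp S) (HS' : subsp S') (SS : S `<=` S').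

(** The matrix that expresses a basis of S in a basis of S' has independent
    rows. *)
Lemma has_dim_incl r r' : has_dim S r -> has_dim S' r' ->
  exists (b : 'I_r -> V) (b' : 'I_r' -> V) (A : 'M[K]_(r, r')),
    [/\ forall i, S (b i), forall v, S' v -> exists c : 'rV[K]_r', v = \sum_j c 0 j *: b' j,
      forall i, b i = \sum_j A i j *: b' j & row_free A].
Proof.
move=> [b [Sb Hb]] [b' [Sb' Hb']].
have [A0 HA] : {A0 : 'I_r -> 'rV[K]_r' & forall i, b i = \sum_j A0 i 0 j *: b' j}.
  apply: (@choice _ _ (fun i (c : 'rV[K]_r') => b i = \sum_j c 0 j *: b' j)) => i.
  have [c [Hc _]] := Hb' _ (SS (Sb i)).
  by exists c; apply/eqP; rewrite -subr_eq0; apply/eqP.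
pose A : 'M[K]_(r, r') := \matrix_(i, j) A0 i 0 j.
have bE i : b i = \sum_j A i j *: b' j.
  by rewrite HA; apply: eq_bigr => j _; rewrite mxE.
exists b, b', A; split => //.
  move=> v /Hb' [c [Hc _]]; exists c.
  by apply/eqP; rewrite -subr_eq0; apply/eqP.
apply: inj_row_free => u uA.
have [c [Hc uc]] := Hb 0 (proj1 HS).
have c0 : c = 0.
  by apply: uc; rewrite /= big1 ?subr0 // => i _; rewrite mxE scale0r.
rewrite -c0; apply/esym/uc; rewrite /= sub0r.
apply/eqP; rewrite oppr_eq0; apply/eqP.
transitivity (\sum_j (u *m A) 0 j *: b' j); last first.
  by rewrite uA big1 // => j _; rewrite mxE scale0r.
transitivity (\sum_i \sum_j (u 0 i * A i j) *: b' j).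
  by apply: eq_bigr => i _; rewrite bE scaler_sumr; apply: eq_bigr => j _; rewrite scalerA.
rewrite exchange_big /=; apply: eq_bigr => j _.
by rewrite mxE scaler_suml.
Qed.

Lemma has_dim_le r r' : has_dim S r -> has_dim S' r' -> (r <= r')%N.
Proof.
move=> h h'; have [_ [_ [A [_ _ _ fA]]]] := has_dim_incl h h'.
by move/eqP: fA => <-; exact: rank_leq_col.
Qed.

Lemma has_dim_eq r : has_dim S r -> has_dim S' r -> S' `<=` S.
Proof.
move=> h h'; have [b [b' [A [Sb Hb' bE fA]]]] := has_dim_incl h h'.
move: fA; rewrite row_free_unit => uA v /Hb' [c ->].
suff H j : S (b' j) by exact: subsp_sum.
have -> : b' j = \sum_i invmx A j i *: b i.
  transitivity (\sum_k (invmx A *m A) j k *: b' k).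
    rewrite mulVmx // (bigD1 j) //= mxE eqxx scale1r big1 ?addr0 // => k kj.
    by rewrite mxE eq_sym (negbTE kj) scale0r.
  transitivity (\sum_k \sum_i (invmx A j i * A i k) *: b' k).
    by apply: eq_bigr => k _; rewrite mxE scaler_suml.
  rewrite exchange_big /=; apply: eq_bigr => i _.
  by rewrite bE scaler_sumr; apply: eq_bigr => k _; rewrite scalerA.
exact: subsp_sum.
Qed.

End Compare.

Lemma has_dim_uniq (V : lmodType K) (S : set V) r r' : subsp S ->
  has_dim S r -> has_dim S r' -> r = r'.
Proof.
move=> HS h h'; apply/eqP; rewrite eqn_leq.
by rewrite (has_dim_le HS (@subset_refl _ S) h h') (has_dim_le HS (@subset_refl _ S) h' h).
Qed.

Lemma has_dim_ker m n (B : 'M[K]_(m, n)) :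
  has_dim [set v : 'rV[K]_m | v *m B = 0] (m - \rank B)%N.
Proof.
rewrite -mxrank_ker; set A := row_base (kermx B).
exists (fun i => row i A); split.
  by move=> i /=; apply/sub_kermxP; apply: submx_trans (row_sub i A) _; rewrite eq_row_base.
move=> v /sub_kermxP; rewrite -(eq_row_base (kermx B)) -/A => /submxP [c vE].
have fA : row_free A := row_base_free _.
exists c; rewrite /unique /= -mulmx_sum_row vE subrr; split => // c'.
rewrite -mulmx_sum_row => /eqP; rewrite subr_eq0 => /eqP e.
exact: (row_free_inj fA).
Qed.

End Dimension.

(** * Counting the equations *)

(** Multi-indices are the tuples counted by [card_ord_partitions]. *)
Lemma card_multi_indices n j : (0 < n)%N -> #|multi_indices n j| = cnum n j.
Proof.
case: n => [//|n] _; pose f (t : n.+1.-tuple 'I_j.+1) := [ffun i => tnth t i].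
have fI : injective f.
  move=> t t' /ffunP e; apply: eq_from_tnth => i.
  by have := e i; rewrite !ffunE.
have -> : multi_indices n.+1 j =
    f @: [set t : n.+1.-tuple 'I_j.+1 | \sum_(i <- t) i == j]%N%SET.
  have sumE (t : n.+1.-tuple 'I_j.+1) : (\sum_(i <- t) i = \sum_l tnth t l)%N.
    by rewrite big_tuple.
  apply/setP => L; apply/idP/imsetP.
    rewrite inE => /eqP Lj; exists [tuple L i | i < n.+1].
      rewrite inE sumE; apply/eqP; rewrite -[RHS]Lj.
      by apply: eq_bigr => i _; rewrite tnth_mktuple.
    by apply/ffunP => i; rewrite ffunE tnth_mktuple.
  move=> [t]; rewrite inE sumE => /eqP tj ->; rewrite inE; apply/eqP; rewrite -[RHS]tj.
  by apply: eq_bigr => i _; rewrite ffunE.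
rewrite card_imset // card_ord_partitions /cnum /= -[LHS]bin_sub ?leq_addr //.
by rewrite addKn.
Qed.

Lemma cnum_le n h h' : (h <= h')%N -> (cnum n h <= cnum n h')%N.
Proof.
move=> hh; rewrite /cnum -bin_sub ?leq_addl // addnK -(bin_sub (leq_addl _ h')) addnK.
by apply: leq_bin2l; rewrite leq_add2l.
Qed.

Section System.
Context {R : realType} {n d : nat}.
Local Notation C := (Cplx R).
Local Notation V := 'rV[C]_n.
Variables (x0 : V) (U : 'I_d -> V -> C).
Hypothesis HU : forall i, hg x0 (U i).
Hypothesis Hreg : forall i, exists l, pd l (U i) x0 != 0.
Hypothesis Hspan : row_full (\matrix_(i < d, l < n) pd l (U i) x0).
Hypothesis n0 : (0 < n)%N.
Implicit Types (c : nat -> 'cV[C]_d).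

Local Notation sysM := (sysM x0 U).
Local Notation trace_ok := (trace_ok x0 U).
Local Notation Phi := (Phi x0 U).
Local Notation Rloc := (Rloc x0 U).

Section Order.
Variable h : nat.
Local Notation Q := ('I_h.+1 * 'I_d)%type.
Local Notation T := {j : 'I_h.+1 & 'I_#|multi_indices n j.+1|}.

(** The whole system up to order h as one matrix acting on row vectors, with
    columns indexed by the equations. *)
Definition sysB : 'M[C]_(#|{: Q}|, #|{: T}|) :=
  \matrix_(q, t) (let mi : Q := enum_val q in let jL : T := enum_val t in
    if (mi.1 <= tag jL)%N then sysM (tag jL) mi.1 (tagged jL) mi.2 else 0).

Definition coefs (v : 'rV[C]_#|{: Q}|) (m : nat) : 'cV[C]_d :=
  \col_i v 0 (enum_rank ((inord m, i) : Q)).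

Lemma sysB_ker v : v *m sysB = 0 <-> trace_ok h (coefs v).
Proof.
have E (j : 'I_h.+1) (L : 'I_#|multi_indices n j.+1|) :
    (v *m sysB) 0 (enum_rank (Tagged (fun j : 'I_h.+1 => 'I_#|multi_indices n j.+1|) L)) =
    (\sum_(m < j.+1) sysM j m *m coefs v m) L 0.
  rewrite mxE summxE.
  rewrite (reindex (@enum_rank {: Q})) /=; last by apply: onW_bij; exact: enum_rank_bij.
  under eq_bigr => q _ do rewrite mxE !enum_rankK /=.
  transitivity (\sum_(m < h.+1) \sum_(i < d) v 0 (enum_rank ((m, i) : Q)) *
     (if (m <= j)%N then sysM j m L i else 0)).
    by rewrite pair_bigA; apply: eq_bigr => -[m i].
  rewrite (big_ord_widen_cond h.+1 xpredT (fun m => (sysM j m *m coefs v m) L 0)) //=.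
  rewrite [RHS]big_mkcond /=; apply: eq_bigr => m _; rewrite ltnS.
  case: (m <= j)%N; last by rewrite big1 // => i _; rewrite mulr0.
  by rewrite mxE; apply: eq_bigr => i _; rewrite [coefs v m i 0]mxE inord_val mulrC.
apply: iff_trans (iff_sym (trace_okP HU h (coefs v))); split=> H.
  move=> j; rewrite -ltnS => jh; apply/matrixP => L k; rewrite ord1.
  by have := E (Ordinal jh) L; rewrite H mxE => <-; rewrite mxE.
apply/rowP => t; rewrite [RHS]mxE -(enum_valK t); case: (enum_val t) => j L.
by rewrite E H ?mxE // -ltnS.
Qed.

Lemma card_cols : #|{: Q}| = (h.+1 * d)%N.
Proof. by rewrite card_prod !card_ord. Qed.

Lemma card_rows : #|{: T}| = betanum n h.+1.
Proof.
rewrite card_tagged sumnE big_map big_enum /=.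
rewrite (eq_bigr (fun j : 'I_h.+1 => cnum n j.+1)); last first.
  by move=> j _; rewrite card_ord card_multi_indices.
by rewrite /betanum big_add1 big_mkord.
Qed.

(** A block triangular matrix whose diagonal blocks have independent rows has
    independent rows. *)
Lemma sysB_full : (forall j, (j <= h)%N -> row_free (sysM j j)) -> \rank sysB = #|{: T}|.
Proof.
move=> H; rewrite -mxrank_tr; apply/eqP; apply: inj_row_free => w wB.
pose W (j : 'I_h.+1) : 'rV[C]_#|multi_indices n j.+1| :=
  \row_L w 0 (enum_rank (Tagged (fun j : 'I_h.+1 => 'I_#|multi_indices n j.+1|) L)).
have E (m : 'I_h.+1) : \sum_(j < h.+1 | (m <= j)%N) W j *m sysM j m = 0.
  apply/rowP => i; rewrite [RHS]mxE summxE.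
  have := congr1 (fun M : 'rV[C]_ _ => M 0 (enum_rank ((m, i) : Q))) wB.
  rewrite [in RHS]mxE => e; rewrite -[RHS]e mxE.
  rewrite [RHS](reindex (@enum_rank {: T})) /=; last by apply: onW_bij; exact: enum_rank_bij.
  under [RHS]eq_bigr => t _ do rewrite !mxE !enum_rankK /=.
  transitivity (\sum_(j < h.+1) \sum_(L < #|multi_indices n j.+1|)
     w 0 (enum_rank (Tagged (fun j : 'I_h.+1 => 'I_#|multi_indices n j.+1|) L)) *
     (if (m <= j)%N then sysM j m L i else 0)); last first.
    by rewrite sig_big_dep /=; apply: eq_bigr => -[j L].
  rewrite big_mkcond; apply: eq_bigr => j _; case: (m <= j)%N; last by rewrite big1 // => L _; rewrite mulr0.
  by rewrite mxE; apply: eq_bigr => L _; rewrite [W j 0 L]mxE.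
(* Downward induction on the block index, through h - j. *)
have W0 k : forall j : 'I_h.+1, (h - j < k)%N -> W j = 0.
  elim: k => [//|k IH] j jk.
  have := E j; rewrite (bigD1 j) //= big1 ?addr0 => [e|j' /andP [jj' ne]].
    apply: (row_free_inj (H j _)); first by rewrite -ltnS.
    by rewrite /= e mul0mx.
  rewrite IH ?mul0mx //; apply: leq_trans (_ : (h - j <= k)%N) => //.
  apply: ltn_sub2l; last by rewrite ltn_neqAle eq_sym ne.
  by apply: leq_trans (_ : (j' <= h)%N); rewrite ?ltn_neqAle 1?eq_sym ?ne //= -ltnS.
apply/rowP => t; rewrite mxE -(enum_valK t); case: (enum_val t) => j L.
have := W0 (h - j).+1 j (ltnSn _) => /rowP /(_ L).
by rewrite !mxE.
Qed.

(** The fibre of R_h is the image of the kernel of the system under the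
    injective parametrization [Phi]. *)
Lemma Rloc_dim : has_dim (Rloc h) (h.+1 * d - \rank sysB)%N.
Proof.
rewrite -card_cols.
have cl a u v m : coefs (a *: u + v) m = a *: coefs u m + coefs v m.
  by apply/colP => i; rewrite !mxE.
apply: (has_dim_modT (f := fun v => Phi h (coefs v)) (N := [set 0]) _ _ _ _ _ _).1;
  last exact: has_dim_ker.
- split=> [|a u v] /=; first by rewrite mul0mx.
  by move=> hu hv; rewrite mulmxDl -scalemxAl hu hv scaler0 addr0.
- move=> a u v _ _; rewrite -(Phi_lin HU h a (coefs u) (coefs v)).
  by congr (Phi h _); apply/funext => m; exact: cl.
- move=> v /= /sysB_ker Hv; apply/(RlocP HU Hreg Hspan).
  by exists (coefs v).
- move=> v _; split=> [->|H].
    rewrite /= -[RHS](Phi0 HU h); apply: Phi_ext => m _.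
    by apply/colP => i; rewrite !mxE.
  have H0 : Phi h (coefs v) = Phi h (fun=> 0) by rewrite Phi0.
  apply/rowP => q; rewrite mxE -(enum_valK q); case: (enum_val q) => m i.
  have mh : (m <= h)%N by rewrite -ltnS.
  have := Phi_inj HU Hreg H0 mh => /colP /(_ i).
  by rewrite !mxE inord_val.
move=> J /(RlocP HU Hreg Hspan) [c Hc ->].
pose v : 'rV[C]_#|{: Q}| := \row_q c (enum_val q : Q).1 (enum_val q : Q).2 0.
have cv m : (m <= h)%N -> coefs v m = c m.
  by move=> mh; apply/colP => i; rewrite !mxE enum_rankK /= inordK.
exists v; last by apply: Phi_ext => m mh; exact: cv.
apply/sysB_ker/(trace_okP HU) => j jh; rewrite -[RHS]((trace_okP HU h c).1 Hc j jh).
by apply: eq_bigr => m _; rewrite cv // (leq_trans _ jh) // -ltnS.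
Qed.

End Order.
End System.

(** * The web read in a chart *)

Section Charts.
Context {R : realType} {n : nat}.
Local Notation C := (Cplx R).
Local Notation V := 'rV[C]_n.

#[local] Transparent fdiff.
(** A row is the sum of its coordinates times the basis vectors. *)
Lemma differentiable_rV (F : V -> V) x : (forall l, fdiff (fun y => F y 0 l) x) ->
  differentiable F x.
Proof.
move=> H; have -> : F = \sum_(l < n) (fun y => F y 0 l *: (delta_mx 0 l : V)).
  apply/funext => y; rewrite fct_sumE; exact: row_sum_delta.
apply: differentiable_sum => l; exact: (@differentiableZl _ V V (fun y => F y 0 l) (delta_mx 0 l) x (H l)).
Qed.
#[local] Opaque fdiff.

#[local] Transparent der.
Lemma dfun_der (M : complexManifold R n) (k : chart R M n) u p v :
  dfun k u p v = der (u \o chart_inv k) (chart_map k p) v.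
Proof. by []. Qed.
#[local] Opaque der.

Lemma hg_dpart (f : V -> C) x : hg x f -> (exists v, der f x v <> 0) ->
  exists l, pd l f x != 0.
Proof.
move=> hf [v nz]; case: (boolP [exists l, pd l f x != 0]) => [/existsP //|H]; case: nz.
rewrite (fdiff_pd _ (nearx_at hf)) big1 // => l _.
have := H; rewrite negb_exists => /forallP /(_ l); rewrite negbK => /eqP ->.
by rewrite mulr0.
Qed.

End Charts.

Section Model.
Context {R : realType} {n d : nat}.
Local Notation C := (Cplx R).
Local Notation V := 'rV[C]_n.
Variables (M : complexManifold R n) (W : web M d).
Hypothesis hord : ordinary W.
Variables (p : M) (k : chart R M n).
Hypothesis Hk : chart_at p k.

Local Notation x0 := (chart_map k p).
Local Notation ci := (chart_inv k).

Lemma near_chart (Oi : 'I_d -> set M) : (forall i, open (Oi i)) -> (forall i, Oi i p) ->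
  nearx x0 (fun x => exists q, [/\ chart_dom k q, chart_map k q = x, ci x = q & forall i, Oi i q]).
Proof.
move=> oO Op; have [ak dk] := Hk.
have Ix0 : (chart_map k @` chart_dom k) x0 by exists p.
have [r r0 Hr] := open_nm (@chart_img_open _ _ _ k) Ix0.
have cp : ci x0 = p by exact: chart_mapK.
have cc : {for x0, continuous ci}.
  have := chart_inv_cont (c := k); rewrite continuous_open_subspace; last exact: chart_img_open.
  by move=> H; apply: H; rewrite inE.
have HO i : nearx x0 (fun x => Oi i (ci x)).
  apply/nearE_nm; apply: (cc (Oi i)); rewrite /= cp; apply: open_nbhs_nbhs; split; [exact: oO|exact: Op].
have H : nearx x0 (fun x => (chart_map k @` chart_dom k) x) by exists r.
apply: nearx_imp (nearx_and H (nearx_all HO)) => x [[q dq qx] Ox].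
have cx : ci x = q by rewrite -qx; exact: chart_mapK.
by exists q; split => // i; rewrite -cx.
Qed.

(** What the sequel retains of the web near p: first integrals U read in the
    chart k, with the consequences of the hypotheses on the web. *)
Definition is_model (U : 'I_d -> V -> C) :=
  [/\ forall i, hg x0 (U i),
      forall i, exists l, pd l (U i) x0 != 0,
      row_full (\matrix_(i < d, l < n) pd l (U i) x0),
      forall j, \rank (sysM x0 U j j) = minn d (cnum n j.+1)
    & nearx x0 (fun x => (chart_map k @` chart_dom k) x /\
        forall i v, tangent (W i) k (ci x) v <-> der (U i) x v = 0)].

#[local] Transparent pd.
(** The tangent hyperplanes are those of one chosen family of first integrals,
    since two first integrals of a foliation have the same differential up to a
    factor. *)
Lemma model_exists : exists U, is_model U.
Proof.
have [ak dk] := Hk.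
have [F HF] : {F : 'I_d -> set M * (M -> C) & forall i, first_int (W i) (F i) /\ (F i).1 p}.
  apply: (@choice _ _ (fun i (F : set M * (M -> C)) => first_int (W i) F /\ F.1 p)) => i.
  by have [A [u [Fu Ap]]] := first_int_cover (W i) p; exists (A, u).
pose Oi i := (F i).1; pose u i := (F i).2.
have Fi i : first_int (W i) (Oi i, u i) by case: (HF i); rewrite /Oi /u; case: (F i).
have Op i : Oi i p by case: (HF i).
have oO i : open (Oi i) := first_int_open (Fi i).
have N := near_chart oO Op.
pose U i : V -> C := u i \o ci.
have hU i : hg x0 (U i).
  apply: nearx_imp N => x [q [dq qx _ Oq]].
  by apply: (first_int_holomorphic (Fi i) ak); exists q.
have tanU i x v q : chart_dom k q -> chart_map k q = x -> ci x = q -> Oi i q ->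
    tangent (W i) k (ci x) v <-> der (U i) x v = 0.
  move=> dq qx cq Oq; have E : dfun k (u i) q v = der (U i) x v by rewrite dfun_der qx.
  rewrite cq; split.
    move=> [u' [A' Fu' Aq'] du'].
    have := first_int_compat Fu' (Fi i) Aq' Oq (conj ak dq) => /seteqP [sub _].
    by rewrite -E; exact: (sub v du').
  by move=> du; exists (u i); [exists (Oi i)|rewrite E].
have cp : ci x0 = p by exact: chart_mapK.
exists U; split.
- exact: hU.
- move=> i; apply: hg_dpart (hU i) _.
  by have [v Hv] := first_int_regular (Fi i) (Op i) Hk; exists v.
- have [s [_ sE]] := web_weak_general W Hk.
  rewrite /row_full -mxrank_tr; apply: inj_row_free => v vG.
  suff : (\bigcap_(j in [set: 'I_n]) tangent (W (s j)) k p) v by rewrite sE.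
  move=> j _; have := tanU (s j) x0 v p dk (erefl _) cp (Op _); rewrite cp => ->.
  rewrite (fdiff_pd _ (nearx_at (hU (s j)))).
  have := congr1 (fun A : 'rV[C]_d => A 0 (s j)) vG; rewrite !mxE => e.
  by rewrite -[RHS]e; apply: eq_bigr => l _; rewrite !mxE.
- move=> j; rewrite -(hord (ltn0Sn j) Hk (u := u)); last by move=> i; exists (Oi i).
  by rewrite sysM_diag.
apply: nearx_imp N => x [q [dq qx cq Oq]]; split; first by exists q.
by move=> i v; exact: (tanU i x v q dq qx cq (Oq i)).
Qed.
#[local] Opaque pd.

Variable U : 'I_d -> V -> C.
Hypothesis HM : is_model U.

Let HU i : hg x0 (U i). Proof. by case: HM. Qed.
Let Hreg i : exists l, pd l (U i) x0 != 0. Proof. by case: HM. Qed.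

Lemma model_tangent : nearx x0 (fun x => (chart_map k @` chart_dom k) x /\
        forall i v, tangent (W i) k (ci x) v <-> der (U i) x v = 0).
Proof. by case: HM. Qed.

Lemma germ_ball P : nearx x0 P -> exists2 r : R, 0 < r &
  [set y | nm (y - x0) < r] `<=` P.
Proof. by move=> [r r0 Hr]; exists r. Qed.

(** On small balls the factors are holomorphic, the forms annihilate the tangent
    hyperplanes and the trace vanishes. *)
Lemma lsec_section g : lsec x0 U g -> exists2 r : R, 0 < r & forall r', 0 < r' -> r' <= r ->
  sectionA W k [set y | nm (y - x0) < r'] (fsec U g).
Proof.
move=> [hgg tr].
have N := nearx_and (nearx_and model_tangent (nearx_all tr))
  (nearx_and (nearx_all hgg) (nearx_and (nearx_all HU)
     (nearx_all (I := ('I_d * 'I_n)%type) (fun il => hg_pd il.2 (HU il.1))))).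
have [r r0 Hr] := germ_ball N.
exists r => // r' r'0 r'r.
have {}Hr y : nm (y - x0) < r' -> _ := fun yr => Hr y (lt_le_trans yr r'r).
split.
- exact: open_ball_nm.
- by move=> y /Hr [[[]]].
- move=> i y /Hr [_ [h1 [_ h3]]]; apply: differentiable_rV => l.
  by rewrite fsecE; apply: fdiffM; [exact: h1|exact: (h3 (i, l))].
- move=> y i v /Hr [[[_ Ht] _] [_ [h2 _]]] /Ht du.
  rewrite (fdiff_pd _ (h2 i)) in du.
  transitivity (g i y * \sum_l v 0 l * pd l (U i) y); last by rewrite du mulr0.
  rewrite mulr_sumr; apply: eq_bigr => l _.
  by rewrite mxE -mulrA; congr (_ * _); exact: mulrC.
move=> y /Hr [[_ h] _]; apply/rowP => l; rewrite summxE mxE -[RHS](h l).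
by apply: eq_bigr => i _; rewrite mxE.
Qed.

Lemma section_hgm O s x : O x -> sectionA W k O s -> forall i, hgm x (s i).
Proof.
move=> Ox [oO _ hs _ _] i b l; have [r r0 Hr] := open_nm oO Ox.
by exists r => // y /Hr Oy; apply: fdiff_coord; exact: hs.
Qed.

(** A form that annihilates the kernel of dU_i is a multiple of dU_i; the factor
    is the quotient of two coordinates. *)
Lemma section_lsec O s : O x0 -> sectionA W k O s -> exists g, lsec x0 U g /\
  nearx x0 (fun y => forall i, s i y = fsec U g i y).
Proof.
move=> Ox sO; have hs := section_hgm Ox sO; have [oO _ _ st sz] := sO.
have [l Hl] : {l : 'I_d -> 'I_n & forall i, pd (l i) (U i) x0 != 0}.
  by apply: (@choice _ _ (fun i l => pd l (U i) x0 != 0)).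
pose g i y := s i y 0 (l i) / pd (l i) (U i) y.
have hgg i : hg x0 (g i).
  apply: hgM; [exact: hs|apply: hgV (Hl i); exact: hg_pd].
have NO : nearx x0 O by have [r r0 Hr] := open_nm oO Ox; exists r.
have N := nearx_and (nearx_and model_tangent NO)
  (nearx_and (nearx_all HU) (nearx_all (fun i => hg_neq0 (hg_pd (l i) (HU i)) (Hl i)))).
have E : nearx x0 (fun y => forall i, s i y = fsec U g i y).
  apply: nearx_imp N => y [[[_ Ht] Oy] [hUy w]] i; apply/rowP => m; rewrite mxE /g.
  (* A vector tangent to the level of U_i at y. *)
  pose v : V := pd (l i) (U i) y *: delta_mx 0 m - pd m (U i) y *: delta_mx 0 (l i).
  have sumv (f : 'I_n -> C) : \sum_j f j * v 0 j = f m * pd (l i) (U i) y - f (l i) * pd m (U i) y.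
    rewrite (eq_bigr (fun j => f j * pd (l i) (U i) y * (j == m)%:R - f j * pd m (U i) y * (j == l i)%:R)).
      rewrite sumrB; congr (_ - _).
        rewrite (bigD1 m) //= eqxx mulr1 big1 ?addr0 // => j /negbTE ->.
        exact: mulr0.
      rewrite (bigD1 (l i)) //= eqxx mulr1 big1 ?addr0 // => j /negbTE ->.
      exact: mulr0.
    by move=> j _; rewrite !mxE /= mulrBr !mulrA.
  have tv : tangent (W i) k (ci y) v.
    apply/Ht; rewrite (fdiff_pd _ (hUy i)).
    rewrite (eq_bigr (fun j => pd j (U i) y * v 0 j)); last by move=> j _; exact: mulrC.
    rewrite sumv; apply/eqP; rewrite subr_eq0; apply/eqP; exact: mulrC.
  have := st y i v Oy tv; rewrite sumv => /eqP; rewrite subr_eq0 => /eqP e.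
  by rewrite mulrAC -e mulfK.
exists g; split => //; split => // j.
apply: nearx_imp (nearx_and E NO) => y [Ey Oy].
have := congr1 (fun A : 'rV[C]_n => A 0 j) (sz y Oy); rewrite mxE => e; rewrite -[RHS]e summxE.
by apply: eq_bigr => i _; rewrite Ey mxE.
Qed.

Lemma jet_germ h (s s' : forms R n d) : (forall i, hgm x0 (s i)) -> (forall i, hgm x0 (s' i)) ->
  nearx x0 (fun y => forall i, s i y = s' i y) -> jet h s x0 = jet h s' x0.
Proof.
move=> hs hs' E; apply/(jet_eqP h hs hs') => i b c.
apply: van_ext (van0 _ _); apply: nearx_imp E => y ->.
by rewrite subrr.
Qed.

Lemma dform_ext (s s' : forms R n d) i l m : (forall i, hgm x0 (s i)) -> (forall i, hgm x0 (s' i)) ->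
  nearx x0 (fun y => forall i, s i y = s' i y) ->
  germeq x0 (fun y => dform s i y l m) (fun y => dform s' i y l m).
Proof.
move=> hs hs' E.
have G b j : germeq x0 (fun y => s i y b j) (fun y => s' i y b j).
  by apply: nearx_imp E => y ->.
apply: germeq_trans (dform_germ l m (hs i)) _.
apply: germeq_trans _ (germeq_sym (dform_germ l m (hs' i))).
apply: nearx_imp (nearx_and (germeq_pd l (G 0 m)) (germeq_pd m (G 0 l))) => y [e1 e2].
have sub2 (a b a' b' : C) : a = a' -> b = b' -> a - b = a' - b' by move=> -> ->.
apply: sub2; [exact: e1|exact: e2].
Qed.

Lemma RfibP h J : Rfib W h k p J <-> Rloc x0 U h J.
Proof.
split.
  move=> [A [s [Ox sO -> Hd]]]; have hs := section_hgm Ox sO.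
  have [g [lg E]] := section_lsec Ox sO; have hf := hgm_fsec HU (proj1 lg).
  exists g; split => //; first exact: jet_germ.
  move=> i l m; have D := dform_ext i l m hs hf E.
  apply: van_ext D _; case: h Hd => [_|h Hd].
    by apply: hg_van0; exact: (hgm_dform (hs i)).
  apply: (jet_eq0P h (fun i => hgm_dform (hs i))).1; exact: Hd.
move=> [g [lg -> cl]]; have [r r0 Hr] := lsec_section lg.
exists [set y | nm (y - x0) < r], (fsec U g); split => //.
- by rewrite /= subrr nm0.
- exact: Hr.
move=> h0; apply/(jet_eq0P _ (fun i => hgm_dform (hgm_fsec HU (proj1 lg) i))) => i l m.
by rewrite prednK.
Qed.

Lemma closed_relation g : lsec x0 U g ->
  (forall i l m, germeq x0 (fun y => dform (fsec U g) i y l m) (fun=> 0)) ->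
  exists2 O, O x0 & abelian_relation W k O (fsec U g).
Proof.
move=> lg cl; have [r r0 Hr] := lsec_section lg.
have [s s0 Hs] := nearx_all (I := ('I_d * ('I_n * 'I_n))%type) (fun t => cl t.1 t.2.1 t.2.2).
have m0 : 0 < Num.min r s by rewrite lt_min r0.
exists [set y | nm (y - x0) < Num.min r s]; first by rewrite /= subrr nm0.
split; first by apply: Hr => //; rewrite ge_min lexx.
move=> y i /=; rewrite lt_min => /andP [_ ys].
by apply/matrixP => l m; rewrite [RHS]mxE; exact: (Hs y ys (i, (l, m))).
Qed.

Lemma relation_closed O s : O x0 -> abelian_relation W k O s ->
  forall h, Rfib W h k p (jet h s x0).
Proof.
move=> Ox [sO ds] h; exists O, s; split => // _.
have hs := section_hgm Ox sO; have [oO _ _ _ _] := sO.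
apply/(jet_eq0P _ (fun i => hgm_dform (hs i))) => i l m.
apply: van_ext (van0 _ _); have [r r0 Hr] := open_nm oO Ox.
by exists r => // y /Hr Oy; rewrite ds // mxE.
Qed.

End Model.

(** * The tower of the R_h over a point *)

Section Point.
Context {R : realType} {n d : nat}.
Local Notation C := (Cplx R).
Local Notation V := 'rV[C]_n.
Variables (M : complexManifold R n) (W : web M d) (h1 : nat).
Hypothesis hord : ordinary W.
Hypothesis n0 : (0 < n)%N.
(* h1 stands for h0 - 2. *)
Hypotheses (Hlo : (cnum n h1.+1 < d)%N) (Hhi : (d <= cnum n h1.+2)%N).
Variables (p : M) (k : chart R M n).
Hypothesis Hk : chart_at p k.
Local Notation x0 := (chart_map k p).

Section Coordinates.
Variable U : 'I_d -> V -> C.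
Hypothesis HM : is_model W p k U.
Local Notation sysM := (sysM x0 U).
Local Notation trace_ok := (trace_ok x0 U).
Local Notation Phi := (Phi x0 U).
Implicit Types (c : nat -> 'cV[C]_d).

Let HU i : hg x0 (U i). Proof. by case: HM. Qed.
Let Hreg i : exists l, pd l (U i) x0 != 0. Proof. by case: HM. Qed.
Let Hspan : row_full (\matrix_(i < d, l < n) pd l (U i) x0). Proof. by case: HM. Qed.
Let Hrank j : \rank (sysM j j) = minn d (cnum n j.+1). Proof. by case: HM. Qed.

(** For j + 1 < h0 the matrix P_{j+1} has maximal rank c(n, j + 1). *)
Lemma sys_free j : (j <= h1)%N -> row_free (sysM j j).
Proof.
move=> jh; rewrite /row_free Hrank card_multi_indices //; apply/eqP/minn_idPr.
by apply: leq_trans (ltnW Hlo); exact: cnum_le.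
Qed.

(** For j + 1 >= h0 the matrix P_{j+1} has maximal rank d. *)
Lemma sys_full j : (h1 < j)%N -> row_full (sysM j j).
Proof.
move=> jh; rewrite /row_full Hrank; apply/eqP/minn_idPl.
by apply: leq_trans Hhi _; exact: cnum_le.
Qed.

(** The equation of index m > h0 - 2 determines c_m by the preceding
    coefficients. *)
Lemma K_uniq h c : trace_ok h c -> (forall m, (m <= h1)%N -> c m = 0) ->
  forall m, (m <= h)%N -> c m = 0.
Proof.
move=> /(trace_okP HU) Hc c0 m; elim/ltn_ind: m => m IH mh.
case: (leqP m h1) => mh1; first exact: c0.
have [L HL] := row_fullP (sys_full mh1).
have := Hc m mh; rewrite big_ord_recr /= big1 ?add0r => [e|i _].
  by rewrite -[c m]mul1mx -HL -mulmxA e mulmx0.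
by rewrite IH ?mulmx0 // (leq_trans (ltnW (ltn_ord i))).
Qed.

Lemma trace_ok_le h h' c : (h <= h')%N -> trace_ok h' c -> trace_ok h c.
Proof.
move=> hh /(trace_okP HU) Hc; apply/(trace_okP HU) => j jh.
by apply: Hc; exact: leq_trans hh.
Qed.

Lemma trace_ok_lin h (a : C) c c' : trace_ok h c -> trace_ok h c' ->
  trace_ok h (fun m => a *: c m + c' m).
Proof.
move=> /(trace_okP HU) H /(trace_okP HU) H'; apply/(trace_okP HU) => j jh.
rewrite (eq_bigr (fun m : 'I_j.+1 => a *: (sysM j m *m c m) + sysM j m *m c' m)).
  by rewrite big_split /= -scaler_sumr H // H' // scaler0 addr0.
by move=> m _; rewrite mulmxDr scalemxAr.
Qed.

Lemma RfibE h J : Rfib W h k p J <-> exists2 c, trace_ok h c & J = Phi h c.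
Proof. exact: iff_trans (RfibP HM h J) (RlocP HU Hreg Hspan h J). Qed.

Lemma agree_all h c c' : (h1 <= h)%N -> trace_ok h c -> trace_ok h c' ->
  (forall m, (m <= h1)%N -> c m = c' m) -> forall m, (m <= h)%N -> c m = c' m.
Proof.
move=> hh Hc Hc' e m mh; apply/eqP; rewrite -subr_eq0 -scaleN1r addrC; apply/eqP.
apply: (K_uniq (trace_ok_lin (-1) Hc' Hc)) mh => m' mh'.
by rewrite e // scaleN1r addNr.
Qed.

(** Extend the element order by order; by [agree_all] the extensions of
    different orders have the same coefficients, and these form the formal
    solution. *)
Lemma formal_exists H J : (h1 <= H)%N ->
  (forall h, (H <= h)%N -> Rfib W h k p `<=` trunc h @` Rfib W h.+1 k p) ->
  Rfib W H k p J -> exists c, (forall h, trace_ok h c) /\ Phi H c = J.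
Proof.
move=> hH Hsurj /RfibE [cJ HcJ EJ].
(* Surjectivity, read on coefficients. *)
have step h c : (H <= h)%N -> trace_ok h c -> exists2 c', trace_ok h.+1 c' &
    forall m, (m <= h)%N -> c' m = c m.
  move=> Hh Hc; have : Rfib W h k p (Phi h c) by apply/RfibE; exists c.
  move=> /(Hsurj h Hh) [J' /RfibE [c' Hc' ->]] e; exists c' => //.
  apply: (Phi_inj HU Hreg (h := h)); rewrite -e.
  by rewrite (trunc_Phi HU Hreg c' (leqnSn h)).
have tower j : exists2 c, trace_ok (H + j) c & forall m, (m <= H)%N -> c m = cJ m.
  elim: j => [|j [c Hc ec]]; first by exists cJ; rewrite ?addn0.
  have [c' Hc' ec'] := step (H + j)%N c (leq_addr _ _) Hc.
  by exists c'; rewrite ?addnS // => m mH; rewrite ec' ?ec // (leq_trans mH) ?leq_addr.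
have [D HD] : {D : nat -> nat -> 'cV[C]_d & forall j, trace_ok (H + j) (D j) /\
    forall m, (m <= H)%N -> D j m = cJ m}.
  apply: (@choice _ _ (fun j c => trace_ok (H + j) c /\ forall m, (m <= H)%N -> c m = cJ m)) => j.
  by have [c ? ?] := tower j; exists c.
have agree j j' m : (j <= j')%N -> (m <= H + j)%N -> D j m = D j' m.
  move=> jj mj; have [t1 e1] := HD j; have [t2 e2] := HD j'.
  apply: (agree_all (h := H + j) _ t1 (trace_ok_le _ t2)) mj => //.
  - by rewrite (leq_trans hH) ?leq_addr.
  - by rewrite leq_add2l.
  by move=> m' mh; rewrite e1 ?e2 // (leq_trans mh).
have Dm m j : (m <= H + j)%N -> D m m = D j m.
  move=> mj; case: (leqP m j) => mj'; first by apply: agree => //; exact: leq_addl.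
  by apply/esym/agree => //; exact: ltnW.
exists (fun m => D m m); split.
  move=> h; apply/(trace_okP HU) => j jh.
  have [/(trace_ok_le (leq_addl H h)) /(trace_okP HU) t _] := HD h.
  rewrite -[RHS](t j jh); apply: eq_bigr => m _; congr (_ *m _).
  by apply: Dm; rewrite (leq_trans _ (leq_addl H h)) // (leq_trans _ jh) // -ltnS.
rewrite EJ; apply: Phi_ext => m mH; rewrite (Dm m 0%N) ?addn0 //.
by have [_ ->] := HD 0%N.
Qed.

Lemma Rfib_subsp h : subsp (Rfib W h k p).
Proof.
split.
  apply/RfibE; exists (fun=> 0); last by rewrite Phi0.
  by apply/(trace_okP HU) => j _; rewrite big1 // => m _; rewrite mulmx0.
move=> a J J' /RfibE [c Hc ->] /RfibE [c' Hc' ->]; apply/RfibE.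
exists (fun m => a *: c m + c' m); first exact: trace_ok_lin.
by rewrite (Phi_lin HU).
Qed.

Lemma trunc_Rfib h : (trunc h @` Rfib W h.+1 k p) `<=` Rfib W h k p.
Proof.
move=> _ [J /RfibE [c Hc ->] <-]; apply/RfibE; exists c.
  exact: trace_ok_le (leqnSn h) Hc.
exact: trunc_Phi.
Qed.

(** By [K_uniq], the truncations are injective from order h0 - 2 on. *)
Lemma jet_trunc_eq0 h h' J : (h1 <= h)%N -> (h <= h')%N -> Rfib W h' k p J ->
  trunc h J = 0 -> J = 0.
Proof.
move=> hh hh' /RfibE [c Hc ->]; rewrite (trunc_Phi HU Hreg c hh') => z.
have c0 := Phi_inj HU Hreg (etrans z (esym (Phi0 HU h))).
transitivity (Phi h' (fun=> 0)); last exact: Phi0.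
apply: Phi_ext.
apply: (K_uniq Hc) => m mh; apply: c0; exact: leq_trans hh.
Qed.

Lemma Rfib_eq h : Rfib W h k p = Rloc x0 U h.
Proof. by apply/seteqP; split => J /(RfibP HM). Qed.

Lemma Rfib_dim_lower h : exists2 r, has_dim (Rfib W h k p) r &
  (h.+1 * d <= r + betanum n h.+1)%N.
Proof.
exists (h.+1 * d - \rank (sysB x0 U h))%N.
  by rewrite Rfib_eq; exact: Rloc_dim.
by rewrite addnC -leq_subLR leq_sub2l // -(card_rows n0) rank_leq_col.
Qed.

Lemma Rfib_dim_base : has_dim (Rfib W h1 k p) (h1.+1 * d - betanum n h1.+1)%N.
Proof.
rewrite Rfib_eq -(card_rows n0) -(sysB_full (x0 := x0) (U := U)).
  exact: Rloc_dim.
exact: sys_free.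
Qed.

Lemma near_pt P : (\forall x \near x0, P x) <-> nearx x0 P.
Proof. exact: nearE_nm. Qed.

Definition relations : set (forms R n d) :=
  [set s | exists2 O, O x0 & abelian_relation W k O s].

Lemma relations_subsp : subsp relations.
Proof.
split.
  have c0 h : trace_ok h (fun=> 0).
    by apply/(trace_okP HU) => j _; rewrite big1 // => m _; rewrite mulmx0.
  have g0 (i : 'I_d) : hg x0 (fun=> 0 : C) by exact: hg_cst.
  have v0 i h : van h.+1 x0 (fun y => 0 - fser x0 U h (fun=> 0) i y).
    apply: van_ext (van0 _ _); exists 1 => // y _; rewrite /fser big1 ?subrr // => m _.
    by rewrite mxE mulr0.
  have [lg0 cl0 _] := formal_relation HU Hreg c0 g0 v0.
  have E : fsec U (fun _ _ => 0) = 0.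
    by apply/funext => i; apply/funext => y; apply/rowP => l; rewrite !mxE mul0r.
  by rewrite -E; exact: (closed_relation HM lg0).
move=> a s s' [A Ax [sA dA]] [A' Ax' [sA' dA']].
exists (A `&` A'); first by split.
have H x : (A `&` A') x -> (forall i, hgm x (s i)) /\ (forall i, hgm x (s' i)).
  by move=> [Axx Axx']; split; [exact: section_hgm Axx sA|exact: section_hgm Axx' sA'].
have E i l : (fun y => (a *: s + s') i y 0 l) = fun y => s i y 0 l * a + s' i y 0 l.
  apply/funext => y; rewrite -[LHS]/((a *: s i y + s' i y) 0 l) !mxE.
  by congr (_ + _); exact: mulrC.
have hZ i l x : hgm x (s i) -> hg x (fun y => s i y 0 l * a).
  by move=> h; apply: hgM; [exact: h|exact: hg_cst].
have [oA iA _ tA zA] := sA; have [oA' _ _ tA' zA'] := sA'.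
split; first split.
- exact: openI.
- by move=> x [/iA].
- move=> i x Axx; have [h h'] := H x Axx; apply: differentiable_rV => l; rewrite E.
  by apply: fdiffD; [exact: nearx_at (hZ i l x (h i))|exact: nearx_at (h' i 0 l)].
- move=> x i v [Axx Axx'] tv.
  rewrite (eq_bigr (fun l => a * (s i x 0 l * v 0 l) + s' i x 0 l * v 0 l)).
    by rewrite big_split /= -mulr_sumr (tA x i v Axx tv) (tA' x i v Axx' tv) mulr0 addr0.
  move=> l _; rewrite -[X in X * _]/((a *: s i x + s' i x) 0 l) !mxE.
  by rewrite mulrDl mulrA.
- move=> x [Axx Axx']; transitivity (a *: (\sum_i s i x) + \sum_i s' i x).
    by rewrite scaler_sumr -big_split.
  by rewrite zA // zA' // scaler0 addr0.
move=> x i Axx; have [h h'] := H x Axx.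
have h2 : hgm x ((a *: s + s') i).
  by move=> b l; rewrite ord1 E; exact: hgD (hZ i l x (h i)) (h' i 0 l).
apply/matrixP => l m; rewrite [RHS]mxE (nearx_at (dform_germ l m h2)) !E.
have P q b : pd q (fun y => s i y 0 b * a + s' i y 0 b) x =
    pd q (fun y => s i y 0 b) x * a + pd q (fun y => s' i y 0 b) x.
  by rewrite (pdD _ (hZ i b x (h i)) (h' i 0 b)) (pdZ _ _ (h i 0 b)).
rewrite !P.
have e : pd l (fun y => s i y 0 m) x - pd m (fun y => s i y 0 l) x = 0.
  by rewrite -(nearx_at (dform_germ l m (h i))) dA ?mxE //; case: Axx.
have e' : pd l (fun y => s' i y 0 m) x - pd m (fun y => s' i y 0 l) x = 0.
  by rewrite -(nearx_at (dform_germ l m (h' i))) dA' ?mxE //; case: Axx.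
move: e e'; move: (pd l _ x) (pd m _ x) (pd l _ x) (pd m _ x) => a1 a2 a3 a4.
by move=> /eqP; rewrite subr_eq0 => /eqP -> /eqP; rewrite subr_eq0 => /eqP ->; ring.
Qed.

(** The H-jet sends germs of abelian relations to R_H. It is injective because a
    relation with zero H-jet has all its jets zero by [jet_trunc_eq0], and
    surjective because formal solutions converge. *)
Lemma relations_dim H r : (h1 <= H)%N ->
  (forall h, (H <= h)%N -> Rfib W h k p `<=` trunc h @` Rfib W h.+1 k p) ->
  has_dim (Rfib W H k p) r ->
  has_dim_mod relations [set s | \forall x \near x0, forall i, s i x = 0] r.
Proof.
move=> hH Hsurj.
apply: (has_dim_modT (f := fun s => jet H s x0) relations_subsp _ _ _ _ r).2.
- move=> a s s' [A Ax [sA _]] [A' Ax' [sA' _]].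
  exact: (jet_lin H a (section_hgm Ax sA) (section_hgm Ax' sA')).
- by move=> s [A Ax sA]; exact: (relation_closed Ax sA H).
- move=> s [A Ax sA]; have hs := section_hgm Ax (proj1 sA).
  have [g [lg E]] := section_lsec HM Ax (proj1 sA).
  have hf := hgm_fsec HU (proj1 lg).
  split=> [/near_pt z|z].
    rewrite /= -(jet0 (d := d) 1 n H x0).
    apply: jet_germ hs (fun i => @hgm0 R n 1 n x0) _; apply: nearx_imp z => y zy i; exact: zy.
  apply/near_pt.
  have jz h : jet h (fsec U g) x0 = 0.
    rewrite -(jet_germ h hs hf E); case: (leqP h H) => hh.
      rewrite -(trunc_jet x0 s hh) (_ : jet H s x0 = 0) //.
      by apply/funext => b; apply/funext => i; rewrite /trunc; case: ifP.
    apply: (jet_trunc_eq0 hH (ltnW hh) (relation_closed Ax sA h)).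
    by rewrite (trunc_jet x0 s (ltnW hh)).
  have := fsec_germ0 HU Hreg (proj1 lg) jz.
  by move=> z0; apply: nearx_imp (nearx_and E z0) => y [Ey zy] i; rewrite Ey zy.
move=> J /(formal_exists hH Hsurj) [c [Hc <-]].
have [g [hgg Hg]] := formal_converges HU (ltn0Sn h1) (sys_full (ltnSn h1)) Hc Hreg.
have [lg cl jg] := formal_relation HU Hreg Hc hgg Hg.
by exists (fsec U g); [exact: closed_relation|rewrite jg].
Qed.

End Coordinates.

Lemma trunc_lin h (a : C) (J J' : jets n d V) :
  trunc h (a *: J + J') = a *: trunc h J + trunc h J'.
Proof.
apply/funext => b; apply/funext => i; rewrite /trunc.
rewrite -[RHS]/(a *: (if (degree b <= h)%N then J b i else 0) +
  (if (degree b <= h)%N then J' b i else 0)).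
by case: ifP => // _; rewrite scaler0 addr0.
Qed.

Lemma Rfib_dim_image h r : (h1 <= h)%N ->
  has_dim (Rfib W h.+1 k p) r <-> has_dim (trunc h @` Rfib W h.+1 k p) r.
Proof.
move=> hh; have [U HM] := model_exists hord Hk.
apply: (has_dim_modT (f := trunc h) (Rfib_subsp HM h.+1)).
- by move=> a u v _ _; exact: trunc_lin.
- by move=> J HJ; exists J.
- move=> J HJ; split=> [->|z].
    by apply/funext => b; apply/funext => i; rewrite /trunc; case: ifP.
  exact: (jet_trunc_eq0 HM hh (leqnSn h) HJ z).
by move=> _ [J HJ <-]; exists J.
Qed.

End Point.

(** * The sequence of ranks *)

Lemma subsp_trunc (R : realType) (n d h : nat) (S : set (jets n d 'rV[Cplx R]_n)) :
  subsp S -> subsp (trunc h @` S).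
Proof.
move=> [S0 SL]; split.
  exists 0 => //; apply/funext => b; apply/funext => i; rewrite /trunc.
  by case: ifP.
move=> a _ _ [J HJ <-] [J' HJ' <-]; exists (a *: J + J'); first exact: SL.
exact: trunc_lin.
Qed.

Lemma eventually_constant (f : nat -> nat) h1 : (forall h, (h1 <= h)%N -> (f h.+1 <= f h)%N) ->
  exists H, (h1 <= H)%N /\ forall h, (H <= h)%N -> f h = f H.
Proof.
move=> mono.
have mono2 h h' : (h1 <= h)%N -> (h <= h')%N -> (f h' <= f h)%N.
  move=> hh hh'; rewrite -(subnKC hh'); elim: (h' - h)%N => [|j IH]; first by rewrite addn0.
  rewrite addnS; apply: leq_trans (mono _ _) IH; exact: leq_trans hh (leq_addr _ _).
suff K v h : (h1 <= h)%N -> (f h < v)%N ->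
    exists H, (h1 <= H)%N /\ forall h, (H <= h)%N -> f h = f H by exact: (K _ h1 (leqnn _) (ltnSn _)).
elim: v h => [//|v IH] h hh fv.
have [[h' /andP [hh' ne]]|no] := pselect (exists h', (h <= h')%N && (f h' != f h)).
  apply: (IH h' (leq_trans hh hh')).
  by rewrite -ltnS; apply: leq_trans fv; rewrite ltnS ltn_neqAle ne mono2.
exists h; split=> // h' hh'; apply/eqP; apply: contra_notT no => ne.
by exists h'; rewrite hh'.
Qed.

(** All the numbers c(n, 1), ..., c(n, h0 - 1) are at most d. *)
Lemma betanum_le n d h1 : (cnum n h1.+1 < d)%N -> (betanum n h1.+1 <= h1.+1 * d)%N.
Proof.
move=> lo; rewrite /betanum big_add1 /= big_mkord.
rewrite -[X in (X * d)%N]card_ord -sum_nat_const; apply: leq_sum => i _.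
by apply: leq_trans (ltnW lo); exact: cnum_le.
Qed.

Lemma pi'numE n d h1 : (cnum n h1.+1 < d)%N ->
  pi'num n d h1.+2 = (h1.+1 * d - betanum n h1.+1)%N%:Z.
Proof.
move=> lo; rewrite -subzn ?betanum_le // /pi'num sumrB; congr (_ - _).
  by rewrite sumr_const_nat subSS subn0 -mulr_natr natz -PoszM mulnC.
by rewrite /betanum (big_morph Posz PoszD (erefl _)).
Qed.

Theorem mainTheorem2 (R : realType) (n d h0 : nat) (M : complexManifold R n)
    (W : web M d) (hn : (2 <= n)%N) (hd : (n < d)%N)
    (hh0 : (cnum n h0.-1 < d <= cnum n h0)%N)
    (hord : ordinary W)
    (hpi : forall h : nat, (h0 - 2 <= h)%N -> pi_constant_rank W h) :
  exists (rho : nat -> nat) (rhoW : nat),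
    (forall h : nat, (h0 - 2 <= h)%N -> R_has_rank W h (rho h)) /\
    web_rank W rhoW /\
    (rho (h0 - 2)%N)%:Z = pi'num n d h0 /\
    (exists H : nat, forall h : nat, (H <= h)%N -> rho h = rhoW) /\
    (forall h : nat, (h0 - 2 <= h)%N ->
      (h.+2 * d)%N%:Z - (betanum n h.+2)%:Z <= (rho h.+1)%:Z /\
      (rho h.+1 <= rho h)%N /\
      (rho h)%:Z <= pi'num n d h0).
Proof.
have n0 : (0 < n)%N by exact: ltnW.
(* The order h0 is at least 2 since c(n, 0) = 1 and c(n, 1) = n are less than d. *)
have [h1 eh] : exists h1, h0 = h1.+2.
  case: h0 hh0 {hpi} => [|[|h]] /andP [lo hi]; last by exists h.
    by move: (leq_trans lo hi); rewrite ltnn.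
  by move: (leq_trans hd hi); rewrite /cnum addn1 bin1 prednK // ltnn.
subst h0; move: hh0 hpi; rewrite subn2 /= => /andP [lo hi] hpi.
have [p0 _] := manifold_inhabited M.
have [k0 ak0 dk0] := atlas_cover p0; have K0 : chart_at p0 k0 by [].
have [U0 M0] := model_exists hord K0.
have [rho Hrho] : {rho : nat -> nat & forall h, (h1 <= h)%N -> R_has_rank W h (rho h)}.
  apply: (@choice _ _ (fun h r => (h1 <= h)%N -> R_has_rank W h r)) => h.
  case: (ltngtP h1 h) => [|lt|<-].
  - case: h => [//|h hh]; have [r Hr] := hpi h hh; exists r => _ p k Hk.
    by apply/(Rfib_dim_image hord hi Hk r hh); exact: Hr.
  - by exists 0%N.
  exists (h1.+1 * d - betanum n h1.+1)%N => _ p k Hk.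
  by have [U HM] := model_exists hord Hk; exact: Rfib_dim_base HM.
have base : rho h1 = (h1.+1 * d - betanum n h1.+1)%N.
  apply: (has_dim_uniq (Rfib_subsp M0 h1)); first exact: Hrho.
  exact: Rfib_dim_base M0.
have mono h : (h1 <= h)%N -> (rho h.+1 <= rho h)%N.
  move=> hh; apply: (has_dim_le (S := trunc h @` Rfib W h.+1 k0 p0) (S' := Rfib W h k0 p0)).
  - exact: subsp_trunc (Rfib_subsp M0 _).
  - exact: trunc_Rfib M0 h.
  - by apply/(Rfib_dim_image hord hi K0 _ hh); apply: Hrho => //; exact: leqW.
  exact: Hrho.
have le_base h : (h1 <= h)%N -> (rho h <= rho h1)%N.
  move=> hh; rewrite -(subnKC hh); elim: (h - h1)%N => [|j IH]; first by rewrite addn0.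
  by rewrite addnS; apply: leq_trans (mono _ (leq_addr _ _)) IH.
(* From H on the ranks are constant, so the truncations are bijective. *)
have [H [hH cH]] := eventually_constant mono.
have rk p : rank_at W p (rho H).
  move=> k Hk; have [U HM] := model_exists hord Hk.
  apply: (relations_dim hi HM hH); last exact: Hrho.
  move=> h Hh; have hh := leq_trans hH Hh.
  have dimg : has_dim (trunc h @` Rfib W h.+1 k p) (rho h).
    have -> : rho h = rho h.+1 by rewrite !cH // leqW.
    by apply/(Rfib_dim_image hord hi Hk _ hh); apply: Hrho => //; exact: leqW.
  have st := subsp_trunc h (Rfib_subsp HM h.+1).
  have sub := trunc_Rfib HM (h := h); have dR := Hrho h hh p k Hk.
  by move=> J HJ; exact: (has_dim_eq st sub dimg dR HJ).
exists rho, (rho H); split => //; split; first by split; [exists p0|move=> p; exists (rho H)].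
split; first by rewrite base pi'numE.
split; first by exists H.
move=> h hh; split; last by rewrite mono // pi'numE // -base lez_nat le_base.
have [r Hr le] := Rfib_dim_lower n0 M0 h.+1.
have -> : rho h.+1 = r.
  apply: (has_dim_uniq (Rfib_subsp M0 h.+1)) Hr; apply: Hrho => //; exact: leqW.
by rewrite lerBlDr -PoszD lez_nat.
Qed.
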